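(* Let $R$ be a Lie conformal algebra and let $M$ be an $R$-module endowed with the structure of a commutative associative algebra on which $\partial^M$ and $a_\lambda$, $a\in R$, act by derivations. For $X=a_1\otimes\cdots\otimes a_h\otimes\phi\in C_h(R,M)$ and $c\in C^k(R,M)$ let $$(\iota_Xc)_{\lambda_{h+1},\dots,\lambda_k}(a_{h+1},\dots,a_k)=(-1)^{\frac{h(h-1)}2}\phi(\partial_{\lambda_1},\dots,\partial_{\lambda_h})\,c_{\lambda_1,\dots,\lambda_k}(a_1,\dots,a_k)\Big|_{\lambda_1=\cdots=\lambda_h=0}\in C^{k-h}(R,M)$$ ($\iota_Xc=0$ if $h>k$), and let $L_X=[\iota_X,d]$. Then the contraction map $\iota_\cdot:C_\bullet(R,M)\to\mathrm{End}(C^\bullet(R,M))$ and the Lie derivative map $L_\cdot:\Pi C_\bullet(R,M)\to\mathrm{End}(C^\bullet(R,M))$ define a $\mathbb Z_+$-graded calculus structure of the Gerstenhaber algebra $C_\bullet(R,M)$ on the complex $(C^\bullet(R,M),d)$.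
   Context: $\mathbb F$ is a field of characteristic $0$; tensor products are over $\mathbb F$ unless indicated. $\Pi$ denotes parity reversal; $\mathrm{End}(V)$ carries the supercommutator $[P,Q]=PQ-(-1)^{p(P)p(Q)}QP$. A *Lie conformal algebra* $R$ is an $\mathbb F[\partial]$-module with an $\mathbb F$-linear $\lambda$-bracket $R\otimes R\to\mathbb F[\lambda]\otimes R$, $a\otimes b\mapsto[a_\lambda b]$, such that $[\partial a_\lambda b]=-\lambda[a_\lambda b]$, $[a_\lambda\partial b]=(\partial+\lambda)[a_\lambda b]$, $[a_\lambda b]=-[b_{-\lambda-\partial}a]$ ($\partial$ moved to the left), $[a_\lambda[b_\mu c]]-[b_\mu[a_\lambda c]]=[[a_\lambda b]_{\lambda+\mu}c]$. Write $[a_\lambda b]=\sum_j\frac{\lambda^j}{j!}a_{(j)}b$. An *$R$-module* $M$ is an $\mathbb F[\partial]$-module (action of $\partial$ denoted $\partial^M$) with a $\lambda$-action $R\otimes M\to\mathbb F[\lambda]\otimes M$, $a\otimes m\mapsto a_\lambda m=\sum_n\frac{\lambda^n}{n!}a_nm$, such that $(\partial a)_\lambda m=-\lambda a_\lambda m$, $a_\lambda(\partial^Mm)=(\partial^M+\lambda)(a_\lambda m)$, $a_\lambda(b_\mu m)-b_\mu(a_\lambda m)=[a_\lambda b]_{\lambda+\mu}m$. Derivation means $a_\lambda(mn)=(a_\lambda m)n+m(a_\lambda n)$, and similarly for $\partial^M$. *Cochains.* $\mathbb F_-[\lambda_1,\dots,\lambda_k]$ is the polynomial space with $\partial$ acting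 as multiplication by $-(\lambda_1+\cdots+\lambda_k)$, so $\mathbb F_-[\lambda_1,\dots,\lambda_k]\otimes_{\mathbb F[\partial]}M$ is the quotient of $\mathbb F[\lambda_1,\dots,\lambda_k]\otimes M$ by the image of $\lambda_1+\cdots+\lambda_k+\partial^M$. $C^k(R,M)$ is the space of $\mathbb F$-linear maps $c:R^{\otimes k}\to\mathbb F_-[\lambda_1,\dots,\lambda_k]\otimes_{\mathbb F[\partial]}M$, $a_1\otimes\cdots\otimes a_k\mapsto c_{\lambda_1,\dots,\lambda_k}(a_1,\dots,a_k)$, with $c_{\lambda_1,\dots,\lambda_k}(a_1,\dots,\partial a_i,\dots,a_k)=-\lambda_ic_{\lambda_1,\dots,\lambda_k}(a_1,\dots,a_k)$ and $c_{\lambda_{\sigma(1)},\dots,\lambda_{\sigma(k)}}(a_{\sigma(1)},\dots,a_{\sigma(k)})=\mathrm{sign}(\sigma)c_{\lambda_1,\dots,\lambda_k}(a_1,\dots,a_k)$, $\sigma\in S_k$; so $C^0(R,M)=M/\partial^MM$. $C^\bullet(R,M)=\bigoplus_{k\ge0}C^k(R,M)$, with parity induced by the grading, is a complex with $$(dc)_{\lambda_1,\dots,\lambda_{k+1}}(a_1,\dots,a_{k+1})=\sum_{i=1}^{k+1}(-1)^{i+1}{a_i}_{\lambda_i}\big(c_{\lambda_1,\dots\widehat{\lambda_i}\dots,\lambda_{k+1}}(a_1,\dots\widehat{a_i}\dots,a_{k+1})\big)+\sum_{i<j}(-1)^{j+1}c_{\lambda_1,\dots,\lambda_i+\lambda_j,\dots\widehat{\lambda_j}\dots,\lambda_{k+1}}(a_1,\dots,[{a_i}_{\lambda_i}a_j],\dots\widehat{a_j}\dots,a_{k+1}),$$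 where $\lambda_i+\lambda_j$ and $[{a_i}_{\lambda_i}a_j]$ are in position $i$. *Chains.* $\partial^M$ and $a_\lambda$ act on $M[[x_1,\dots,x_k]]$ coefficientwise. $\mathcal M_k\subset M[[x_1,\dots,x_k]]$ is the subspace of $\phi$ with $(\partial_{x_1}+\cdots+\partial_{x_k})\phi=\partial^M\phi$. $S_k$ acts by $(\sigma\phi)(x_1,\dots,x_k)=\phi(x_{\sigma(1)},\dots,x_{\sigma(k)})$ and $\sigma(a_1\otimes\cdots\otimes a_k)=a_{\sigma^{-1}(1)}\otimes\cdots\otimes a_{\sigma^{-1}(k)}$. $C_k(R,M)$ is the quotient of $R^{\otimes k}\otimes\mathcal M_k$ by the relations $a_1\otimes\cdots\partial a_i\cdots\otimes a_k\otimes\phi+a_1\otimes\cdots\otimes a_k\otimes\partial_{x_i}\phi=0$ and $\sigma(a_1\otimes\cdots\otimes a_k)\otimes\sigma\phi=\mathrm{sign}(\sigma)a_1\otimes\cdots\otimes a_k\otimes\phi$. $C_\bullet(R,M)=\bigoplus_kC_k(R,M)$ (parity induced by the grading) is a $\mathbb Z_+$-graded Gerstenhaber algebra with $$\big(a_1\otimes\cdots\otimes a_h\otimes\phi\big)\wedge\big(a_{h+1}\otimes\cdots\otimes a_k\otimes\psi\big)=a_1\otimes\cdots\otimes a_k\otimes\phi(x_1,\dots,x_h)\psi(x_{h+1},\dots,x_k),$$ $$\begin{aligned}&[a_1\otimes\cdots\otimes a_h\otimes\phi,\;a_{h+1}\otimes\cdots\otimes a_k\otimes\psi]\\&=\sum_{i=1}^h\sum_{j=h+1}^k(-1)^{h+j+1}\big(a_1\otimes\cdots\overset{i}{[{a_i}_{\partial_{x_i}}a_j]}\cdots\widehat{a_j}\cdots\otimes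 a_k\otimes\phi(x_1,\dots,x_h)\psi(x_{h+1},\dots,\overset{j}{y},\dots,x_{k-1})\big)\Big|_{y=x_i}\\&+\sum_{i=1}^h(-1)^{h+i}a_1\otimes\cdots\widehat{a_i}\cdots\otimes a_k\otimes\big({a_i}_{\partial_y}\psi(x_h,\dots,x_{k-1})\big)\phi(x_1,\dots,\overset{i}{y},\dots,x_{h-1})\Big|_{y=0}\\&+\sum_{i=h+1}^k(-1)^{h+i}a_1\otimes\cdots\widehat{a_i}\cdots\otimes a_k\otimes\big({a_i}_{\partial_y}\phi(x_1,\dots,x_h)\big)\psi(x_{h+1},\dots,\overset{i}{y},\dots,x_{k-1})\Big|_{y=0}.\end{aligned}$$ Here $\overset{j}{y}$ means that $y$ is inserted in place of $x_j$, the variables $x_\ell$, $\ell\ge j$, being shifted to the right (e.g. $\psi(x_{h+1},\dots,x_{j-1},y,x_j,\dots,x_{k-1})$); $[{a_i}_{\partial_{x_i}}a_j]=\sum_l(a_{i(l)}a_j)\frac{\partial_{x_i}^l}{l!}$ is in position $i$, with $\partial_{x_i}$ acting on the series before setting $y=x_i$; $({a_i}_{\partial_y}\psi)\phi|_{y=0}=\sum_n\frac1{n!}(a_{i,n}\psi)(\partial_y^n\phi)|_{y=0}$, with $a_{i,n}$ the $n$-th coefficient operator of ${a_i}_\lambda$ acting coefficientwise. *Contraction.* In the formula for $\iota_X$, one lifts $c_{\lambda_1,\dots,\lambda_k}(a_1,\dots,a_k)$ to $\mathbb F[\lambda_1,\dots,\lambda_k]\otimes M$, applies $\phi(\partial_{\lambda_1},\dots,\partial_{\lambda_h})$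 (coefficients of $\phi$ act by multiplication in $M$), sets $\lambda_1=\cdots=\lambda_h=0$ and projects to $\mathbb F_-[\lambda_{h+1},\dots,\lambda_k]\otimes_{\mathbb F[\partial]}M$ (to $M/\partial^MM$ if $h=k$); the result is independent of the lift. *Calculus structure.* A Gerstenhaber algebra is a superspace $\mathcal G$ with parity $p$, such that $(\mathcal G,\wedge)$ is a commutative associative superalgebra, $(\Pi\mathcal G,[\cdot,\cdot])$ is a Lie superalgebra and $[X,Y\wedge Z]=[X,Y]\wedge Z+(-1)^{(p(X)+\bar1)p(Y)}Y\wedge[X,Z]$. A calculus structure $(\mathcal G,\Omega)$ of $\mathcal G$ on a complex $(\Omega,d)$ is a module structure $X\mapsto\iota_X$ of $\Omega$ over the superalgebra $(\mathcal G,\wedge)$ and a module structure $X\mapsto L_X$ over the Lie superalgebra $\Pi\mathcal G$, with $[L_X,\iota_Y]=\iota_{[X,Y]}$ and $L_X=[\iota_X,d]$ for all $X,Y$. It is $\mathbb Z_+$-graded if $\iota_X\Omega^n\subset\Omega^{n-m}$ and $L_X\Omega^n\subset\Omega^{n-m+1}$ for $X\in\mathcal G_m$ (with $\Omega^n=0$ for $n<0$). *)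

(* Defs.v *)
From HB Require Import structures.
From mathcomp Require Import fingroup perm all_boot all_algebra.
From mathcomp Require Import boolp functions.

Set Implicit Arguments.
Unset Strict Implicit.
Unset Printing Implicit Defensive.

Import GRing.Theory.
Local Open Scope ring_scope.
Local Open Scope quotient_scope.

Lemma linear_fun0 (F : fieldType) (U W : lmodType F) (f : U -> W) :
  linear f -> f 0 = 0.
Proof. by move=> /(_ (-1) 0 0); rewrite scaler0 addr0 scaleN1r addNr. Qed.

Section DirectSum.
Variables (F : fieldType) (I : choiceType) (V : I -> lmodType F).

Record dsum := Dsum {
  dcoef :> forall i, V i;
  dcoef_finite : exists s : seq I, forall i, dcoef i != 0 -> i \in s }.

HB.instance Definition _ := gen_eqMixin dsum.
HB.instance Definition _ := gen_choiceMixin dsum.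

Lemma dsumP (x y : dsum) : (forall i, x i = y i) -> x = y.
Proof.
case: x y => x hx [y hy] /= exy.
have e : x = y by apply: functional_extensionality_dep.
by case: y / e hy {exy} => hy; congr Dsum; apply: Prop_irrelevance.
Qed.

Lemma dsum0_subproof :
  exists s : seq I, forall i, (fun i => 0 : V i) i != 0 -> i \in s.
Proof. by exists [::] => i /=; rewrite eqxx. Qed.

Lemma dsumN_subproof (x : dsum) :
  exists s : seq I, forall i, - x i != 0 -> i \in s.
Proof.
by case: (dcoef_finite x) => s hs; exists s => i; rewrite oppr_eq0 => /hs.
Qed.

Lemma dsumD_subproof (x y : dsum) :
  exists s : seq I, forall i, x i + y i != 0 -> i \in s.
Proof.
case: (dcoef_finite x) (dcoef_finite y) => s hs [t ht]; exists (s ++ t) => i.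
apply: contraR; rewrite mem_cat negb_or => /andP[nis nit].
have /negbNE/eqP-> := contra (hs i) nis.
by have /negbNE/eqP-> := contra (ht i) nit; rewrite addr0.
Qed.

Lemma dsumZ_subproof (a : F) (x : dsum) :
  exists s : seq I, forall i, a *: x i != 0 -> i \in s.
Proof.
case: (dcoef_finite x) => s hs; exists s => i h; apply: hs.
by apply: contraNneq h => ->; rewrite scaler0.
Qed.

Definition dsum0 := Dsum dsum0_subproof.
Definition dsumN x := Dsum (dsumN_subproof x).
Definition dsumD x y := Dsum (dsumD_subproof x y).
Definition dsumZ a x := Dsum (dsumZ_subproof a x).

Lemma dsumDA : associative dsumD.
Proof. by move=> x y z; apply: dsumP => i /=; rewrite addrA. Qed.
Lemma dsumDC : commutative dsumD.
Proof. by move=> x y; apply: dsumP => i /=; rewrite addrC. Qed.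
Lemma dsum0D : left_id dsum0 dsumD.
Proof. by move=> x; apply: dsumP => i /=; rewrite add0r. Qed.
Lemma dsumND : left_inverse dsum0 dsumN dsumD.
Proof. by move=> x; apply: dsumP => i /=; rewrite addNr. Qed.

HB.instance Definition _ := GRing.isZmodule.Build dsum dsumDA dsumDC dsum0D dsumND.

Lemma dsumZA a b x : dsumZ a (dsumZ b x) = dsumZ (a * b) x.
Proof. by apply: dsumP => i /=; rewrite scalerA. Qed.
Lemma dsum1Z : left_id 1 dsumZ.
Proof. by move=> x; apply: dsumP => i /=; rewrite scale1r. Qed.
Lemma dsumZDr : right_distributive dsumZ +%R.
Proof. by move=> a x y; apply: dsumP => i /=; rewrite scalerDr. Qed.
Lemma dsumZDl x : {morph dsumZ^~ x : a b / a + b}.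
Proof. by move=> a b; apply: dsumP => i /=; rewrite scalerDl. Qed.

HB.instance Definition _ :=
  GRing.Zmodule_isLmodule.Build F dsum dsumZA dsum1Z dsumZDr dsumZDl.

Lemma dsum0E i : (0 : dsum) i = 0. Proof. by []. Qed.
Lemma dsumDE (x y : dsum) i : (x + y) i = x i + y i. Proof. by []. Qed.
Lemma dsumNE (x : dsum) i : (- x) i = - x i. Proof. by []. Qed.
Lemma dsumZE a (x : dsum) i : (a *: x) i = a *: x i. Proof. by []. Qed.

Definition dinj_fun i (v : V i) (j : I) : V j :=
  if pselect (i = j) is left e then ecast j (V j) e v else 0.

Lemma dinj_subproof i (v : V i) :
  exists s : seq I, forall j, dinj_fun v j != 0 -> j \in s.
Proof.
exists [:: i] => j; rewrite /dinj_fun inE; case: pselect => [e _|_].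
  by apply/eqP.
by rewrite eqxx.
Qed.

Definition dinj i (v : V i) : dsum := Dsum (dinj_subproof v).

Definition supp (x : dsum) : seq I :=
  [seq i <- undup (projT1 (cid (dcoef_finite x))) | x i != 0].

Lemma mem_supp (x : dsum) i : (i \in supp x) = (x i != 0).
Proof.
rewrite mem_filter mem_undup; case: cid => s hs /=.
by case: eqP => //= /eqP /hs.
Qed.

Lemma supp_uniq (x : dsum) : uniq (supp x).
Proof. exact/filter_uniq/undup_uniq. Qed.

End DirectSum.

Arguments dinj {F I} V i v.

Section Quotient.
Variables (F : fieldType) (V : lmodType F).

Definition lspan (G : V -> Prop) : {pred V} := fun v =>
  `[< forall S : V -> Prop, S 0 ->
      (forall a u w, S u -> S w -> S (a *: u + w)) ->
      (forall g, G g -> S g) -> S v >].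

Lemma lspanP (G : V -> Prop) v : reflect (forall S : V -> Prop, S 0 ->
      (forall a u w, S u -> S w -> S (a *: u + w)) ->
      (forall g, G g -> S g) -> S v) (v \in lspan G).
Proof. exact: asboolP. Qed.

Lemma lspan_closed G : submod_closed (lspan G).
Proof.
split=> [|a u v /lspanP hu /lspanP hv]; apply/lspanP => S S0 SL SG //.
exact: SL (hu _ S0 SL SG) (hv _ S0 SL SG).
Qed.

HB.instance Definition _ G := GRing.isSubmodClosed.Build F V (lspan G) (lspan_closed G).

Lemma lspan_gen (G : V -> Prop) g : G g -> g \in lspan G.
Proof. by move=> hg; apply/lspanP => S _ _ /(_ _ hg). Qed.

Variable G : V -> Prop.

Definition lquot := Quotient.quot (lspan G).
HB.instance Definition _ := GRing.Zmodule.on lquot.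

Definition lpi (v : V) : lquot := \pi_lquot v.

Lemma lpi_eqP (u v : V) : lpi u = lpi v <-> u - v \in lspan G.
Proof.
split=> [/eqP|h]; first by rewrite -Quotient.idealrBE.
by apply/eqP; rewrite -Quotient.idealrBE.
Qed.

Lemma lpi_repr (q : lquot) : lpi (repr q) = q.
Proof. exact: reprK. Qed.

Lemma lpiD u v : lpi (u + v) = lpi u + lpi v.
Proof. by rewrite /lpi !piE. Qed.

Definition lquot_scale (a : F) (q : lquot) : lquot := lpi (a *: repr q).

Lemma lquot_scaleE a v : lquot_scale a (lpi v) = lpi (a *: v).
Proof.
by apply/lpi_eqP; rewrite -scalerBr rpredZ //; apply/lpi_eqP; rewrite lpi_repr.
Qed.

Lemma lquot_scaleA a b q : lquot_scale a (lquot_scale b q) = lquot_scale (a * b) q.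
Proof. by rewrite -[q]lpi_repr !lquot_scaleE scalerA. Qed.
Lemma lquot_scale1 : left_id 1 lquot_scale.
Proof. by move=> q; rewrite -[q]lpi_repr !lquot_scaleE scale1r. Qed.
Lemma lquot_scaleDr : right_distributive lquot_scale +%R.
Proof.
move=> a p q; rewrite -[q]lpi_repr -[p]lpi_repr -lpiD !lquot_scaleE.
by rewrite scalerDr lpiD.
Qed.
Lemma lquot_scaleDl q : {morph lquot_scale^~ q : a b / a + b}.
Proof. by move=> a b; rewrite -[q]lpi_repr !lquot_scaleE scalerDl lpiD. Qed.

HB.instance Definition _ := GRing.Zmodule_isLmodule.Build F lquot
  lquot_scaleA lquot_scale1 lquot_scaleDr lquot_scaleDl.

Lemma lpi_linear : linear lpi.
Proof. by move=> a u v; rewrite lpiD -lquot_scaleE. Qed.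

HB.instance Definition _ := GRing.isLinear.Build F V lquot _ lpi lpi_linear.

End Quotient.

Section QuotientMap.
Variables (F : fieldType) (V W : lmodType F) (G : V -> Prop) (H : W -> Prop).
Variables (f : V -> W).
Hypotheses (lf : linear f) (fGH : forall g, G g -> f g \in lspan H).

Definition lquot_map (q : lquot G) : lquot H := lpi H (f (repr q)).

Lemma lquot_mapE v : lquot_map (lpi G v) = lpi H (f v).
Proof.
have f0 := linear_fun0 lf.
have fN u w : f (u - w) = f u - f w.
  by rewrite -scaleN1r addrC lf scaleN1r addrC.
apply/lpi_eqP; rewrite -fN.
have /lpi_eqP/lspanP h := lpi_repr (lpi G v).
apply: (h (fun u => f u \in lspan H)) => [|a u w hu hw|g /fGH //].
  by rewrite f0 rpred0.
by rewrite lf rpredD ?rpredZ.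
Qed.

Lemma lquot_map_linear : linear lquot_map.
Proof.
move=> a p q; rewrite -[p]lpi_repr -[q]lpi_repr -linearP !lquot_mapE lf.
exact: linearP.
Qed.

End QuotientMap.

(* Families of elements of V indexed by K with finite support; F[lambda] (x) V
   is the case K = nat, the family being that of the coefficients of the powers
   of lambda (not of the divided powers lambda^j / j!) *)
Notation finfam K V := (dsum (fun _ : K => V)).

Definition mono (F : fieldType) (K : choiceType) (V : lmodType F) (k : K) (v : V) :
  finfam K V := dinj (fun _ => V) k v.

Section LinearExtension.
Variables (F : fieldType) (K : choiceType).

(* the linear map sending mono k v to f k v *)
Definition lext (V W : lmodType F) (f : K -> V -> W) (p : finfam K V) : W :=
  \sum_(k <- supp p) f k (p k).

Lemma lext_widen (V W : lmodType F) (f : K -> V -> W) (p : finfam K V) (s : seq K) :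
  (forall k, f k 0 = 0) -> uniq s -> {subset supp p <= s} ->
  lext f p = \sum_(k <- s) f k (p k).
Proof.
move=> f0 us sub; rewrite /lext [RHS](bigID (mem (supp p))) /=.
rewrite [X in _ = _ + X]big1 ?addr0; last first.
  by move=> k; rewrite mem_supp negbK => /eqP->.
rewrite -[RHS]big_filter; apply: perm_big.
apply: uniq_perm (supp_uniq p) (filter_uniq _ us) _ => k.
by rewrite mem_filter; case: (boolP (k \in supp p)) => //= /sub ->.
Qed.

Lemma lext_linear (V W : lmodType F) (f : K -> V -> W) :
  (forall k, linear (f k)) -> linear (lext f).
Proof.
move=> lf; have f0 k := linear_fun0 (lf k).
move=> a p q; set s := undup (supp p ++ supp q).
have us : uniq s := undup_uniq _.
have subp : {subset supp p <= s} by move=> k; rewrite mem_undup mem_cat => ->.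
have subq : {subset supp q <= s}.
  by move=> k; rewrite mem_undup mem_cat orbC => ->.
have subr : {subset supp (a *: p + q) <= s}.
  move=> k; apply: contraLR => nks; rewrite mem_supp negbK dsumDE dsumZE.
  have /negbNE/eqP-> : ~~ (p k != 0) by rewrite -mem_supp; apply: contra nks => /subp.
  have /negbNE/eqP-> : ~~ (q k != 0) by rewrite -mem_supp; apply: contra nks => /subq.
  by rewrite scaler0 addr0.
rewrite (lext_widen f0 us subp) (lext_widen f0 us subq) (lext_widen f0 us subr).
by rewrite scaler_sumr -big_split /=; apply: eq_bigr => k _; rewrite lf.
Qed.

Lemma mono_linear (V : lmodType F) (k : K) : linear (@mono F K V k).
Proof.
move=> a u v; apply: dsumP => j; rewrite dsumDE dsumZE /= /dinj_fun.
by case: pselect => [e|_]; [case: j / e | rewrite scaler0 addr0].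
Qed.

Lemma lext_mono (V W : lmodType F) (f : K -> V -> W) k v :
  f k 0 = 0 -> lext f (mono k v) = f k v.
Proof.
move=> f0; have mk : (mono k v) k = v.
  by rewrite /= /dinj_fun; case: pselect => // e; rewrite (Prop_irrelevance e erefl).
have mj j : j != k -> (mono k v) j = 0.
  move=> /eqP njk; rewrite /= /dinj_fun.
  by case: pselect => // e; case: njk.
rewrite /lext; have [v0|vn0] := eqVneq v 0.
  rewrite big1_seq ?v0 ?f0 // => j /=; rewrite -v0.
  rewrite mem_supp; have [->|njk] := eqVneq j k; last by rewrite mj ?eqxx.
  by rewrite mk v0 eqxx.
have pm : perm_eq (supp (mono k v)) [:: k].
  apply: uniq_perm (supp_uniq _) _ _ => // j; rewrite mem_supp inE.
  by have [->|njk] := eqVneq j k; [rewrite mk | rewrite mj ?eqxx].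
by rewrite (perm_big _ pm) big_seq1 mk.
Qed.

Definition fmap (V W : lmodType F) (f : V -> W) : finfam K V -> finfam K W :=
  lext (fun k v => mono k (f v)).

Lemma mono_ext (V W : lmodType F) (f g : finfam K V -> W) :
  linear f -> linear g -> (forall k v, f (mono k v) = g (mono k v)) -> f =1 g.
Proof.
move=> lf lg fg p.
have -> : p = \sum_(k <- supp p) mono k (p k).
  rewrite -/(lext (fun k v => mono k v) p); apply: dsumP => j.
  have -> : lext (fun k v => mono k v) p j = lext (fun k v => mono k v j) p.
    rewrite /lext; elim: (supp p) => [|k s ih]; first by rewrite !big_nil.
    by rewrite !big_cons dsumDE ih.
  have h k : linear (fun v : V => (mono k v : finfam K V) j).
    by move=> a u v; rewrite mono_linear.
  have h0 k : (mono k (0 : V) : finfam K V) j = 0 := linear_fun0 (h k).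
  rewrite (@lext_widen _ _ _ _ (undup (j :: supp p))) ?undup_uniq //; last first.
    by move=> k kp; rewrite mem_undup inE kp orbT.
  rewrite (bigD1_seq j) ?undup_uniq ?mem_undup ?mem_head //= big1 ?addr0.
    by rewrite /dinj_fun; case: pselect => // e; rewrite (Prop_irrelevance e erefl).
  by move=> k /eqP nkj; rewrite /dinj_fun; case: pselect.
have f0 := linear_fun0 lf.
have g0 := linear_fun0 lg.
elim: (supp p) => [|k s ih]; first by rewrite big_nil f0 g0.
by rewrite big_cons -[mono _ _]scale1r lf lg fg ih.
Qed.

(* multiplication by the monomial whose effect on exponents is s *)
Definition shift (V : lmodType F) (s : K -> K) : finfam K V -> finfam K V :=
  lext (fun k v => mono (s k) v).

End LinearExtension.

Definition upd (k : nat) (T : Type) (a : 'I_k -> T) (i : 'I_k) (x : T) : 'I_k -> T :=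
  fun j => if j == i then x else a j.

Definition catf (T : Type) (h k : nat) (a : 'I_h -> T) (b : 'I_k -> T) :
    'I_(h + k) -> T :=
  fun i => match fintype.split i with inl j => a j | inr j => b j end.

Definition expo (k : nat) : Type := 'I_k -> nat.
HB.instance Definition _ k := Choice.copy (expo k) ('I_k -> nat).

(* insertion of the value n at position i, the later positions being shifted *)
Definition ins (N : nat) (i : 'I_N) (n : nat) (m : expo N.-1) : expo N :=
  fun l => if unlift i l is Some l' then m l' else n.

(* F[lambda_0, ..., lambda_(k-1)] (x) V *)
Notation vpoly k V := (finfam (expo k) V).

Section Polynomials.
Variable F : fieldType.
Implicit Types (k : nat) (V W : lmodType F).

(* multiplication by lambda on F[lambda] (x) V *)
Definition mulX1 V : finfam nat V -> finfam nat V := shift S.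

(* multiplication by lambda and by mu on F[lambda, mu] (x) V *)
Definition mulL V : finfam (nat * nat)%type V -> finfam (nat * nat)%type V :=
  shift (fun e => (e.1.+1, e.2)).
Definition mulM V : finfam (nat * nat)%type V -> finfam (nat * nat)%type V :=
  shift (fun e => (e.1, e.2.+1)).

Definition mulX k V (i : 'I_k) : vpoly k V -> vpoly k V :=
  shift (fun m : expo k => upd m i (m i).+1 : expo k).

(* p(lambda_(s 0), ..., lambda_(s (k-1))) *)
Definition permX k V (s : 'S_k) : vpoly k V -> vpoly k V :=
  lext (fun (m : expo k) v => mono (m \o (s^-1)%g : expo k) v).

(* p(lambda_0, ..., lambda_i + lambda_j, ..., omit lambda_j, ..., lambda_k),
   the sum being in position i < j *)
Definition mergeX k V (i j : 'I_k.+1) : vpoly k V -> vpoly k.+1 V :=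
  lext (fun (m : expo k) v => let m' : expo k.+1 := ins j 0 m in
    iter (m' i) (fun q => mulX i q + mulX j q) (mono (upd m' i 0%N : expo k.+1) v)).

Lemma mulX_linear k V i : linear (@mulX k V i).
Proof. by apply: lext_linear => m; apply: mono_linear. Qed.

Lemma permX_linear k V s : linear (@permX k V s).
Proof. by apply: lext_linear => m; apply: mono_linear. Qed.

Lemma fmap_linear (K : choiceType) V W (f : V -> W) :
  linear f -> linear (@fmap F K V W f).
Proof. by move=> lf; apply: lext_linear => m a u v; rewrite lf mono_linear. Qed.

(* derivative of a power series with respect to x_i *)
Definition derX k V (i : 'I_k) (phi : expo k -> V) : expo k -> V :=
  fun m => phi (upd m i (m i).+1) *+ (m i).+1.

(* phi(x_(s 0), ..., x_(s (k-1))) for a power series phi *)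
Definition permS k V (s : 'S_k) (phi : expo k -> V) : expo k -> V :=
  fun m => phi (m \o s).

End Polynomials.

Section LambdaActions.
Variables (F : fieldType) (R V : lmodType F).
Variables (DR : R -> R) (DV : V -> V).
Variables (br : R -> R -> finfam nat R) (act : R -> V -> finfam nat V).

Definition bilinear_op (U1 U2 W : lmodType F) (f : U1 -> U2 -> W) : Prop :=
  (forall v, linear (f^~ v)) /\ (forall u, linear (f u)).

Definition sesquilinear : Prop :=
  (forall a v, act (DR a) v = - mulX1 (act a v)) /\
  (forall a v, act a (DV v) = fmap DV (act a v) + mulX1 (act a v)).

(* a_lambda (b_mu v) *)
Definition act_lm (a b : R) (v : V) : finfam (nat * nat)%type V :=
  lext (fun n w => lext (fun m u => mono (m, n) u) (act a w)) (act b v).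

(* b_mu (a_lambda v) *)
Definition act_ml (a b : R) (v : V) : finfam (nat * nat)%type V :=
  lext (fun m w => lext (fun n u => mono (m, n) u) (act b w)) (act a v).

(* [a_lambda b]_(lambda + mu) v *)
Definition act_br (a b : R) (v : V) : finfam (nat * nat)%type V :=
  lext (fun l r => lext (fun n u =>
      iter l (@mulL F V) (iter n (fun p => mulL p + mulM p) (mono (0%N, 0%N) u)))
    (act r v)) (br a b).

Definition lambda_jacobi : Prop :=
  forall a b v, act_lm a b v - act_ml a b v = act_br a b v.

End LambdaActions.

(* p(- lambda - D), the powers of D being moved to the left *)
Definition skew_subst (F : fieldType) (R : lmodType F) (D : R -> R)
    (p : finfam nat R) : finfam nat R :=
  lext (fun n v => iter n (fun q => - mulX1 q - fmap D q) (mono 0%N v)) p.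

Record lieConformalAlgebra (F : fieldType) := LieConformalAlgebra {
  lca_sort :> lmodType F;
  lca_D : lca_sort -> lca_sort;
  lca_br : lca_sort -> lca_sort -> finfam nat lca_sort;
  lca_D_linear : linear lca_D;
  lca_br_bilinear : bilinear_op lca_br;
  lca_br_sesquilinear : sesquilinear lca_D lca_D lca_br;
  lca_br_skew : forall a b, lca_br a b = - skew_subst lca_D (lca_br b a);
  lca_br_jacobi : lambda_jacobi lca_br lca_br }.

Record lcaModule (F : fieldType) (R : lieConformalAlgebra F) := LcaModule {
  lcm_sort :> lmodType F;
  lcm_D : lcm_sort -> lcm_sort;
  lcm_act : R -> lcm_sort -> finfam nat lcm_sort;
  lcm_D_linear : linear lcm_D;
  lcm_act_bilinear : bilinear_op lcm_act;
  lcm_act_sesquilinear : sesquilinear (@lca_D F R) lcm_D lcm_act;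
  lcm_act_jacobi : lambda_jacobi (@lca_br F R) lcm_act }.

(* R-modules with a commutative associative (not necessarily unital) product
   on which the derivation of the module and the lambda-action act by derivations *)
Record lcaModuleAlgebra (F : fieldType) (R : lieConformalAlgebra F) :=
  LcaModuleAlgebra {
  lcma_module :> lcaModule R;
  lcma_mul : lcma_module -> lcma_module -> lcma_module;
  lcma_mul_bilinear : bilinear_op lcma_mul;
  lcma_mulC : commutative lcma_mul;
  lcma_mulA : associative lcma_mul;
  lcma_D_derivation : forall m n : lcma_module,
    lcm_D (lcma_mul m n) = lcma_mul (lcm_D m) n + lcma_mul m (lcm_D n);
  lcma_act_derivation : forall (a : R) (m n : lcma_module),
    lcm_act a (lcma_mul m n) =
      fmap (lcma_mul^~ n) (lcm_act a m) + fmap (lcma_mul m) (lcm_act a n) }.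

Section Commutations.
Variables (F : fieldType) (V : lmodType F) (k : nat).

Lemma mulX_mono (i : 'I_k) (m : expo k) (v : V) :
  mulX i (mono m v) = mono (upd m i (m i).+1 : expo k) v.
Proof.
by rewrite /mulX /shift lext_mono // (linear_fun0 (@mono_linear _ _ _ _)).
Qed.

Lemma permX_mono (s : 'S_k) (m : expo k) (v : V) :
  permX s (mono m v) = mono (m \o (s^-1)%g : expo k) v.
Proof.
by rewrite /permX lext_mono // (linear_fun0 (@mono_linear _ _ _ _)).
Qed.

Lemma fmap_mono (f : V -> V) (m : expo k) (v : V) :
  linear f -> fmap f (mono m v) = mono m (f v).
Proof.
move=> lf; rewrite /fmap lext_mono //.
by rewrite (linear_fun0 lf) (linear_fun0 (@mono_linear _ _ _ _)).
Qed.

Lemma linear_comp (U1 U2 U3 : lmodType F) (f : U2 -> U3) (g : U1 -> U2) :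
  linear f -> linear g -> linear (fun x => f (g x)).
Proof. by move=> lf lg a u v; rewrite lg lf. Qed.

Lemma mulXC (i j : 'I_k) (p : vpoly k V) : mulX i (mulX j p) = mulX j (mulX i p).
Proof.
have li := @mulX_linear F k V i; have lj := @mulX_linear F k V j.
apply: (mono_ext (linear_comp li lj) (linear_comp lj li)) => m v.
rewrite !mulX_mono; congr mono; apply: functional_extensionality_dep => l.
rewrite /upd /=; have [->|nij] := eqVneq i j; first by case: (l == j).
by case: (eqVneq l i) => [->|_] //=; rewrite (negbTE nij).
Qed.

Lemma mulX_fmap (i : 'I_k) (f : V -> V) (p : vpoly k V) :
  linear f -> mulX i (fmap f p) = fmap f (mulX i p).
Proof.
move=> lf; have li := @mulX_linear F k V i.
have lm : linear (@fmap F (expo k) V V f) by apply: fmap_linear.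
apply: (mono_ext (linear_comp li lm) (linear_comp lm li)) => m v.
by rewrite !(mulX_mono, fmap_mono).
Qed.

Lemma permX_mulX (s : 'S_k) (i : 'I_k) (p : vpoly k V) :
  permX s (mulX i p) = mulX (s i) (permX s p).
Proof.
have li := @mulX_linear F k V i; have lsi := @mulX_linear F k V (s i).
have ls := @permX_linear F k V s.
apply: (mono_ext (linear_comp ls li) (linear_comp lsi ls)) => m v.
rewrite !(mulX_mono, permX_mono); congr mono.
apply: functional_extensionality_dep => l; rewrite /upd /= permK.
by rewrite -[in RHS](permKV s l) (inj_eq perm_inj) permKV.
Qed.

Lemma permX_fmap (s : 'S_k) (f : V -> V) (p : vpoly k V) :
  linear f -> permX s (fmap f p) = fmap f (permX s p).
Proof.
move=> lf; have ls := @permX_linear F k V s.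
have lm : linear (@fmap F (expo k) V V f) by apply: fmap_linear.
apply: (mono_ext (linear_comp ls lm) (linear_comp lm ls)) => m v.
by rewrite !(permX_mono, fmap_mono).
Qed.

End Commutations.

Section Cochains.
Variables (F : fieldType) (R : lieConformalAlgebra F) (M : lcaModule R).

(* the image of lambda_0 + ... + lambda_(k-1) + D *)
Definition coef_rel (k : nat) (q : vpoly k M) : Prop :=
  exists p : vpoly k M, q = \sum_(i < k) mulX i p + fmap (@lcm_D F R M) p.

(* F_-[lambda_0, ..., lambda_(k-1)] (x)_F[D] M *)
Definition coef_space (k : nat) : lmodType F := lquot (@coef_rel k).

Definition coef_pi (k : nat) : vpoly k M -> coef_space k := @lpi F _ (@coef_rel k).

(* multiplication by lambda_i and substitution of lambda_(s l) for lambda_l *)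
Definition coef_mulX (k : nat) (i : 'I_k) : coef_space k -> coef_space k :=
  lquot_map (@coef_rel k) (@mulX F k M i).
Definition coef_permX (k : nat) (s : 'S_k) : coef_space k -> coef_space k :=
  lquot_map (@coef_rel k) (@permX F k M s).

Lemma coef_mulX_rel k (i : 'I_k) (q : vpoly k M) :
  coef_rel q -> mulX i q \in lspan (@coef_rel k).
Proof.
move=> [p ->]; apply: lspan_gen; exists (mulX i p).
have li := @mulX_linear F k M i.
rewrite -[X in mulX i (X + _)]scale1r li scale1r (mulX_fmap _ _ (@lcm_D_linear F R M)).
congr (_ + _); under [RHS]eq_bigr do rewrite mulXC.
have l0 := linear_fun0 li.
elim/big_rec2: _ => [|j x y _ <-]; first exact: l0.
by rewrite -[X in mulX i (X + _)]scale1r li scale1r.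
Qed.

Lemma coef_permX_rel k (s : 'S_k) (q : vpoly k M) :
  coef_rel q -> permX s q \in lspan (@coef_rel k).
Proof.
move=> [p ->]; apply: lspan_gen; exists (permX s p).
have ls := @permX_linear F k M s.
rewrite -[X in permX s (X + _)]scale1r ls scale1r (permX_fmap _ _ (@lcm_D_linear F R M)).
congr (_ + _); rewrite [RHS](reindex_inj (@perm_inj _ s)) /=.
under [RHS]eq_bigr do rewrite -permX_mulX.
have l0 := linear_fun0 ls.
elim/big_rec2: _ => [|j x y _ <-]; first exact: l0.
by rewrite -[X in permX s (X + _)]scale1r ls scale1r.
Qed.

Lemma coef_mulX_pi k (i : 'I_k) p : coef_mulX i (coef_pi p) = coef_pi (mulX i p).
Proof. exact: lquot_mapE (@mulX_linear _ _ _ i) (@coef_mulX_rel k i) p. Qed.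
Lemma coef_permX_pi k (s : 'S_k) p : coef_permX s (coef_pi p) = coef_pi (permX s p).
Proof. exact: lquot_mapE (@permX_linear _ _ _ s) (@coef_permX_rel k s) p. Qed.

Lemma coef_mulX_linear k (i : 'I_k) : linear (coef_mulX i).
Proof. exact: lquot_map_linear (@mulX_linear _ _ _ i) (@coef_mulX_rel k i). Qed.
Lemma coef_permX_linear k (s : 'S_k) : linear (coef_permX s).
Proof. exact: lquot_map_linear (@permX_linear _ _ _ s) (@coef_permX_rel k s). Qed.

Variable k : nat.

(* Linear maps on the k-th tensor power of R are given as multilinear maps *)
Definition is_cochain : {pred ('I_k -> R) -> coef_space k} := fun c =>
  `[< [/\ forall a i s (u v : R),
            c (upd a i (s *: u + v)) = s *: c (upd a i u) + c (upd a i v),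
          forall a i, c (upd a i (lca_D (a i))) = - coef_mulX i (c a) &
          forall (s : 'S_k) a, coef_permX s (c (a \o s)) = (-1) ^+ s *: c a] >].

Lemma is_cochain_closed : submod_closed is_cochain.
Proof.
split=> [|x c e /asboolP[lc sc pc] /asboolP[le se pe]]; apply/asboolP; split.
- by move=> *; rewrite scaler0 addr0.
- by move=> a i; rewrite (linear_fun0 (@coef_mulX_linear k i)) oppr0.
- by move=> s a; rewrite (linear_fun0 (@coef_permX_linear k s)) scaler0.
- move=> a i s u v.
  change (x *: c (upd a i (s *: u + v)) + e (upd a i (s *: u + v)) =
    s *: (x *: c (upd a i u) + e (upd a i u)) + (x *: c (upd a i v) + e (upd a i v))).
  rewrite lc le !scalerDr !scalerA [s * x]mulrC -!addrA; congr (_ + _).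
  by rewrite addrCA.
- move=> a i.
  change (x *: c (upd a i (lca_D (a i))) + e (upd a i (lca_D (a i))) =
    - coef_mulX i (x *: c a + e a)).
  by rewrite sc se coef_mulX_linear scalerN opprD.
- move=> s a.
  change (coef_permX s (x *: c (a \o s) + e (a \o s)) =
    (-1) ^+ s *: (x *: c a + e a)).
  by rewrite coef_permX_linear pc pe scalerDr !scalerA mulrC.
Qed.

HB.instance Definition _ :=
  GRing.isSubmodClosed.Build F (('I_k -> R) -> coef_space k) is_cochain
    is_cochain_closed.

(* C^k(R, M) *)
Record cochain := Cochain {
  cochain_val :> ('I_k -> R) -> coef_space k;
  cochain_valP : cochain_val \in is_cochain }.

HB.instance Definition _ := [isSub for cochain_val].
HB.instance Definition _ := [Choice of cochain by <:].
HB.instance Definition _ := [SubChoice_isSubLmodule of cochain by <:].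

End Cochains.

Section Multiindices.
Variables (N : nat).

Lemma ins_lift (i : 'I_N) n (m : expo N.-1) l : ins i n m (lift i l) = m l.
Proof. by rewrite /ins liftK. Qed.

Lemma ins_id (i : 'I_N) n (m : expo N.-1) : ins i n m i = n.
Proof. by rewrite /ins unlift_none. Qed.

Lemma upd_ins_lift (i : 'I_N) n (m : expo N.-1) l x :
  upd (ins i n m) (lift i l) x = ins i n (upd m l x).
Proof.
apply: functional_extensionality_dep => j; rewrite /upd /ins.
case: unliftP => [j' ->|->]; first by rewrite (inj_eq lift_inj).
by rewrite (negbTE (neq_lift _ _)).
Qed.

Lemma upd_ins_id (i : 'I_N) n (m : expo N.-1) x : upd (ins i n m) i x = ins i x m.
Proof.
apply: functional_extensionality_dep => j; rewrite /upd /ins.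
by case: unliftP => [j' ->|->]; rewrite ?eqxx // eq_sym (negbTE (neq_lift _ _)).
Qed.

Lemma updC (k : nat) (T : Type) (m : 'I_k -> T) i j x y :
  i != j -> upd (upd m i x) j y = upd (upd m j y) i x.
Proof.
move=> nij; apply: functional_extensionality_dep => l; rewrite /upd.
by case: (eqVneq l j) => // ->; rewrite eq_sym (negbTE nij).
Qed.

Lemma updK (k : nat) (T : Type) (m : 'I_k -> T) i x y :
  upd (upd m i x) i y = upd m i y.
Proof. by apply: functional_extensionality_dep => l; rewrite /upd; case: eqP. Qed.

Lemma upd_neq (k : nat) (T : Type) (m : 'I_k -> T) i x l :
  l != i -> upd m i x l = m l.
Proof. by rewrite /upd => /negbTE->. Qed.

Lemma upd_id (k : nat) (T : Type) (m : 'I_k -> T) i x : upd m i x i = x.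
Proof. by rewrite /upd eqxx. Qed.

End Multiindices.

Lemma big_ord_lift (N : nat) (V : nmodType) (p : 'I_N) (P : pred 'I_N) (G : 'I_N -> V) :
  \sum_(l < N | P l) G l =
  (if P p then G p else 0) + \sum_(l < N.-1 | P (lift p l)) G (lift p l).
Proof. by rewrite big_mkcond (bigD1_ord p) //= -big_mkcond. Qed.

Section LinearFun.
Variables (F : fieldType) (U W : lmodType F) (f : U -> W).
Hypothesis lf : linear f.

Lemma linear_funD u v : f (u + v) = f u + f v.
Proof. by rewrite -[u in LHS]scale1r lf scale1r. Qed.

Lemma linear_fun_sum (I : Type) (r : seq I) (P : pred I) (G : I -> U) :
  f (\sum_(i <- r | P i) G i) = \sum_(i <- r | P i) f (G i).
Proof. exact: (big_morph f linear_funD (linear_fun0 lf)). Qed.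

Lemma linear_fun_muln u n : f (u *+ n) = f u *+ n.
Proof. by elim: n => [|n ih]; rewrite ?mulr0n ?linear_fun0 // !mulrS linear_funD ih. Qed.

End LinearFun.

Section Series.
Variables (F : fieldType) (R : lieConformalAlgebra F) (M : lcaModuleAlgebra R).

Local Notation D := (@lcm_D F R M).
Local Notation mul := (@lcma_mul F R M).

Section Space.
Variable k : nat.

Definition is_series : {pred expo k -> M} := fun phi =>
  `[< forall m, \sum_(i < k) derX i phi m = D (phi m) >].

Lemma is_series_closed : submod_closed is_series.
Proof.
split=> [|x phi psi /asboolP hp /asboolP hq]; apply/asboolP => m.
  rewrite big1; first by rewrite (linear_fun0 (@lcm_D_linear F R M)).
  by move=> i _; rewrite /derX /= mul0rn.
change (\sum_(i < k) (x *: phi (upd m i (m i).+1) + psi (upd m i (m i).+1)) *+ (m i).+1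
  = D (x *: phi m + psi m)).
rewrite (@lcm_D_linear F R M) -hp -hq scaler_sumr -big_split /=.
by apply: eq_bigr => i _; rewrite mulrnDl scalerMnr.
Qed.

HB.instance Definition _ :=
  GRing.isSubmodClosed.Build F (expo k -> M) is_series is_series_closed.

(* the space M_k of power series in x_0, ..., x_(k-1) with coefficients in M
   annihilated by d/dx_0 + ... + d/dx_(k-1) - D *)
Record xseries := XSeries {
  xseries_val :> expo k -> M;
  xseries_valP : xseries_val \in is_series }.

HB.instance Definition _ := [isSub for xseries_val].
HB.instance Definition _ := [Choice of xseries by <:].
HB.instance Definition _ := [SubChoice_isSubLmodule of xseries by <:].

Lemma derX_xseries (i : 'I_k) (phi : xseries) : derX i phi \in is_series.
Proof.
apply/asboolP => m; have /asboolP h := xseries_valP phi.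
rewrite {2}/derX (linear_fun_muln (@lcm_D_linear F R M)) -h -sumrMnl.
apply: eq_bigr => j _; rewrite /derX.
have [<-|nij] := eqVneq j i; first by rewrite !updK !upd_id -mulrnA mulnC mulrnA.
rewrite (upd_neq _ _ nij) upd_neq 1?eq_sym // (updC _ _ _ nij).
by rewrite -mulrnA mulnC mulrnA.
Qed.

Lemma permS_xseries (s : 'S_k) (phi : xseries) : permS s phi \in is_series.
Proof.
apply/asboolP => m; have /asboolP h := xseries_valP phi.
rewrite {2}/permS -h (reindex_inj (@perm_inj _ s)) /=.
apply: eq_bigr => j _; rewrite /derX /permS /=; congr (xseries_val phi _ *+ _).
apply: functional_extensionality_dep => l.
by rewrite /upd /= (inj_eq perm_inj).
Qed.

Definition derM i phi : xseries := XSeries (derX_xseries i phi).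
Definition permM s phi : xseries := XSeries (permS_xseries s phi).

End Space.

Section Product.
Variables (h k : nat) (phi : xseries h) (psi : xseries k).

(* phi(x_0, ..., x_(h-1)) psi(x_h, ..., x_(h+k-1)) *)
Definition prodS : expo (h + k) -> M :=
  fun m => mul (phi (m \o lshift k)) (psi (m \o @rshift h k)).

Lemma prodS_xseries : prodS \in @is_series (h + k).
Proof.
have [ml mr] := @lcma_mul_bilinear F R M.
apply/asboolP => m; have /asboolP hp := xseries_valP phi.
have /asboolP hq := xseries_valP psi.
rewrite /prodS lcma_D_derivation -hp -hq big_split_ord /=.
rewrite (linear_fun_sum (ml _)) (linear_fun_sum (mr _)).
congr (_ + _); apply: eq_bigr => i _; rewrite /derX.
  rewrite (linear_fun_muln (ml _)); congr (mul (phi _) (psi _) *+ _).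
  by apply: functional_extensionality_dep => l; rewrite /upd /= eq_rlshift.
rewrite (linear_fun_muln (mr _)); congr (mul (phi _) (psi _) *+ _).
  by apply: functional_extensionality_dep => l; rewrite /upd /= eq_lrshift.
by apply: functional_extensionality_dep => l; rewrite /upd /= (inj_eq (@rshift_inj _ _)).
Qed.

Definition prodM : xseries (h + k) := XSeries prodS_xseries.

End Product.

(* setting x_j = x_i, the variables after x_j being renumbered *)
Definition diagS (N : nat) (i j : 'I_N) (theta : expo N -> M) : expo N.-1 -> M :=
  fun m => \sum_(s < (ins j 0 m i).+1)
    theta (upd (ins j s m) i (ins j s m i - s)%N).

Lemma diag_sum (G : nat -> nat -> M) n :
  (\sum_(s < n.+2) G (n.+1 - s)%N s) *+ n.+1 =
  \sum_(s < n.+1) (G (n - s).+1 s *+ (n - s).+1 + G (n - s)%N s.+1 *+ s.+1).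
Proof.
rewrite big_split /=.
rewrite (eq_bigr (fun s : 'I_n.+1 => G (n.+1 - s)%N s *+ (n.+1 - s))); last first.
  by move=> s _; rewrite subSn // -ltnS.
have -> : \sum_(s < n.+1) G (n.+1 - s)%N s *+ (n.+1 - s) =
    \sum_(s < n.+2) G (n.+1 - s)%N s *+ (n.+1 - s).
  by rewrite [RHS]big_ord_recr /= subnn mulr0n addr0.
have -> : \sum_(s < n.+1) G (n - s)%N s.+1 *+ s.+1 =
    \sum_(s < n.+2) G (n.+1 - s)%N s *+ s.
  by rewrite [RHS]big_ord_recl /= mulr0n add0r; apply: eq_bigr.
rewrite -big_split /= -sumrMnl; apply: eq_bigr => s _.
by rewrite -mulrnDr subnK // -ltnS.
Qed.

Lemma diagS_xseries (N : nat) (i j : 'I_N) (theta : xseries N) :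
  i != j -> diagS i j theta \in @is_series N.-1.
Proof.
rewrite eq_sym => /unlift_some [i0 -> _]; apply/asboolP => m.
have /asboolP ht := xseries_valP theta.
have dE m' : diagS (lift j i0) j theta m' =
    \sum_(s < (m' i0).+1) theta (ins j s (upd m' i0 (m' i0 - s)%N)).
  rewrite /diagS ins_lift; apply: eq_bigr => s _.
  by rewrite ins_lift upd_ins_lift.
rewrite dE (linear_fun_sum (@lcm_D_linear F R M)).
under [RHS]eq_bigr => s _ do rewrite -ht (bigD1_ord j) //= (bigD1_ord i0) //=.
have e0 : derX i0 (diagS (lift j i0) j theta) m =
    (\sum_(s < (m i0).+2) theta (ins j s (upd m i0 ((m i0).+1 - s)%N))) *+ (m i0).+1.
  rewrite /derX dE upd_id; congr (_ *+ _).
  by apply: eq_bigr => s _; rewrite updK.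
rewrite (bigD1_ord i0) //= e0 (diag_sum (fun p q => theta (ins j q (upd m i0 p)))).
under [RHS]eq_bigr => s _ do rewrite addrA.
rewrite [RHS]big_split /=; congr (_ + _).
  apply: eq_bigr => s _; rewrite addrC /derX ins_id upd_ins_id.
  by rewrite ins_lift upd_ins_lift upd_id updK.
rewrite [RHS]exchange_big /=; apply: eq_bigr => l _.
rewrite /derX dE; set l1 := lift i0 l.
have n1 : l1 != i0 by rewrite eq_sym neq_lift.
have e1 : upd m l1 (m l1).+1 i0 = m i0.
  by rewrite /upd eq_sym (negbTE n1).
rewrite e1 -sumrMnl; apply: eq_bigr => s _.
rewrite ins_lift upd_ins_lift.
have -> : upd m i0 (m i0 - s)%N l1 = m l1 by rewrite /upd (negbTE n1).
by rewrite (updC _ _ _ n1).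
Qed.

(* sum over n of (a_n f) (d/dy)^n g / n! at y = 0, where y is the variable in
   position p of g and f does not involve y. As lcm_act a w has coefficients
   a_n w / n! and (d/dy)^n g at y = 0 is n! times the coefficient of y^n in g, the
   factor n! remains *)
Definition evalS (N : nat) (p : 'I_N) (a : R) (f g : expo N -> M) : expo N.-1 -> M :=
  fun m => lext (fun n v => mul v (g (ins p n m)) *+ n`!) (lcm_act a (f (ins p 0 m))).

Lemma evalS_xseries (N : nat) (p : 'I_N) (a : R) (f g : expo N -> M) (S : pred 'I_N) :
  ~~ S p ->
  (forall u, \sum_(l < N | S l) derX l f u = D (f u)) ->
  (forall u, \sum_(l < N | ~~ S l) derX l g u = D (g u)) ->
  (forall u l x, ~~ S l -> f (upd u l x) = f u) ->
  (forall u l x, S l -> g (upd u l x) = g u) ->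
  evalS p a f g \in @is_series N.-1.
Proof.
move=> Sp hf hg f_indep g_indep; apply/asboolP => m.
have [ml mr] := @lcma_mul_bilinear F R M.
have [al ar] := @lcm_act_bilinear F R M.
have lD := @lcm_D_linear F R M.
pose Lam (gg : nat -> M) := lext (fun n v => mul v (gg n) *+ n`!).
have linmul x n : linear (fun v : M => mul v x *+ n).
  by move=> c u v; rewrite ml mulrnDl scalerMnr.
have linLam gg : linear (Lam gg) by apply: lext_linear => n.
have LamE gg n v : Lam gg (mono n v) = mul v (gg n) *+ n`!.
  by rewrite /Lam lext_mono // (linear_fun0 (linmul _ _)).
pose g0 n := g (ins p n m).
have eT : evalS p a f g m = Lam g0 (lcm_act a (f (ins p 0 m))) by [].
rewrite (bigID (fun l => S (lift p l))) /=.
have e1 : \sum_(l < N.-1 | S (lift p l)) derX l (evalS p a f g) m =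
    Lam g0 (lcm_act a (D (f (ins p 0 m)))).
  rewrite -hf (big_ord_lift p) (negbTE Sp) add0r.
  rewrite (linear_fun_sum (ar a)) (linear_fun_sum (linLam g0)).
  apply: eq_bigr => l Sl; rewrite /derX ins_lift.
  rewrite (linear_fun_muln (ar a)) (linear_fun_muln (linLam g0)); congr (_ *+ _).
  rewrite /evalS upd_ins_lift; congr (lext _ _).
  apply: functional_extensionality_dep => n.
  apply: functional_extensionality_dep => v.
  by rewrite /g0 -upd_ins_lift g_indep.
have e2 : \sum_(l < N.-1 | ~~ S (lift p l)) derX l (evalS p a f g) m =
    Lam (fun n => D (g0 n) - g0 n.+1 *+ n.+1) (lcm_act a (f (ins p 0 m))).
  pose G l n := derX (lift p l) g (ins p n m).
  have eG n : D (g0 n) - g0 n.+1 *+ n.+1 = \sum_(l < N.-1 | ~~ S (lift p l)) G l n.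
    rewrite /g0 -hg (big_ord_lift p) Sp /derX ins_id upd_ins_id.
    by rewrite addrC addrK.
  have -> : Lam (fun n => D (g0 n) - g0 n.+1 *+ n.+1) =
      fun q => \sum_(l < N.-1 | ~~ S (lift p l)) Lam (G l) q.
    apply: functional_extensionality_dep => q.
    rewrite /Lam /lext exchange_big /=; apply: eq_bigr => n _.
    by rewrite eG (linear_fun_sum (mr _)) -sumrMnl.
  apply: eq_bigr => l Sl; rewrite /derX /evalS -upd_ins_lift f_indep //.
  rewrite /Lam /lext -sumrMnl; apply: eq_bigr => n _.
  rewrite /G /derX ins_lift upd_ins_lift (linear_fun_muln (mr _)).
  by rewrite -!mulrnA mulnC.
rewrite e1 e2 eT.
have [_ ->] := @lcm_act_sesquilinear F R M.
have l1 : linear (fun q : finfam nat M => Lam g0 (fmap D q + mulX1 q) +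
    Lam (fun n => D (g0 n) - g0 n.+1 *+ n.+1) q).
  move=> c u v; have lf : linear (@fmap F nat M M D) by apply: fmap_linear.
  have lx : linear (@mulX1 F M) by apply: lext_linear => n; apply: mono_linear.
  rewrite lf lx addrACA -scalerDr !linLam scalerDr.
  by rewrite addrACA.
have l2 : linear (fun q : finfam nat M => D (Lam g0 q)).
  by move=> c u v; rewrite linLam lD.
apply: (mono_ext l1 l2) => n v; rewrite !LamE.
have m0 i : @mono F nat M i 0 = 0 := linear_fun0 (@mono_linear _ _ _ i).
rewrite /fmap /mulX1 /shift !lext_mono ?(linear_fun0 lD) ?m0 //.
rewrite (linear_funD (linLam g0)) !LamE (linear_funD (mr _)).
rewrite (linear_fun_muln lD) lcma_D_derivation -addrA [RHS]mulrnDl; congr (_ + _).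
have mN u w : mul u (- w) = - mul u w.
  by apply/eqP; rewrite -addr_eq0 -(linear_funD (mr u)) addNr (linear_fun0 (mr u)).
by rewrite mN (linear_fun_muln (mr _)) mulrnDl addrCA mulNrn -mulrnA -factS subrr addr0.
Qed.

Section Terms.
Variables (h k : nat) (a : R) (phi : xseries h) (psi : xseries k).

Let phi' (m : expo (h + k)) := phi (m \o lshift k).
Let psi' (m : expo (h + k)) := psi (m \o @rshift h k).
Let left (l : 'I_(h + k)) := (l < h)%N.

Lemma left_lshift i : left (lshift k i). Proof. by rewrite /left /=. Qed.
Lemma left_rshift i : ~~ left (@rshift h k i).
Proof. by rewrite /left /= -leqNgt leq_addr. Qed.

Lemma phi'_indep u l x : ~~ left l -> phi' (upd u l x) = phi' u.
Proof.
rewrite /phi' => nl; congr (xseries_val phi _).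
apply: functional_extensionality_dep => j; rewrite /upd /=.
by case: eqP => // e; move: nl; rewrite -e left_lshift.
Qed.

Lemma psi'_indep u l x : left l -> psi' (upd u l x) = psi' u.
Proof.
rewrite /psi' => nl; congr (xseries_val psi _).
apply: functional_extensionality_dep => j; rewrite /upd /=.
by case: eqP => // e; have := left_rshift j; rewrite e nl.
Qed.

Lemma phi'_der u : \sum_(l < h + k | left l) derX l phi' u = D (phi' u).
Proof.
have /asboolP hp := xseries_valP phi; rewrite [in RHS]/phi' -hp big_split_ord /=.
rewrite [X in _ + X]big_pred0 ?addr0; last first.
  by move=> l; apply/negbTE/left_rshift.
apply: eq_big => [l|l _]; first by rewrite left_lshift.
rewrite /derX /phi'; congr (xseries_val phi _ *+ _).
Qed.

Lemma psi'_der u : \sum_(l < h + k | ~~ left l) derX l psi' u = D (psi' u).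
Proof.
have /asboolP hq := xseries_valP psi; rewrite [in RHS]/psi' -hq big_split_ord /=.
rewrite [X in X + _]big_pred0 ?add0r; last first.
  by move=> l; rewrite left_lshift.
apply: eq_big => [l|l _]; first by rewrite left_rshift.
rewrite /derX /psi'; congr (xseries_val psi _ *+ _).
apply: functional_extensionality_dep => j; rewrite /upd /=.
by rewrite (inj_eq (@rshift_inj _ _)).
Qed.

Lemma evalL_xseries (i : 'I_h) :
  evalS (lshift k i) a psi' phi' \in @is_series (h + k).-1.
Proof.
apply: (@evalS_xseries _ _ _ _ _ (fun l => ~~ left l)).
- by rewrite negbK left_lshift.
- exact: psi'_der.
- by move=> u; rewrite -phi'_der; apply: eq_bigl => l; rewrite negbK.
- by move=> u l x; rewrite negbK; apply: psi'_indep.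
- exact: phi'_indep.
Qed.

Lemma evalR_xseries (i : 'I_k) :
  evalS (rshift h i) a phi' psi' \in @is_series (h + k).-1.
Proof.
apply: (@evalS_xseries _ _ _ _ _ left).
- exact: left_rshift.
- exact: phi'_der.
- exact: psi'_der.
- exact: phi'_indep.
- exact: psi'_indep.
Qed.

Lemma diag_xseries (i : 'I_h) (j : 'I_k) (theta : xseries (h + k)) :
  diagS (lshift k i) (rshift h j) theta \in @is_series (h + k).-1.
Proof. by apply: diagS_xseries; rewrite eq_lrshift. Qed.

(* (a_(d/dy) psi(x_(h-1), ..., x_(h+k-2))) phi(x_0, ..., y, ..., x_(h-2)) at y = 0,
   y being the variable number i of phi *)
Definition evalL (i : 'I_h) : xseries (h + k).-1 := XSeries (evalL_xseries i).

(* (a_(d/dy) phi(x_0, ..., x_(h-1))) psi(x_h, ..., y, ..., x_(h+k-2)) at y = 0,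
   y being the variable number i of psi *)
Definition evalR (i : 'I_k) : xseries (h + k).-1 := XSeries (evalR_xseries i).

End Terms.

Definition diagM (h k : nat) (i : 'I_h) (j : 'I_k) (theta : xseries (h + k)) :
  xseries (h + k).-1 := XSeries (diag_xseries i j theta).

End Series.

Section ChainSpace.
Variables (F : fieldType) (R : lieConformalAlgebra F) (M : lcaModuleAlgebra R).
Variable k : nat.

(* the vector space freely generated by the pairs (a, phi) *)
Definition chain_free : lmodType F :=
  finfam (('I_k -> R) * xseries M k)%type F^o.

Definition gen (a : 'I_k -> R) (phi : xseries M k) : chain_free :=
  mono (a, phi) (1 : F^o).

(* The first two relations present the tensor product of k copies of R and of M_k *)
Inductive chain_rel : chain_free -> Prop :=
| chain_rel_tensor a i (s : F) (u v : R) phi :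
    chain_rel (gen (upd a i (s *: u + v)) phi
               - (s *: gen (upd a i u) phi + gen (upd a i v) phi))
| chain_rel_series a (s : F) (phi psi : xseries M k) :
    chain_rel (gen a (s *: phi + psi) - (s *: gen a phi + gen a psi))
| chain_rel_D a i phi :
    chain_rel (gen (upd a i (lca_D (a i))) phi + gen a (derM i phi))
| chain_rel_perm a (s : 'S_k) phi :
    chain_rel (gen (a \o (s^-1)%g) (permM s phi) - (-1) ^+ s *: gen a phi).

(* C_k(R, M) *)
Definition chain_space : lmodType F := lquot chain_rel.

(* the class of a_0 (x) ... (x) a_(k-1) (x) phi *)
Definition chain (a : 'I_k -> R) (phi : xseries M k) : chain_space :=
  lpi chain_rel (gen a phi).

End ChainSpace.

Section Calculus.
Variable F : fieldType.
Implicit Types (V W G : lmodType F).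

(* P b is the subspace of the vectors of parity b *)
Definition is_superspace V (P : bool -> V -> Prop) : Prop :=
  [/\ forall b, P b 0,
      forall b (s : F) u v, P b u -> P b v -> P b (s *: u + v),
      forall v, P false v -> P true v -> v = 0 &
      forall v, exists v0 v1, [/\ P false v0, P true v1 & v = v0 + v1]].

Definition rev_parity V (P : bool -> V -> Prop) : bool -> V -> Prop :=
  fun b => P (~~ b).

(* [A, B] for endomorphisms A of parity p and B of parity q *)
Definition scomm V (p q : bool) (A B : V -> V) : V -> V :=
  fun v => A (B v) - (-1) ^+ (p && q) *: B (A v).

Definition comm_assoc_superalgebra V (P : bool -> V -> Prop) (w : V -> V -> V) : Prop :=
  [/\ bilinear_op w,
      forall p q x y, P p x -> P q y -> P (p (+) q) (w x y),
      forall p q x y, P p x -> P q y -> w x y = (-1) ^+ (p && q) *: w y x &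
      forall x y z, w x (w y z) = w (w x y) z].

Definition lie_superalgebra V (P : bool -> V -> Prop) (br : V -> V -> V) : Prop :=
  [/\ bilinear_op br,
      forall p q x y, P p x -> P q y -> P (p (+) q) (br x y),
      forall p q x y, P p x -> P q y -> br x y = - ((-1) ^+ (p && q) *: br y x) &
      forall p q x y z, P p x -> P q y ->
        br x (br y z) = br (br x y) z + (-1) ^+ (p && q) *: br y (br x z)].

Definition gerstenhaber V (P : bool -> V -> Prop) (w br : V -> V -> V) : Prop :=
  [/\ is_superspace P,
      comm_assoc_superalgebra P w,
      lie_superalgebra (rev_parity P) br &
      forall p q x y z, P p x -> P q y ->
        br x (w y z) = w (br x y) z + (-1) ^+ (~~ p && q) *: w y (br x z)].

Definition super_complex V (P : bool -> V -> Prop) (d : V -> V) : Prop :=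
  [/\ is_superspace P, linear d,
      forall p v, P p v -> P (~~ p) (d v) &
      forall v, d (d v) = 0].

(* X |-> A X is an even linear map from a superspace to the endomorphisms of
   another one *)
Definition super_linear_action V W (P : bool -> V -> Prop) (Q : bool -> W -> Prop)
    (A : V -> W -> W) : Prop :=
  bilinear_op A /\ (forall p q x c, P p x -> Q q c -> Q (p (+) q) (A x c)).

Definition superalgebra_module V W (P : bool -> V -> Prop) (w : V -> V -> V)
    (Q : bool -> W -> Prop) (iota : V -> W -> W) : Prop :=
  super_linear_action P Q iota /\
  (forall x y c, iota (w x y) c = iota x (iota y c)).

Definition lie_superalgebra_module V W (P : bool -> V -> Prop) (br : V -> V -> V)
    (Q : bool -> W -> Prop) (L : V -> W -> W) : Prop :=
  super_linear_action P Q L /\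
  (forall p q x y, P p x -> P q y -> L (br x y) =1 scomm p q (L x) (L y)).

(* iota and L define a calculus structure of the Gerstenhaber algebra (G, w, br)
   on the complex (W, d) *)
Definition calculus_structure G W (P : bool -> G -> Prop) (w br : G -> G -> G)
    (Q : bool -> W -> Prop) (d : W -> W) (iota L : G -> W -> W) : Prop :=
  [/\ gerstenhaber P w br /\ super_complex Q d,
      superalgebra_module P w Q iota,
      lie_superalgebra_module (rev_parity P) br Q L,
      forall p q x y, P p x -> P q y ->
        scomm (~~ p) q (L x) (iota y) =1 iota (br x y) &
      forall p x, P p x -> L x =1 scomm p true (iota x) d].

(* V^(n-m) if m <= n, and 0 otherwise *)
Definition degree_sub V (D : nat -> V -> Prop) (n m : nat) : V -> Prop :=
  fun v => if (m <= n)%N then D (n - m)%N v else v = 0.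

Definition graded_calculus G W (D : nat -> G -> Prop) (E : nat -> W -> Prop)
    (iota L : G -> W -> W) : Prop :=
  forall m n x c, D m x -> E n c ->
    degree_sub E n m (iota x c) /\ degree_sub E n.+1 m (L x c).

Section DirectSumGrading.
Variable V : nat -> lmodType F.

Definition dsum_degree (n : nat) (x : dsum V) : Prop :=
  forall k, k != n -> x k = 0.

Definition dsum_parity (b : bool) (x : dsum V) : Prop :=
  forall k, odd k != b -> x k = 0.

End DirectSumGrading.

End Calculus.

Notation Cochains M := (dsum (fun k => cochain M k : lmodType _)).
Notation Chains M := (dsum (fun k => chain_space M k)).

Section Operations.
Variables (F : fieldType) (R : lieConformalAlgebra F) (M : lcaModuleAlgebra R).

(* a_(lambda_i) p, where p does not involve lambda_i *)
Definition actX (k : nat) (i : 'I_k.+1) (a : R) (p : vpoly k M) : vpoly k.+1 M :=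
  lext (fun (m : expo k) v =>
    lext (fun n u => mono (ins i n m : expo k.+1) u) (lcm_act a v)) p.

(* the formula for (d c)(a_0, ..., a_k), c being a lift of a k-cochain; the
   coefficients of [a_i _(lambda_i) a_j] are inserted in position i *)
Definition differential_formula (k : nat) (c : ('I_k -> R) -> vpoly k M)
    (a : 'I_k.+1 -> R) : vpoly k.+1 M :=
  \sum_(i < k.+1) (-1) ^+ i *: actX i (a i) (c (a \o lift i)) +
  \sum_(i < k.+1) \sum_(j < k.+1 | (i < j)%N) (-1) ^+ j *:
    lext (fun n e => iter n (mulX i) (mergeX i j (c (upd a i e \o lift j))))
      (lca_br (a i) (a j)).

Definition is_differential (d : Cochains M -> Cochains M) : Prop :=
  [/\ linear d,
      forall c, d c 0%N = 0 &
      forall (c : Cochains M) k (c' : ('I_k -> R) -> vpoly k M),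
        (forall a, coef_pi (c' a) = c k a) ->
        forall a, d c k.+1 a = coef_pi (differential_formula c' a)].

Definition is_wedge (w : Chains M -> Chains M -> Chains M) : Prop :=
  bilinear_op w /\
  forall h k (a : 'I_h -> R) (b : 'I_k -> R) (phi : xseries M h) (psi : xseries M k),
    w (dinj _ h (chain a phi)) (dinj _ k (chain b psi)) =
    dinj _ (h + k)%N (chain (catf a b) (prodM phi psi)).

(* [a_0 (x) ... (x) a_(h-1) (x) phi, b_0 (x) ... (x) b_(k-1) (x) psi]; the signs are
   those of the formula with indices starting from 1, i.+1 and (h + j).+1 *)
Definition bracket_formula (h k : nat) (a : 'I_h -> R) (phi : xseries M h)
    (b : 'I_k -> R) (psi : xseries M k) : chain_space M (h + k).-1 :=
  let ab := catf a b in
  \sum_(i < h) \sum_(j < k) (-1) ^+ (h + (h + j).+1 + 1) *: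
    lext (fun l e => chain (upd ab (lshift k i) e \o lift (rshift h j))
        (diagM i j (iter l (@derM F R M _ (lshift k i)) (prodM phi psi))))
      (lca_br (a i) (b j)) +
  \sum_(i < h) (-1) ^+ (h + i.+1) *:
    chain (ab \o lift (lshift k i)) (evalL (a i) phi psi i) +
  \sum_(i < k) (-1) ^+ (h + (h + i).+1) *:
    chain (ab \o lift (rshift h i)) (evalR (b i) phi psi i).

Definition is_bracket (br : Chains M -> Chains M -> Chains M) : Prop :=
  bilinear_op br /\
  forall h k (a : 'I_h -> R) (b : 'I_k -> R) (phi : xseries M h) (psi : xseries M k),
    br (dinj _ h (chain a phi)) (dinj _ k (chain b psi)) =
    dinj _ (h + k).-1 (bracket_formula a phi b psi).

(* phi(d/dlambda_0, ..., d/dlambda_(h-1)) p at lambda_0 = ... = lambda_(h-1) = 0: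
   the monomial lambda^m v contributes m_0! ... m_(h-1)! times the product of v by
   the coefficient of x^(m_0, ..., m_(h-1)) in phi *)
Definition contract (h k : nat) (phi : xseries M h) (p : vpoly (h + k) M) : vpoly k M :=
  lext (fun (m : expo (h + k)) v =>
    mono (m \o @rshift h k : expo k)
      (lcma_mul (phi (m \o lshift k)) v *+ \prod_(l < h) (m (lshift k l))`!)) p.

(* The condition holds for every lift p of the value of the cochain c; as the
   component of degree n of c is used only if n >= h, it also says that the
   contraction with a chain of degree h vanishes on cochains of smaller degree *)
Definition is_contraction (iota : Chains M -> Cochains M -> Cochains M) : Prop :=
  bilinear_op iota /\
  forall h (a : 'I_h -> R) (phi : xseries M h) (c : Cochains M) k (b : 'I_k -> R)
      (p : vpoly (h + k) M),
    coef_pi p = c (h + k)%N (catf a b) ->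
    iota (dinj _ h (chain a phi)) c k b =
      (-1) ^+ ((h * (h - 1)) %/ 2) *: coef_pi (contract phi p).

End Operations.

(* Main.v *)
(* Chains can be formed with coefficients in any F[D]-module A. Prepending a letter
   together with its variable gives maps e_b from k-chains over A[[y]] to (k+1)-chains
   over A, through which all operations are defined and compared by recursion on the
   degree. When R acts on A by operators b_(d/dy), these extend to Lie derivatives
   theta_b on chains, and there is a boundary operator delta with
   delta e_b + e_b delta = theta_b and delta^2 = 0. If moreover A is a module over M, the
   chains X over M act on the chains over A by X wedge -, and [[delta, X], Y] is again the
   action of a chain, up to sign the bracket [X, Y]. For A = Hom(M, M) + M the action is
   faithful, so that the axioms of a Gerstenhaber algebra become identities between
   supercommutators of operators.

   A k-cochain pairs with the k-chains over Hom(M, W), for any vector space W; in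
   characteristic 0 this pairing is faithful, because of the chains over the series
   lambda^m v / m!. The differential and the contraction by X are, up to sign, the
   transposes of delta and of X wedge -, so that the calculus identities are transposes
   of those between operators on chains. *)

(* Chains are classes, and the bracket formula is a double sum with signs over representatives:
   neither its independence of representatives nor its Jacobi identity is accessible directly. A
   chain of degree k+1 over A is a sum of chains e_b w with w of degree k over A[[y]], and the
   relations that involve the first letter reduce to linearity, the exchange of D b with -d/dy, and
   the alternation of the first two letters. An operation defined by recursion therefore needs only
   these short checks, at the price of quantifying all statements over A and of carrying naturality
   in A through the inductions. The bracket is not defined by its formula: [[delta, X], Y] crosses
   every e_c up to a sign, because theta_c is an operator of order one over M, so the formula has to
   be verified in degree 0 only. As M need not have a unit, the element (id, 0) of Hom(M, M) + M
   takes its place. Transposition reverses composition; the sign (-1)^(h(h-1)/2) of order reversal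
   makes the contraction an action of the wedge algebra again. *)
From HB Require Import structures.
From mathcomp Require Import fingroup perm all_boot all_algebra.
From mathcomp Require Import boolp functions.
From mathcomp Require Import zify.
Require Import Defs.

Set Implicit Arguments.
Unset Strict Implicit.
Unset Printing Implicit Defensive.

Import GRing.Theory.
Local Open Scope ring_scope.
Local Open Scope quotient_scope.

(* Syntax of abelian group identities, decided by the reflexive tactic zmod *)
Inductive zexpr := ZVar of nat | ZAdd of zexpr & zexpr | ZOpp of zexpr | ZZero.

Fixpoint zeval (V : zmodType) (env : seq V) e : V :=
  match e with
  | ZVar i => env`_i
  | ZAdd e1 e2 => zeval env e1 + zeval env e2
  | ZOpp e1 => - zeval env e1
  | ZZero => 0
  end.

Fixpoint zcoef e (i : nat) : int :=
  match e with
  | ZVar j => (i == j)%:Z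
  | ZAdd e1 e2 => zcoef e1 i + zcoef e2 i
  | ZOpp e1 => - zcoef e1 i
  | ZZero => 0
  end.

(** An expression matters only through its integer coefficients; a variable outside the environment
    has value 0 by the default of [nth], so no side condition is needed. *)
Lemma zevalE (V : zmodType) (env : seq V) e :
  zeval env e = \sum_(i < size env) env`_i *~ zcoef e i.
Proof.
elim: e => [j|e1 IH1 e2 IH2|e IH|] /=.
- have [lt_j|ge_j] := ltnP j (size env); last first.
    rewrite nth_default // big1 // => i _.
    by rewrite (ltn_eqF (leq_trans (ltn_ord i) ge_j)).
  rewrite (bigD1 (Ordinal lt_j)) //= eqxx mulr1z big1 ?addr0 // => i.
  by rewrite -val_eqE /= => /negbTE ->.
- by rewrite IH1 IH2 -big_split; apply: eq_bigr => i _; rewrite mulrzDr.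
- by rewrite IH -sumrN; apply: eq_bigr => i _; rewrite mulrNz.
- by rewrite big1.
Qed.

Lemma zeval_eq (V : zmodType) (env : seq V) e1 e2 :
  all (fun i => zcoef e1 i == zcoef e2 i) (iota 0 (size env)) -> zeval env e1 = zeval env e2.
Proof.
move=> /allP h; rewrite !zevalE; apply: eq_bigr => i _; congr (_ *~ _); apply/eqP/h.
by rewrite mem_iota /=.
Qed.

Ltac zmem x env :=
  lazymatch env with
  | nil => constr:(false)
  | x :: _ => constr:(true)
  | _ :: ?l => zmem x l
  end.
Ltac zidx x env :=
  lazymatch env with
  | x :: _ => constr:(0%N)
  | _ :: ?l => let i := zidx x l in constr:(S i)
  end.
Ltac zatoms t env :=
  lazymatch t with
  | @GRing.add _ ?a ?b => let env1 := zatoms a env in zatoms b env1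
  | @GRing.opp _ ?a => zatoms a env
  | @GRing.zero _ => env
  | _ => lazymatch zmem t env with true => env | false => constr:(t :: env) end
  end.
Ltac zreify t env :=
  lazymatch t with
  | @GRing.add _ ?a ?b => let x := zreify a env in let y := zreify b env in constr:(ZAdd x y)
  | @GRing.opp _ ?a => let x := zreify a env in constr:(ZOpp x)
  | @GRing.zero _ => constr:(ZZero)
  | _ => let i := zidx t env in constr:(ZVar i)
  end.
Ltac zmod :=
  lazymatch goal with
  | |- @eq ?T ?a ?b =>
    let env := zatoms a (@nil T) in
    let env := zatoms b env in
    let x := zreify a env in
    let y := zreify b env in
    exact (@zeval_eq _ env x y isT)
  end.

(** * Linear maps, direct sums and families *)

Notation funext := functional_extensionality_dep.

Section LinearMaps.
Variable F : fieldType.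
Implicit Types U V W : lmodType F.

Lemma linear_funZ U W (f : U -> W) : linear f -> forall a u, f (a *: u) = a *: f u.
Proof. by move=> lf a u; rewrite -[a *: u]addr0 lf linear_fun0 // addr0. Qed.

Lemma linear_funN U W (f : U -> W) : linear f -> forall u, f (- u) = - f u.
Proof. by move=> lf u; rewrite -scaleN1r linear_funZ // scaleN1r. Qed.

Lemma linear_funB U W (f : U -> W) : linear f -> forall u v, f (u - v) = f u - f v.
Proof. by move=> lf u v; rewrite linear_funD // linear_funN. Qed.

Lemma linear_add U W (f g : U -> W) : linear f -> linear g -> linear (fun u => f u + g u).
Proof. by move=> lf lg a u v; rewrite lf lg scalerDr addrACA. Qed.

Lemma linear_opp U W (f : U -> W) : linear f -> linear (fun u => - f u).
Proof. by move=> lf a u v; rewrite lf opprD scalerN. Qed.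

Lemma linear_sub U W (f g : U -> W) : linear f -> linear g -> linear (fun u => f u - g u).
Proof. by move=> lf lg; apply: linear_add => //; apply: linear_opp. Qed.

Lemma linear_scale U W (f : U -> W) c : linear f -> linear (fun u => c *: f u).
Proof. by move=> lf a u v; rewrite lf scalerDr !scalerA mulrC. Qed.

Lemma linear_muln U W (f : U -> W) n : linear f -> linear (fun u => f u *+ n).
Proof. by move=> lf a u v; rewrite lf mulrnDl scalerMnr. Qed.

Lemma linear_bigsum U W (I : Type) (r : seq I) (P : pred I) (f : I -> U -> W) :
  (forall i, linear (f i)) -> linear (fun u => \sum_(i <- r | P i) f i u).
Proof.
move=> lf a u v; rewrite scaler_sumr -big_split /=; apply: eq_bigr => i _.
by rewrite lf.
Qed.

Lemma linear_id U : linear (fun u : U => u). Proof. by []. Qed.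
Lemma linear_zero U W : linear (fun u : U => 0 : W).
Proof. by move=> a u v; rewrite scaler0 addr0. Qed.

Lemma lextD (K : choiceType) V W (f g : K -> V -> W) p :
  lext (fun k v => f k v + g k v) p = lext f p + lext g p.
Proof. exact: big_split. Qed.

Lemma lextN (K : choiceType) V W (f : K -> V -> W) p :
  lext (fun k v => - f k v) p = - lext f p.
Proof. exact: sumrN. Qed.

Lemma lextZ (K : choiceType) V W (f : K -> V -> W) c p :
  lext (fun k v => c *: f k v) p = c *: lext f p.
Proof. by rewrite /lext scaler_sumr. Qed.

Lemma eq_lext (K : choiceType) V W (f g : K -> V -> W) :
  (forall k v, f k v = g k v) -> lext f =1 lext g.
Proof. by move=> e p; apply: eq_bigr. Qed.

Lemma lext_comp (K : choiceType) V W W' (f : K -> V -> W) (g : W -> W') p :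
  linear g -> g (lext f p) = lext (fun k v => g (f k v)) p.
Proof. by move=> lg; rewrite /lext linear_fun_sum. Qed.

Lemma lext_linear_l (K : choiceType) U V W (f : U -> K -> V -> W) p :
  (forall k v, linear (fun u => f u k v)) -> linear (fun u => lext (f u) p).
Proof. by move=> lf; apply: linear_bigsum. Qed.

Lemma lext_mono_lin (K : choiceType) V W (f : K -> V -> W) k v :
  linear (f k) -> lext f (mono k v) = f k v.
Proof. by move=> lf; rewrite lext_mono // linear_fun0. Qed.

Lemma lext_shift (K : choiceType) V W (f : K -> V -> W) (s : K -> K) p :
  (forall k, linear (f k)) -> lext f (shift s p) = lext (fun k => f (s k)) p.
Proof.
move=> lf; have ls : linear (@shift F K V s) by apply: lext_linear => ?; exact: mono_linear.
apply: (mono_ext (linear_comp (lext_linear lf) ls) (lext_linear _)) => [k|k v]; first exact: lf.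
rewrite /shift lext_mono_lin ?lext_mono_lin //; exact: mono_linear.
Qed.

Lemma lext_fmap (K : choiceType) V V' W (f : K -> V -> W) (g : V' -> V) p :
  (forall k, linear (f k)) -> linear g -> lext f (fmap g p) = lext (fun k v => f k (g v)) p.
Proof.
move=> lf lg; apply: (mono_ext (linear_comp (lext_linear lf) (fmap_linear lg)) (lext_linear _)).
  by move=> k; apply: linear_comp.
move=> k v; have lm : linear (fun v => mono k (g v) : finfam K V).
  by apply: linear_comp => //; exact: mono_linear.
by rewrite /fmap !lext_mono_lin //; apply: linear_comp (lf k) lg.
Qed.

(** Evaluation at the chosen representative, defined for every f; that f kills the relations is
    asked only by the laws. Maps on quotients can thus be written first, recursively, and justified
    afterwards. *)
Definition qlift V W (G : V -> Prop) (f : V -> W) (q : lquot G) : W := f (repr q).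

Lemma qliftE V W (G : V -> Prop) (f : V -> W) v :
  linear f -> (forall g, G g -> f g = 0) -> qlift f (lpi G v) = f v.
Proof.
move=> lf fG; apply/eqP; rewrite -subr_eq0 /qlift -linear_funB //; apply/eqP.
have /lpi_eqP/lspanP h := lpi_repr (lpi G v).
apply: (h (fun u => f u = 0)) => [|a u w hu hw|g /fG //]; first exact: linear_fun0.
by rewrite lf hu hw scaler0 addr0.
Qed.

Lemma qlift_linear V W (G : V -> Prop) (f : V -> W) :
  linear f -> (forall g, G g -> f g = 0) -> linear (@qlift V W G f).
Proof.
by move=> lf fG a p q; rewrite -[p]lpi_repr -[q]lpi_repr -linearP !qliftE // lf.
Qed.

Section DirectSumMaps.
Variables (I : choiceType) (V : I -> lmodType F).

Definition dlift W (f : forall i, V i -> W) (x : dsum V) : W :=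
  \sum_(i <- supp x) f i (x i).

Lemma dlift_widen W (f : forall i, V i -> W) (x : dsum V) (s : seq I) :
  (forall i, linear (f i)) -> uniq s -> {subset supp x <= s} ->
  dlift f x = \sum_(i <- s) f i (x i).
Proof.
move=> lf us sub; rewrite /dlift [RHS](bigID (mem (supp x))) /=.
rewrite [X in _ = _ + X]big1 ?addr0; last first.
  by move=> k; rewrite mem_supp negbK => /eqP->; rewrite linear_fun0.
rewrite -[RHS]big_filter; apply: perm_big.
apply: uniq_perm (supp_uniq x) (filter_uniq _ us) _ => k.
by rewrite mem_filter; case: (boolP (k \in supp x)) => //= /sub ->.
Qed.

Lemma dlift_linear W (f : forall i, V i -> W) : (forall i, linear (f i)) -> linear (dlift f).
Proof.
move=> lf a p q; set s := undup (supp p ++ supp q).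
have us : uniq s := undup_uniq _.
have subp : {subset supp p <= s} by move=> k; rewrite mem_undup mem_cat => ->.
have subq : {subset supp q <= s} by move=> k; rewrite mem_undup mem_cat orbC => ->.
have subr : {subset supp (a *: p + q) <= s}.
  move=> k; apply: contraLR => nks; rewrite mem_supp negbK dsumDE dsumZE.
  have /negbNE/eqP-> : ~~ (p k != 0) by rewrite -mem_supp; apply: contra nks => /subp.
  have /negbNE/eqP-> : ~~ (q k != 0) by rewrite -mem_supp; apply: contra nks => /subq.
  by rewrite scaler0 addr0.
rewrite (dlift_widen lf us subp) (dlift_widen lf us subq) (dlift_widen lf us subr).
by rewrite scaler_sumr -big_split /=; apply: eq_bigr => k _; rewrite lf.
Qed.

Lemma dinj_id i (v : V i) : dinj V i v i = v.
Proof. by rewrite /= /dinj_fun; case: pselect => // e; rewrite (Prop_irrelevance e erefl). Qed.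

Lemma dinj_neq i j (v : V i) : i != j -> dinj V i v j = 0.
Proof. by move=> /eqP nij; rewrite /= /dinj_fun; case: pselect. Qed.

Lemma dinj_linear i : linear (dinj V i).
Proof.
move=> a u v; apply: dsumP => j; rewrite dsumDE dsumZE.
have [<-|nij] := eqVneq i j; first by rewrite !dinj_id.
by rewrite !dinj_neq // scaler0 addr0.
Qed.

Lemma dliftE W (f : forall i, V i -> W) i v :
  (forall i, linear (f i)) -> dlift f (dinj V i v) = f i v.
Proof.
move=> lf; rewrite (@dlift_widen _ _ _ [:: i]) // ?big_seq1 ?dinj_id // => j.
rewrite mem_supp inE; apply: contraR; rewrite eq_sym => nij.
by rewrite dinj_neq.
Qed.

Lemma dsum_sum (x : dsum V) : x = \sum_(i <- supp x) dinj V i (x i).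
Proof.
apply: dsumP => j.
have -> : (\sum_(i <- supp x) dinj V i (x i)) j = \sum_(i <- supp x) dinj V i (x i) j.
  by elim: (supp x) => [|i s ih]; rewrite ?big_nil // !big_cons dsumDE ih.
case: (boolP (j \in supp x)) => [js|].
  rewrite (bigD1_seq j) ?supp_uniq // dinj_id big1 => [|i nij]; first exact/esym/addr0.
  by rewrite dinj_neq.
move=> njs; have := njs; rewrite mem_supp negbK => /eqP ->.
rewrite big1_seq // => i /andP[_ si]; rewrite dinj_neq //.
by apply: contraNneq njs => <-.
Qed.

Lemma dsum_ext W (f g : dsum V -> W) : linear f -> linear g ->
  (forall i v, f (dinj V i v) = g (dinj V i v)) -> f =1 g.
Proof.
move=> lf lg fg x; rewrite (dsum_sum x) !linear_fun_sum //.
by apply: eq_bigr => i _.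
Qed.

End DirectSumMaps.
End LinearMaps.

Arguments dinj_linear {F I} V i.

Definition fcons (T : Type) (k : nat) (x : T) (a : 'I_k -> T) : 'I_k.+1 -> T :=
  fun i => if unlift ord0 i is Some j then a j else x.

Section FamilyCons.
Variables (T : Type) (k : nat).
Implicit Types (x : T) (a : 'I_k -> T).

Lemma fcons0 x a : fcons x a ord0 = x. Proof. by rewrite /fcons unlift_none. Qed.
Lemma fconsS x a i : fcons x a (lift ord0 i) = a i. Proof. by rewrite /fcons liftK. Qed.

Lemma fcons_eta (a : 'I_k.+1 -> T) : fcons (a ord0) (a \o lift ord0) = a.
Proof. by apply: funext => i; rewrite /fcons; case: unliftP => [j ->|->]. Qed.

Lemma fcons_lift x a : fcons x a \o lift ord0 = a.
Proof. by apply: funext => i /=; rewrite fconsS. Qed.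

Lemma upd_fcons0 x a y : upd (fcons x a) ord0 y = fcons y a.
Proof.
apply: funext => i; rewrite /upd /fcons.
by case: unliftP => [j ->|->]; rewrite ?eqxx // eq_sym (negbTE (neq_lift _ _)).
Qed.

Lemma upd_fconsS x a i y : upd (fcons x a) (lift ord0 i) y = fcons x (upd a i y).
Proof.
apply: funext => j; rewrite /upd /fcons.
by case: unliftP => [l ->|->]; rewrite ?(inj_eq lift_inj) // (negbTE (neq_lift _ _)).
Qed.

Lemma fcons_lift_perm x a (s : 'S_k) : fcons x (a \o s) = fcons x a \o lift_perm ord0 ord0 s.
Proof.
apply: funext => i /=; have [j ->|->] := unliftP ord0 i.
  by rewrite lift_perm_lift !fconsS.
by rewrite lift_perm_id !fcons0.
Qed.

End FamilyCons.

Lemma fam0 (T : Type) (a b : 'I_0 -> T) : a = b.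
Proof. by apply: funext => -[]. Qed.

(** * Maps out of spaces of chains *)

Section ChainMaps.
Variables (F : fieldType) (R : lieConformalAlgebra F).
Implicit Types (A B C : lcaModuleAlgebra R) (W : lmodType F).

Lemma xseriesP A k (phi psi : xseries A k) : (forall m, phi m = psi m) -> phi = psi.
Proof. by move=> h; apply: val_inj; apply: funext. Qed.

Lemma series_sum A k (phi : xseries A k) m : \sum_(i < k) derX i phi m = lcm_D (phi m).
Proof. by move/asboolP: (xseries_valP phi) => ->. Qed.

(** Falls back on the zero series outside the solutions of the D-equation, so that chains can be
    written with bare functions and no proof inside the term. *)
Definition ser A k (phi : expo k -> A) : xseries A k := insubd (0 : xseries A k) phi.

Arguments ser : simpl never.

Lemma serE A k (phi : expo k -> A) : phi \in @is_series F R A k -> ser phi = phi :> (expo k -> A).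
Proof. by move=> h; rewrite /ser /insubd insubT. Qed.

Lemma ser_val A k (phi : xseries A k) : ser phi = phi.
Proof. exact: valKd. Qed.

Definition tch A k (a : 'I_k -> R) (phi : expo k -> A) : chain_space A k := chain a (ser phi).

Section Chain.
Variables (A : lcaModuleAlgebra R) (k : nat).

Lemma tch_chain (a : 'I_k -> R) (phi : xseries A k) : tch a phi = chain a phi.
Proof. by rewrite /tch ser_val. Qed.

Lemma chain_series_linear (a : 'I_k -> R) : linear (@chain F R A k a).
Proof.
move=> s phi psi; rewrite /chain -linearP; apply/lpi_eqP.
exact: lspan_gen (chain_rel_series a s phi psi).
Qed.

Lemma chain_tensor_linear (a : 'I_k -> R) i (phi : xseries A k) :
  linear (fun u => chain (upd a i u) phi).
Proof.
move=> s u v; rewrite /chain -linearP; apply/lpi_eqP.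
exact: lspan_gen (chain_rel_tensor a i s u v phi).
Qed.

Lemma chain_D (a : 'I_k -> R) i (phi : xseries A k) :
  chain (upd a i (lca_D (a i))) phi = - chain a (derM i phi).
Proof.
rewrite /chain -linearN; apply/lpi_eqP; rewrite opprK.
exact: lspan_gen (chain_rel_D a i phi).
Qed.

Lemma chain_perm (a : 'I_k -> R) (s : 'S_k) (phi : xseries A k) :
  chain (a \o (s^-1)%g) (permM s phi) = (-1) ^+ s *: chain a phi.
Proof.
rewrite /chain -linearZ; apply/lpi_eqP.
exact: lspan_gen (chain_rel_perm a s phi).
Qed.

Lemma chain_ext W (f g : chain_space A k -> W) : linear f -> linear g ->
  (forall a phi, f (chain a phi) = g (chain a phi)) -> f =1 g.
Proof.
move=> lf lg fg q; rewrite -[q]lpi_repr; move: (repr q) => p.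
have lp : linear (lpi (@chain_rel F R A k)) by move=> ? ? ?; exact: linearP.
apply: (mono_ext (linear_comp lf lp) (linear_comp lg lp)) => -[a phi] x {p}.
have -> : mono (a, phi) x = x *: gen a phi.
  by rewrite /gen -(linear_funZ (@mono_linear _ _ F^o _)) /GRing.scale /= mulr1.
by rewrite linearZ !linear_funZ // -/(chain a phi) fg.
Qed.

Definition chain_ok W (f : ('I_k -> R) -> xseries A k -> W) : Prop :=
  [/\ forall a i phi, linear (fun u => f (upd a i u) phi),
      forall a, linear (f a),
      forall a i phi, f (upd a i (lca_D (a i))) phi = - f a (derM i phi) &
      forall a (s : 'S_k) phi, f (a \o (s^-1)%g) (permM s phi) = (-1) ^+ s *: f a phi].

Definition clift W (f : ('I_k -> R) -> xseries A k -> W) : chain_space A k -> W :=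
  qlift (fun p : chain_free A k => lext (fun q (x : F^o) => x *: f q.1 q.2) p).

Section Lift.
Variables (W : lmodType F) (f : ('I_k -> R) -> xseries A k -> W).
Hypothesis fok : chain_ok f.

Let ev (p : chain_free A k) : W := lext (fun q (x : F^o) => x *: f q.1 q.2) p.

Let lev : linear ev.
Proof. by apply: lext_linear => q a x y; rewrite scalerDl scalerA. Qed.

Let evE a phi : ev (gen a phi) = f a phi.
Proof. by rewrite /ev /gen lext_mono /= ?scale0r // scale1r. Qed.

Let ev_rel g : chain_rel g -> ev g = 0.
Proof.
case: fok => ft fs fD fp; case=> [a i s u v phi|a s phi psi|a i phi|a s phi].
- by rewrite (linear_funB lev) (linear_funD lev) (linear_funZ lev) !evE ft subrr.
- by rewrite (linear_funB lev) (linear_funD lev) (linear_funZ lev) !evE fs subrr.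
- by rewrite (linear_funD lev) !evE fD addNr.
- by rewrite (linear_funB lev) (linear_funZ lev) !evE fp subrr.
Qed.

Lemma cliftE a phi : clift f (chain a phi) = f a phi.
Proof. by rewrite /clift /chain qliftE. Qed.

Lemma clift_linear : linear (clift f).
Proof. exact: qlift_linear. Qed.

End Lift.

End Chain.

Section Trivial.
Variables (V : lmodType F) (D : V -> V).
Hypothesis lD : linear D.

Let act0 (a : R) (v : V) : finfam nat V := 0.
Let mul0 (u v : V) : V := 0.

Let bil0 (U1 U2 U3 : lmodType F) : bilinear_op (fun (_ : U1) (_ : U2) => 0 : U3).
Proof. by split=> ? a u v; rewrite scaler0 addr0. Qed.

Let lext0 (K : choiceType) (U U' : lmodType F) (f : K -> U -> U') : lext f 0 = 0.
Proof. by rewrite /lext big1_seq // => k /andP[_]; rewrite mem_supp dsum0E eqxx. Qed.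

Let sesq0 : sesquilinear (@lca_D F R) D act0.
Proof.
by split=> a v; rewrite /act0 /mulX1 /shift /fmap !lext0 ?oppr0 ?addr0.
Qed.

Let jac0 : lambda_jacobi (@lca_br F R) act0.
Proof.
move=> a b v; rewrite /act_lm /act_ml /act_br /act0 !lext0 subr0.
by rewrite /lext big1_seq // => k _; rewrite big1_seq // => l /andP[_]; rewrite mem_supp dsum0E eqxx.
Qed.

Definition triv_module : lcaModule R := LcaModule lD (bil0 R V _) sesq0 jac0.

Let mul0D (m n : triv_module) : @lcm_D F R triv_module (mul0 m n) =
  mul0 (@lcm_D F R triv_module m) n + mul0 m (@lcm_D F R triv_module n).
Proof. by rewrite /mul0 addr0; apply: linear_fun0. Qed.

Let mul0A (a : R) (m n : triv_module) : @lcm_act F R triv_module a (mul0 m n) =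
  fmap (mul0^~ n) (@lcm_act F R triv_module a m) + fmap (mul0 m) (@lcm_act F R triv_module a n).
Proof. by rewrite /lcm_act /= /act0 /fmap !lext0 addr0. Qed.

(* A vector space with an endomorphism, turned into an object over which chains
   can be formed: chains use only the endomorphism of the coefficients *)
Definition triv : lcaModuleAlgebra R :=
  @LcaModuleAlgebra F R triv_module mul0 (bil0 V V V) (fun _ _ => erefl)
    (fun _ _ _ => erefl) mul0D mul0A.

End Trivial.

(** The sign is chosen so that the D-equation in the remaining variables over A[[y]] is the
    D-equation in all variables, y included, over A. Coefficients are those of plain powers of y,
    whence the factor n+1. *)
Definition powD A (g : nat -> A) : nat -> A := fun n => lcm_D (g n) - g n.+1 *+ n.+1.

Lemma powD_linear A : linear (@powD A).
Proof.
move=> s g h; apply: funext => n; rewrite /powD [LHS]/=.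
change (lcm_D (s *: g n + h n) - (s *: g n.+1 + h n.+1) *+ n.+1 =
  s *: (lcm_D (g n) - g n.+1 *+ n.+1) + (lcm_D (h n) - h n.+1 *+ n.+1)).
rewrite (@lcm_D_linear F R A) mulrnDl opprD scalerDr scalerN scalerMnr.
by rewrite addrACA.
Qed.

(* A[[y]], with D - d/dy *)
Definition pow A : lcaModuleAlgebra R := triv (@powD_linear A).

Definition dhom A B (f : A -> B) : Prop := linear f /\ forall x, f (lcm_D x) = lcm_D (f x).

Lemma dhom_comp A B C (f : B -> C) (g : A -> B) : dhom f -> dhom g -> dhom (fun x => f (g x)).
Proof. by case=> lf Df [lg Dg]; split=> [|x]; [apply: linear_comp|rewrite Dg Df]. Qed.

Lemma dhom_id A : dhom (fun x : A => x). Proof. by []. Qed.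

Lemma dhom_series A B k (f : A -> B) (phi : expo k -> A) :
  dhom f -> phi \in @is_series F R A k -> f \o phi \in @is_series F R B k.
Proof.
case=> lf Df /asboolP hphi; apply/asboolP => m /=.
rewrite -Df -hphi linear_fun_sum //; apply: eq_bigr => i _.
by rewrite /derX linear_fun_muln.
Qed.

Lemma ser_linear A B k l (T : (expo k -> A) -> expo l -> B) :
  (forall phi, phi \in @is_series F R A k -> T phi \in @is_series F R B l) ->
  (forall m, linear (fun phi => T phi m)) -> linear (fun phi : xseries A k => ser (T phi)).
Proof.
move=> hT lT s phi psi; apply: xseriesP => m.
rewrite serE; last exact/hT/xseries_valP.
change (T (s *: (phi : expo k -> A) + (psi : expo k -> A)) m =
  s *: ser (T phi) m + ser (T psi) m).
by rewrite lT !serE //; apply/hT/xseries_valP.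
Qed.

Definition cmap A B k (f : A -> B) : chain_space A k -> chain_space B k :=
  clift (fun a phi => tch a (f \o phi)).

Section Cmap.
Variables (A B : lcaModuleAlgebra R) (k : nat) (f : A -> B).
Hypothesis hf : dhom f.

Let ok : chain_ok (fun a (phi : xseries A k) => tch a (f \o phi)).
Proof.
have hs (phi : xseries A k) : f \o phi \in @is_series F R B k.
  by apply: dhom_series => //; apply: xseries_valP.
split.
- by move=> a i phi; apply: chain_tensor_linear.
- move=> a; apply: linear_comp (@chain_series_linear _ _ _) _.
  apply: (ser_linear (T := fun phi => f \o phi)) => [phi|m]; first exact: dhom_series.
  by case: hf => lf _ s phi psi; apply: lf.
- move=> a i phi; rewrite /tch chain_D; congr (- chain _ _); apply: xseriesP => m.
  rewrite serE // /derM /= /derX serE //=.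
  by rewrite linear_fun_muln //; case: hf.
- move=> a s phi; rewrite /tch -chain_perm; congr (chain _ _); apply: xseriesP => m.
  by rewrite serE // /permM /= /permS serE.
Qed.

Lemma cmapE a (phi : xseries A k) : cmap f (chain a phi) = tch a (f \o phi).
Proof. exact: cliftE. Qed.

Lemma cmap_linear : linear (@cmap A B k f).
Proof. exact: clift_linear. Qed.

End Cmap.

Lemma cmap_comp A B C k (f : B -> C) (g : A -> B) : dhom f -> dhom g ->
  forall w : chain_space A k, cmap f (cmap g w) = cmap (fun x => f (g x)) w.
Proof.
move=> hf hg; have hfg := dhom_comp hf hg.
apply: chain_ext; [exact: linear_comp (cmap_linear hf) (cmap_linear hg)|exact: cmap_linear|].
move=> a phi; rewrite !cmapE // /tch; congr (chain _ _).
have hp := dhom_series hg (xseries_valP phi).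
by congr ser; apply: funext => m /=; rewrite serE.
Qed.

Lemma cmap_id A k (f : A -> A) : f =1 id -> forall w : chain_space A k, cmap f w = w.
Proof.
move=> ef; have hf : dhom f by split=> [s x y|x]; rewrite !ef.
apply: chain_ext => //; first exact: cmap_linear.
move=> a phi; rewrite cmapE //; congr chain; apply: xseriesP => m.
by rewrite serE /= ?ef //; apply: dhom_series hf (xseries_valP phi).
Qed.

Lemma eq_cmap A B k (f g : A -> B) : f =1 g -> @cmap A B k f =1 cmap g.
Proof. by move=> fg; have -> : f = g by apply: funext. Qed.

End ChainMaps.

(** * Prepending a letter *)

Lemma lift_perm_tperm n (i j : 'I_n) :
  lift_perm ord0 ord0 (tperm i j) = tperm (lift ord0 i) (lift ord0 j).
Proof.
apply/perm.permP => l; have [l' ->|->] := unliftP ord0 l.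
  by rewrite lift_perm_lift inj_tperm //; apply: lift_inj.
by rewrite lift_perm_id tpermD // eq_sym neq_lift.
Qed.

Lemma fcons_tperm (T : Type) k (x y : T) (a : 'I_k -> T) :
  fcons x (fcons y a) \o tperm ord0 (lift ord0 ord0) = fcons y (fcons x a).
Proof.
apply: funext => i /=; have [j ->|->] := unliftP ord0 i; last by rewrite tpermL !(fconsS, fcons0).
have [l ->|->] := unliftP ord0 j; last by rewrite tpermR !(fconsS, fcons0).
by rewrite tpermD ?neq_lift ?(inj_eq lift_inj) ?neq_lift // !fconsS.
Qed.

(* S_(n+1) is generated by the stabiliser of 0 and by the transposition (0 1) *)
Lemma perm_ord_ind n (P : 'S_n.+1 -> Prop) :
  (forall s t, P s -> P t -> P (s * t)%g) ->
  (forall s : 'S_n, P (lift_perm ord0 ord0 s)) ->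
  (forall i : 'I_n, i = 0%N :> nat -> P (tperm ord0 (lift ord0 i))) ->
  forall s, P s.
Proof.
move=> PM PL PT s; have [ts -> _] := prod_tpermP s.
elim: ts => [|[x y] ts ih]; first by rewrite big_nil -(lift_perm1 ord0).
rewrite big_cons; apply: (PM _ _ _ ih) => /=.
have P0 (j : 'I_n) : P (tperm ord0 (lift ord0 j)).
  (* Here j witnesses that n is positive, so that the index 0 exists. *)
  pose i : 'I_n := Ordinal (leq_ltn_trans (leq0n j) (ltn_ord j)).
  have [->|nji] := eqVneq j i; first exact: PT.
  (* The transposition (0 j+1) is conjugate to (0 1) under a transposition that fixes 0. *)
  have -> : tperm ord0 (lift ord0 j) =
      ((tperm (lift ord0 i) (lift ord0 j)) * (tperm ord0 (lift ord0 i)) *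
       (tperm (lift ord0 i) (lift ord0 j)))%g.
    have := tpermJ ord0 (lift ord0 i) (tperm (lift ord0 i) (lift ord0 j)).
    rewrite tpermL tpermD // => <-.
    by rewrite conjgE tpermV mulgA.
  by rewrite -lift_perm_tperm; do 2?[apply/PM => //]; exact: PT.
have [x' ->|->] := unliftP ord0 x; have [y' ->|->] := unliftP ord0 y => //.
- by rewrite -lift_perm_tperm.
- by rewrite tpermC.
- by rewrite tperm1 -(lift_perm1 ord0).
Qed.

Section Prepend.
Variables (F : fieldType) (R : lieConformalAlgebra F).
Implicit Types (A B C : lcaModuleAlgebra R) (W : lmodType F).

Definition unc A k (phi : expo k -> pow A) : expo k.+1 -> A :=
  fun m => phi (m \o lift ord0) (m ord0).
Definition cur A k (phi : expo k.+1 -> A) : expo k -> pow A := fun m n => phi (fcons n m).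

Lemma unc_fcons A k (phi : expo k -> pow A) n m : unc phi (fcons n m) = phi m n.
Proof. by rewrite /unc fcons_lift fcons0. Qed.

Lemma curK A k (phi : expo k.+1 -> A) : unc (cur phi) = phi.
Proof. by apply: funext => m; rewrite /unc /cur fcons_eta. Qed.

Lemma uncK A k (phi : expo k -> pow A) : cur (unc phi) = phi.
Proof. by apply: funext => m; apply: funext => n; rewrite /cur unc_fcons. Qed.

Lemma derX0 A k (phi : expo k.+1 -> A) n m :
  derX ord0 phi (fcons n m) = phi (fcons n.+1 m) *+ n.+1.
Proof. by rewrite /derX upd_fcons0 fcons0. Qed.

Lemma derXS A k i (phi : expo k.+1 -> A) n m :
  derX (lift ord0 i) phi (fcons n m) = phi (fcons n (upd m i (m i).+1)) *+ (m i).+1.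
Proof. by rewrite /derX upd_fconsS fconsS. Qed.

Lemma unc_series A k (phi : expo k -> pow A) :
  phi \in @is_series F R (pow A) k -> unc phi \in @is_series F R A k.+1.
Proof.
move=> /asboolP h; apply/asboolP => m; rewrite -[m]fcons_eta.
move: (m ord0) (m \o _) => {m} n m; rewrite big_ord_recl derX0 !unc_fcons.
have /(congr1 (@^~ n)) := h m; rewrite /= /powD fct_sumE => e.
rewrite -[lcm_D _](subrK (phi m n.+1 *+ n.+1)) addrC; congr (_ + _); rewrite -e.
by apply: eq_bigr => i _; rewrite derXS unc_fcons /derX natmulfctE.
Qed.

Lemma cur_series A k (phi : expo k.+1 -> A) :
  phi \in @is_series F R A k.+1 -> cur phi \in @is_series F R (pow A) k.
Proof.
move=> /asboolP h; apply/asboolP => m; apply: funext => n.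
rewrite /= /powD /cur -h big_ord_recl derX0 [X in X - _]addrC addrK fct_sumE.
by apply: eq_bigr => i _; rewrite derXS /derX natmulfctE.
Qed.

(** The operator e_b: the variable y of the coefficients becomes x_0, the variable that belongs to
    b. *)
Definition ecr A k (b : R) : chain_space (pow A) k -> chain_space A k.+1 :=
  clift (fun a phi => tch (fcons b a) (unc phi)).

Section PrependMap.
Variables (A : lcaModuleAlgebra R) (k : nat).

Let uncs (phi : xseries (pow A) k) : unc phi \in @is_series F R A k.+1.
Proof. exact/unc_series/xseries_valP. Qed.

Let ok (b : R) : chain_ok (fun a (phi : xseries (pow A) k) => tch (fcons b a) (unc phi)).
Proof.
split.
- move=> a i phi s u v; rewrite -!upd_fconsS; exact: chain_tensor_linear.
- move=> a; apply: linear_comp (@chain_series_linear _ _ _ _ _) _.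
  by apply: (ser_linear (T := @unc A k)) => [|m s phi psi]; first exact: unc_series.
- move=> a i phi; rewrite -upd_fconsS -[in LHS](fconsS b a i) /tch chain_D.
  congr (- chain _ _); apply: xseriesP => m; rewrite serE // -[m]fcons_eta.
  by rewrite unc_fcons /= /derX serE // -/(derX _ _ _) derXS unc_fcons natmulfctE.
(* A permutation of the remaining letters extends by fixing the first one, with the same sign. *)
- move=> a s phi; rewrite -(odd_lift_perm ord0 ord0 s : (_ = s :> bool)) /tch -chain_perm.
  rewrite lift_permV fcons_lift_perm; congr (chain _ _).
  apply: xseriesP => m; rewrite serE ?uncs //= /permS serE //.
  rewrite -[m]fcons_eta -fcons_lift_perm.
  by rewrite !unc_fcons.
Qed.

Lemma ecrE b a (phi : xseries (pow A) k) : ecr b (chain a phi) = tch (fcons b a) (unc phi).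
Proof. exact: cliftE. Qed.

Lemma ecr_linear b : linear (@ecr A k b).
Proof. exact: clift_linear. Qed.

Lemma ecr_linear_l (w : chain_space (pow A) k) : linear (fun b => ecr b w).
Proof.
move=> s u v; apply: (chain_ext (f := ecr (s *: u + v))
  (g := fun w => s *: ecr u w + ecr v w)).
- exact: ecr_linear.
- by apply: linear_add; [apply: linear_scale|]; exact: ecr_linear.
move=> a phi; rewrite !ecrE -(upd_fcons0 0 a u) -(upd_fcons0 0 a v).
by rewrite -(upd_fcons0 0 a (s *: u + v)) /tch chain_tensor_linear.
Qed.

End PrependMap.

Section Variables.
Variable A : lcaModuleAlgebra R.

Lemma pow_D (g : pow A) n : (lcm_D g : pow A) n = lcm_D (g n) - g n.+1 *+ n.+1.
Proof. by []. Qed.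
Lemma pow_add (g h : pow A) n : (g + h) n = g n + h n. Proof. by []. Qed.
Lemma pow_opp (g : pow A) n : (- g) n = - g n. Proof. by []. Qed.
Lemma pow_scale s (g : pow A) n : (s *: g) n = s *: g n. Proof. by []. Qed.
Lemma pow_muln (g : pow A) k n : (g *+ k) n = g n *+ k.
Proof. by rewrite natmulfctE. Qed.
Lemma pow_sum (I : Type) (r : seq I) (P : pred I) (g : I -> pow A) n :
  (\sum_(i <- r | P i) g i) n = \sum_(i <- r | P i) g i n.
Proof. by rewrite fct_sumE. Qed.

End Variables.

Definition powE := (pow_D, pow_add, pow_opp, pow_scale, pow_muln).

Section Substitutions.
Variable A : lcaModuleAlgebra R.

Definition flip (g : pow (pow A)) : pow (pow A) := fun m n => g n m.
Definition dy (g : pow A) : pow A := fun n => g n.+1 *+ n.+1.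
(* setting both variables equal *)
Definition mrg (g : pow (pow A)) : pow A := fun n => \sum_(s < n.+1) g s (n - s)%N.

Lemma flip_dhom : dhom flip.
Proof.
split=> [s g h|g] //; apply: funext => m; apply: funext => n.
by rewrite /flip !powE addrAC.
Qed.

Lemma dy_dhom : dhom dy.
Proof.
split=> [s g h|g]; apply: funext => n; rewrite /dy !powE.
  by rewrite mulrnDl scalerMnr.
by rewrite mulrnBl (linear_fun_muln (@lcm_D_linear _ _ _)).
Qed.

End Substitutions.

Definition pmap A B (f : A -> B) (g : pow A) : pow B := fun n => f (g n).

Lemma pmap_dhom A B (f : A -> B) : dhom f -> dhom (pmap f).
Proof.
case=> lf Df; split=> [s g h|g]; apply: funext => n; rewrite /pmap !powE ?lf //.
by rewrite linear_funB // linear_fun_muln // Df.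
Qed.

Section Merge.
Variable A : lcaModuleAlgebra R.

Lemma mrg_flip (g : pow (pow A)) : mrg (flip g) = mrg g.
Proof.
apply: funext => n; rewrite /mrg (reindex_inj rev_ord_inj) /=.
by apply: eq_bigr => s _; rewrite /flip subSS subKn // -ltnS.
Qed.

Lemma mrg_linear : linear (@mrg A).
Proof.
move=> s g h; apply: funext => n; rewrite /mrg !powE scaler_sumr -big_split.
by apply: eq_bigr => i _; rewrite !powE.
Qed.

(** The chain rule on the diagonal; [diag_sum] is its form on coefficients. *)
Lemma dy_mrg (g : pow (pow A)) : dy (mrg g) = mrg (dy g + pmap (@dy A) g).
Proof.
apply: funext => n; rewrite /dy /mrg (diag_sum (fun p q => g q p)).
by apply: eq_bigr => s _; rewrite !powE addrC.
Qed.

(** On A[[y, z]] the derivation is D - d/dy - d/dz, and by the chain rule the sum of both partial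
    derivatives restricts on the diagonal to the derivative of the restriction. *)
Lemma mrg_dhom : dhom (@mrg A).
Proof.
split; first exact: mrg_linear.
move=> g; apply: funext => n; rewrite powE -[_ *+ n.+1]/(dy (mrg g) n) dy_mrg.
rewrite /mrg (linear_fun_sum (@lcm_D_linear _ _ _)) -sumrB; apply: eq_bigr => s _.
by rewrite !powE opprD addrA addrAC /dy pow_muln.
Qed.

End Merge.

Section EcrLaws.
Variables (A : lcaModuleAlgebra R) (k : nat).

Lemma ecr_D b (w : chain_space (pow A) k) : ecr (lca_D b) w = - ecr b (cmap (@dy A) w).
Proof.
have hd := dy_dhom A.
move: w; apply: chain_ext; first exact: ecr_linear.
  by apply: linear_opp; exact: linear_comp (@ecr_linear _ _ _) (cmap_linear hd).
move=> a phi; rewrite cmapE // /tch !ecrE -(upd_fcons0 b a) -[X in lca_D X](fcons0 b a) /tch chain_D.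
congr (- chain _ _); apply: xseriesP => m.
have hp := dhom_series hd (xseries_valP phi).
rewrite [in RHS]serE; last exact/unc_series/xseries_valP.
rewrite -[m]fcons_eta unc_fcons serE //= -[m]fcons_eta derX0 serE ?unc_fcons //.
exact/unc_series/xseries_valP.
Qed.

Lemma cmap_ecr B (f : A -> B) b (w : chain_space (pow A) k) : dhom f ->
  cmap f (ecr b w) = ecr b (cmap (pmap f) w).
Proof.
move=> hf; have hp := pmap_dhom hf; move: w; apply: chain_ext.
- exact: linear_comp (cmap_linear hf) (@ecr_linear _ _ _).
- exact: linear_comp (@ecr_linear _ _ _) (cmap_linear hp).
move=> a phi; rewrite cmapE // /tch !ecrE /tch cmapE // /tch; congr chain; apply: xseriesP => m.
have h1 : unc phi \in @is_series _ _ _ k.+1 by exact/unc_series/xseries_valP.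
have h2 := dhom_series hp (xseries_valP phi).
have h3 : unc (pmap f \o phi) \in @is_series _ _ B k.+1 by exact/unc_series.
by rewrite !serE.
Qed.

End EcrLaws.

(** The transposition of the first two letters is odd and exchanges their variables: on the left
    side the outer variable of w belongs to c and the inner one to b. *)
Lemma ecr_swap A k b c (w : chain_space (pow (pow A)) k) :
  ecr b (ecr c w) = - ecr c (ecr b (cmap (@flip A) w)).
Proof.
have hf := flip_dhom A; move: w; apply: chain_ext.
- exact: linear_comp (@ecr_linear _ _ _) (@ecr_linear _ _ _).
- apply: linear_opp; apply: (linear_comp (@ecr_linear _ _ _)).
  exact: linear_comp (@ecr_linear _ _ _) (cmap_linear hf).
move=> a phi; rewrite cmapE // /tch !ecrE /tch.
have h1 := unc_series (xseries_valP phi); have h2 := unc_series h1.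
have h3 := dhom_series hf (xseries_valP phi); have h4 := unc_series h3; have h5 := unc_series h4.
pose s : 'S_k.+2 := tperm ord0 (lift ord0 ord0).
have e := chain_perm (fcons b (fcons c a)) s (ser (unc (unc phi))).
rewrite odd_tperm expr1 scaleN1r tpermV fcons_tperm in e.
rewrite (serE h3) (serE h4) (serE h1).
apply: oppr_inj; rewrite opprK -e; congr chain; apply: xseriesP => m.
rewrite (serE h5) /= /permS (serE h2).
rewrite -[m]fcons_eta; move: (m ord0) (m \o _) => n0 {}m.
rewrite -[m]fcons_eta; move: (m ord0) (m \o _) => n1 {}m.
by rewrite fcons_tperm !unc_fcons.
Qed.

Lemma ecr_chain A k (a : 'I_k.+1 -> R) (phi : xseries A k.+1) :
  chain a phi = ecr (a ord0) (tch (a \o lift ord0) (cur phi)).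
Proof.
have h1 := cur_series (xseries_valP phi).
rewrite /tch ecrE fcons_eta /tch; congr chain; apply: xseriesP => m.
by rewrite (serE h1) curK serE //; apply: xseries_valP.
Qed.

Section Recursion.
Variables (A : lcaModuleAlgebra R) (k : nat) (W : lmodType F).

(** Alternation concerns two letters, so it is void when the chain prepended to has degree 0; a case
    analysis on k gives access to the second letter. *)
Definition ecr_alt (u : R -> chain_space (pow A) k -> W) : Prop :=
  match k return (R -> chain_space (pow A) k -> W) -> Prop with
  | 0 => fun _ => True
  | k'.+1 => fun u => forall b c w, u b (ecr c w) = - u c (ecr b (cmap (@flip A) w))
  end u.

(** The relations that involve the first letter. All others hold already inside the second argument
    of u, which is a class. *)
Definition crec_ok (u : R -> chain_space (pow A) k -> W) : Prop :=
  [/\ forall w, linear (u^~ w), forall b, linear (u b),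
      forall b w, u (lca_D b) w = - u b (cmap (@dy A) w) & ecr_alt u].

Definition crec (u : R -> chain_space (pow A) k -> W) : chain_space A k.+1 -> W :=
  clift (fun a phi => u (a ord0) (tch (a \o lift ord0) (cur phi))).

End Recursion.

(** Among the generating permutations only the transposition (0 1) needs alternation. Its second
    index is given as an i of value 0, since k may be 0. *)
Lemma crec_tperm A k W (u : R -> chain_space (pow A) k -> W) (i : 'I_k) a (phi : xseries A k.+1) :
  let f a (phi : xseries A k.+1) := u (a ord0) (tch (a \o lift ord0) (cur phi)) in
  let s := tperm ord0 (lift ord0 i) in
  ecr_alt u -> i = 0%N :> nat ->
  f (a \o (s^-1)%g) (permM s phi) = (-1) ^+ s *: f a phi.
Proof.
case: k u i a phi => [|k] u i a phi; first by case: i.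
move=> f s us i0; have {i0} ei : i = ord0 by apply: val_inj.
have hf := flip_dhom A.
rewrite {}/s {i}ei odd_tperm expr1 scaleN1r tpermV.
rewrite -[a]fcons_eta; move: (a ord0) (a \o _) => b {}a.
rewrite -[a]fcons_eta; move: (a ord0) (a \o _) => c {}a.
rewrite fcons_tperm {}/f !fcons0 !fcons_lift.
have h x (psi : xseries A k.+2) : tch (fcons x a) (cur psi) = ecr x (tch a (cur (cur psi))).
  have h1 := cur_series (xseries_valP psi).
  have e := ecr_chain (fcons x a) (ser (cur psi)).
  by rewrite (serE h1) fcons0 fcons_lift in e.
have h2 := cur_series (cur_series (xseries_valP (permM (tperm ord0 (lift ord0 ord0)) phi))).
have e : cmap (@flip A) (tch a (cur (cur (permM (tperm ord0 (lift ord0 ord0)) phi)))) =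
    tch a (cur (cur phi)).
  apply: etrans (cmapE hf _ _) _; rewrite /tch (serE h2); apply: (congr1 (chain a)).
  apply: (congr1 (@ser F R _ _)); apply: funext => m.
  by do 2![apply: funext => ?]; congr (xseries_val phi _); apply: fcons_tperm.
apply: etrans (congr1 (u c) (h b _)) _; apply: etrans (us _ _ _) _.
apply: (congr1 -%R); apply: etrans _ (esym (congr1 (u b) (h c _))).
exact: (congr1 (fun v => u b (ecr c v)) e).
Qed.

Section RecursionLaws.
Variables (A : lcaModuleAlgebra R) (k : nat) (W : lmodType F).
Variable u : R -> chain_space (pow A) k -> W.
Hypothesis uok : crec_ok u.

Let f (a : 'I_k.+1 -> R) (phi : xseries A k.+1) : W := u (a ord0) (tch (a \o lift ord0) (cur phi)).

Let curs (phi : xseries A k.+1) : cur phi \in @is_series _ _ (pow A) k.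
Proof. exact/cur_series/xseries_valP. Qed.

Let f_perm (s : 'S_k.+1) : forall a phi, f (a \o (s^-1)%g) (permM s phi) = (-1) ^+ s *: f a phi.
Proof.
case: uok => ul ur _ us; elim/perm_ord_ind: s => [s t hs ht a phi|s a phi|i i0 a phi].
- have -> : a \o ((s * t)^-1)%g = (a \o (s^-1)%g) \o (t^-1)%g.
    by apply: funext => i /=; rewrite invMg perm.permM.
  have -> : permM (s * t)%g phi = permM t (permM s phi).
    apply: xseriesP => m; rewrite /= /permS; congr (xseries_val phi _).
    by apply: funext => i /=; rewrite perm.permM.
  by rewrite ht hs scalerA -signr_addb odd_permM addbC.
(* A permutation fixing 0 is absorbed by the permutation relation of the shorter chain. *)
- rewrite odd_lift_perm /= /f /= lift_permV lift_perm_id -(linear_funZ (ur _)).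
  congr (u _ _); rewrite /tch -chain_perm.
  have -> : (a \o lift_perm ord0 ord0 (s^-1)%g) \o lift ord0 = (a \o lift ord0) \o (s^-1)%g.
    by apply: funext => j /=; rewrite lift_perm_lift.
  congr chain; apply: xseriesP => m; rewrite (serE (curs (permM _ _))) [RHS]/= /permS (serE (curs _)).
  by apply: funext => n; rewrite /cur /= /permS -fcons_lift_perm.
- exact: (crec_tperm a phi us i0).
Qed.

Let ok : chain_ok f.
Proof.
case: (uok) => ul ur uD us; split=> [a i phi|a|a i phi|a s phi]; last exact: f_perm.
- have [j ->|->] := unliftP ord0 i => s x y; rewrite /f.
    rewrite !upd_neq ?neq_lift //.
    have e z : upd a (lift ord0 j) z \o lift ord0 = upd (a \o lift ord0) j z.
      by apply: funext => l; rewrite /upd /= (inj_eq lift_inj).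
    by rewrite !e -ur /tch chain_tensor_linear.
  have e z : upd a ord0 z \o lift ord0 = a \o lift ord0.
    by apply: funext.
  by rewrite !upd_id !e ul.
- apply: linear_comp (ur _) _; apply: linear_comp (@chain_series_linear _ _ _ _ _) _.
  by apply: (ser_linear (T := @cur A k)) => [|m s phi psi]; first exact: cur_series.
- rewrite /f; have [j ->|->] := unliftP ord0 i.
    rewrite upd_neq ?neq_lift //.
    have -> : upd a (lift ord0 j) (lca_D (a (lift ord0 j))) \o lift ord0 =
        upd (a \o lift ord0) j (lca_D ((a \o lift ord0) j)).
      by apply: funext => l; rewrite /upd /= (inj_eq lift_inj).
    rewrite /tch chain_D linear_funN //; congr (- u _ (chain _ _)); apply: xseriesP => m.
    rewrite serE // /= /derX serE //; apply: funext => n.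
    by rewrite /cur -/(derX _ _ _) derXS natmulfctE.
  rewrite upd_id uD; have -> : upd a ord0 (lca_D (a ord0)) \o lift ord0 = a \o lift ord0.
    by apply: funext.
  have hd := dy_dhom A.
  rewrite /tch cmapE //; congr (- u _ (chain _ _)); apply: xseriesP => m.
  have h1 := dhom_series hd (curs phi).
  rewrite (serE (curs phi)) (serE h1) (serE (curs _)) /=.
  by apply: funext => n; rewrite /cur /= derX0.
Qed.

Lemma crecE b w : crec u (ecr b w) = u b w.
Proof.
case: uok => _ ur _ _; move: w; apply: chain_ext => [||a phi].
- exact: linear_comp (clift_linear ok) (@ecr_linear _ _ _).
- exact: ur.
rewrite ecrE /tch /crec cliftE // fcons0 fcons_lift; congr (u _ _).
rewrite /tch; congr chain; apply: xseriesP => m.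
have h1 := unc_series (xseries_valP phi).
by rewrite (serE h1) uncK ser_val.
Qed.

Lemma crec_linear : linear (crec u).
Proof. exact: clift_linear. Qed.

End RecursionLaws.

Lemma ecr_ext A k W (f g : chain_space A k.+1 -> W) : linear f -> linear g ->
  (forall b w, f (ecr b w) = g (ecr b w)) -> f =1 g.
Proof.
move=> lf lg fg; by apply: chain_ext => // a phi; rewrite ecr_chain fg.
Qed.

End Prepend.

Global Opaque cmap ecr crec.

(** * Inserting a bracket *)

Section LieDerivative.
Variables (F : fieldType) (R : lieConformalAlgebra F).
Implicit Types (A B C : lcaModuleAlgebra R) (W : lmodType F).

Lemma dhom_add A B (f g : A -> B) : dhom f -> dhom g -> dhom (fun x => f x + g x).
Proof.
move=> [lf Df] [lg Dg]; split=> [|x]; first exact: linear_add.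
by rewrite Df Dg (linear_funD (@lcm_D_linear _ _ _)).
Qed.

Lemma dhom_scale A B (f : A -> B) s : dhom f -> dhom (fun x => s *: f x).
Proof.
move=> [lf Df]; split=> [|x]; first exact: linear_scale.
by rewrite Df (linear_funZ (@lcm_D_linear _ _ _)).
Qed.

Lemma cmapD A B k (f g : A -> B) (w : chain_space A k) : dhom f -> dhom g ->
  cmap (fun x => f x + g x) w = cmap f w + cmap g w.
Proof.
move=> hf hg; have hfg := dhom_add hf hg; move: w; apply: chain_ext.
- exact: cmap_linear.
- by apply: linear_add; apply: cmap_linear.
move=> a phi; rewrite !cmapE // /tch -(linear_funD (@chain_series_linear _ _ _ _ _)).
congr chain; apply: xseriesP => m; have hp := xseries_valP phi.
rewrite (serE (dhom_series hfg hp)) /=.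
by rewrite -[RHS]/(ser _ m + ser _ m) (serE (dhom_series hf hp)) (serE (dhom_series hg hp)).
Qed.

Lemma cmapZ A B k (f : A -> B) s (w : chain_space A k) : dhom f ->
  cmap (fun x => s *: f x) w = s *: cmap f w.
Proof.
move=> hf; have hsf := dhom_scale s hf; move: w; apply: chain_ext.
- exact: cmap_linear.
- by apply: linear_scale; apply: cmap_linear.
move=> a phi; rewrite !cmapE // /tch -(linear_funZ (@chain_series_linear _ _ _ _ _)).
congr chain; apply: xseriesP => m; have hp := xseries_valP phi.
by rewrite (serE (dhom_series hsf hp)) /= -[RHS]/(s *: ser _ m) (serE (dhom_series hf hp)).
Qed.

Lemma iter_dy_dhom A l : dhom (iter l (@dy F R A)).
Proof. by elim: l => [|l ih] //; apply: dhom_comp ih; apply: dy_dhom. Qed.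

Lemma iter_dy_eval A l (g : pow (pow A)) i j :
  iter l (@dy F R (pow A)) g i j = iter l (@dy F R A) (g^~ j) i.
Proof.
elim: l i => [|l ih] i //; rewrite !iterS /dy pow_muln; congr (_ *+ _); exact: ih.
Qed.

(* (d/dy)^l in the inner variable followed by the identification of both variables *)
Definition mrgl A l (g : pow (pow A)) : pow A := mrg (pmap (iter l (@dy F R A)) g).

Lemma mrgl_dhom A l : dhom (@mrgl A l).
Proof. by apply: dhom_comp (@mrg_dhom _ _ _) _; apply: pmap_dhom; apply: iter_dy_dhom. Qed.

Lemma mrglS A l (g : pow (pow A)) : mrgl l.+1 g = mrgl l (pmap (@dy F R A) g).
Proof. by congr mrg; apply: funext => n; rewrite /pmap iterSr. Qed.

Lemma dy_pmap A B (f : A -> B) (g : pow A) : linear f -> dy (pmap f g) = pmap f (dy g).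
Proof. by move=> lf; apply: funext => n; rewrite /dy /pmap linear_fun_muln. Qed.

Lemma iter_dy_pmap A B (f : A -> B) l (g : pow A) : linear f ->
  iter l (@dy F R B) (pmap f g) = pmap f (iter l (@dy F R A) g).
Proof. by move=> lf; elim: l => [|l ih] //; rewrite !iterS ih dy_pmap. Qed.

Lemma dy_mrgl A l (g : pow (pow A)) : dy (mrgl l g) = mrgl l (dy g) + mrgl l.+1 g.
Proof.
rewrite /mrgl dy_mrg (linear_funD (@mrg_linear _ _ _)) dy_pmap //.
by case: (iter_dy_dhom A l).
Qed.

Lemma mrg_pmap A B (f : A -> B) (g : pow (pow A)) : linear f ->
  mrg (pmap (pmap f) g) = pmap f (mrg g).
Proof. by move=> lf; apply: funext => n; rewrite /mrg /pmap linear_fun_sum. Qed.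

Lemma mrgl_pmap A B (f : A -> B) l (g : pow (pow A)) : linear f ->
  mrgl l (pmap (pmap f) g) = pmap f (mrgl l g).
Proof.
move=> lf; rewrite /mrgl -mrg_pmap //; congr mrg; apply: funext => n.
exact: iter_dy_pmap.
Qed.

(** p plays the part of the polynomial [b_lambda c], lambda acting as the derivative in the variable
    of b before the two variables merge. Leaving p free turns the axioms of the lambda-bracket into
    linear identities in p. *)
Definition bri A k (w : chain_space (pow (pow A)) k) (p : finfam nat R) : chain_space A k.+1 :=
  lext (fun l r => ecr r (cmap (@mrgl A l) w)) p.

(* the bracket [b, c] with its variable, b having the inner variable of w *)
Definition ebr A k (b c : R) (w : chain_space (pow (pow A)) k) : chain_space A k.+1 :=
  bri w (lca_br b c).

Section BracketInsertion.
Variables (A : lcaModuleAlgebra R) (k : nat).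
Implicit Types (w : chain_space (pow (pow A)) k) (p : finfam nat R).

Let linr l w : linear (fun r => ecr r (cmap (@mrgl A l) w)).
Proof. exact: ecr_linear_l. Qed.

Lemma bri_linear w : linear (bri w). Proof. exact: lext_linear. Qed.

Lemma bri_mono w l r : bri w (mono l r) = ecr r (cmap (@mrgl A l) w).
Proof. exact: lext_mono_lin. Qed.

Lemma bri_linear_l p : linear (fun w => bri w p).
Proof.
apply: lext_linear_l => l r.
exact: linear_comp (@ecr_linear _ _ _ _ _) (cmap_linear (mrgl_dhom A l)).
Qed.

Lemma bri_mulX1 w p : bri w (mulX1 p) = bri (cmap (pmap (@dy F R A)) w) p.
Proof.
have lX : linear (@mulX1 F R) by apply: lext_linear => n; apply: mono_linear.
have hd := pmap_dhom (@dy_dhom F R A); have hm := @mrgl_dhom A.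
apply: (mono_ext (linear_comp (bri_linear w) lX) (bri_linear _)) => n v.
rewrite /mulX1 /shift lext_mono_lin ?bri_mono; last exact: mono_linear.
rewrite cmap_comp //; congr ecr; apply: eq_cmap => g; exact: mrglS.
Qed.

(** The relation for the letter D r yields minus the derivative in the merged variable, which the
    chain rule splits into the two partial derivatives; the inner one is multiplication by
    lambda. *)
Lemma bri_D w p :
  bri w (fmap (@lca_D F R) p) = - (bri (cmap (@dy F R (pow A)) w) p + bri w (mulX1 p)).
Proof.
have lD := @lca_D_linear F R; have lX : linear (@mulX1 F R).
  by apply: lext_linear => n; apply: mono_linear.
have hd := @dy_dhom F R; have hm := @mrgl_dhom A.
have l2 : linear (fun p => - (bri (cmap (@dy F R (pow A)) w) p + bri w (mulX1 p))).
  apply: linear_opp; apply: linear_add; first exact: bri_linear.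
  exact: linear_comp (bri_linear w) lX.
apply: (mono_ext (linear_comp (bri_linear w) (fmap_linear lD)) l2) => n v; rewrite /fmap /mulX1 /shift !lext_mono_lin ?bri_mono; last 2 first.
- exact: mono_linear.
- by apply: linear_comp => //; apply: mono_linear.
rewrite ecr_D !cmap_comp //; congr (- _).
rewrite -(linear_funD (@ecr_linear _ _ _ _ _)) -cmapD //; last exact: dhom_comp.
by congr ecr; apply: eq_cmap => g; rewrite dy_mrgl.
Qed.

Lemma ebr_linear b c : linear (@ebr A k b c).
Proof. exact: bri_linear_l. Qed.

Lemma ebr_linear1 c w : linear (fun b => ebr b c w).
Proof.
by have [lb _] := @lca_br_bilinear F R; apply: (linear_comp (bri_linear w) (lb c)).
Qed.

Lemma ebr_linear2 b w : linear (fun c => ebr b c w).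
Proof.
by have [_ lb] := @lca_br_bilinear F R; apply: (linear_comp (bri_linear w) (lb b)).
Qed.

Lemma ebr_D1 b c w : ebr (lca_D b) c w = - ebr b c (cmap (pmap (@dy F R A)) w).
Proof.
have [e _] := @lca_br_sesquilinear F R.
by rewrite /ebr e (linear_funN (bri_linear w)) bri_mulX1.
Qed.

Lemma ebr_D2 b c w : ebr b (lca_D c) w = - ebr b c (cmap (@dy F R (pow A)) w).
Proof.
have [_ e] := @lca_br_sesquilinear F R.
by rewrite /ebr e (linear_funD (bri_linear w)) bri_D opprD addrNK.
Qed.

Lemma cmap_bri B (f : A -> B) w p : dhom f ->
  cmap f (bri w p) = bri (cmap (pmap (pmap f)) w) p.
Proof.
move=> hf; have h1 := pmap_dhom hf; have h2 := pmap_dhom h1.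
rewrite /bri (lext_comp _ _ (cmap_linear hf)); apply: eq_lext => l r.
rewrite cmap_ecr // !cmap_comp //; try exact: mrgl_dhom.
by congr ecr; apply: eq_cmap => g; rewrite mrgl_pmap //; case: hf.
Qed.

Lemma cmap_ebr B (f : A -> B) b c w : dhom f ->
  cmap f (ebr b c w) = ebr b c (cmap (pmap (pmap f)) w).
Proof. exact: cmap_bri. Qed.

Definition skew_op p : finfam nat R := - mulX1 p - fmap (@lca_D F R) p.

(** Replacing lambda by -lambda-D passes from the inner derivative to the outer one: the two
    contributions of lambda cancel in [bri_D]. *)
Lemma bri_skew_op w p : bri w (skew_op p) = bri (cmap (@dy F R (pow A)) w) p.
Proof.
have lw := bri_linear w.
by rewrite /skew_op (linear_funB lw) (linear_funN lw) bri_D opprK addrC addrK.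
Qed.

Lemma bri_iter_skew_op w n p :
  bri w (iter n skew_op p) = bri (cmap (iter n (@dy F R (pow A))) w) p.
Proof.
elim: n w => [|n ih] w; first by rewrite cmap_id.
rewrite iterS.
rewrite bri_skew_op.
apply: etrans (ih _) _.
rewrite cmap_comp; [|exact: iter_dy_dhom|exact: dy_dhom].
apply: (congr1 (fun v => bri v p)); apply: eq_cmap => g; exact/esym/iterSr.
Qed.

(** By [bri_iter_skew_op] the coefficients of [c_lambda b] come with derivatives in the outer
    variable, that of c, and restriction to the diagonal is symmetric. *)
Lemma ebr_skew b c w : ebr b c w = - ebr c b (cmap (@flip F R A) w).
Proof.
have hm := @mrgl_dhom A; have hf := @flip_dhom F R A; have lw := bri_linear w.
have hd l := iter_dy_dhom (pow A) l.
rewrite /ebr lca_br_skew (linear_funN lw); congr (- _).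
have -> : skew_subst (@lca_D F R) (lca_br c b) =
  lext (fun n v => iter n skew_op (mono 0%N v)) (lca_br c b) by [].
rewrite (lext_comp _ _ lw) [RHS]/bri; apply: eq_lext => n v.
rewrite bri_iter_skew_op.
rewrite bri_mono !cmap_comp //.
congr ecr; apply: eq_cmap => g; rewrite /mrgl -mrg_flip; congr mrg.
apply: funext => i; apply: funext => j; exact: iter_dy_eval.
Qed.

End BracketInsertion.
End LieDerivative.

(** * Lie derivatives of chains *)

Section EvModules.
Variables (F : fieldType) (R : lieConformalAlgebra F).
Implicit Types (A B C : lcaModuleAlgebra R) (W : lmodType F).

(* ev b g = b_(d/dy) g at y = 0, up to a sign: a right action of R on A[[y]] *)
Record is_ev A (ev : R -> pow A -> A) : Prop := IsEv {
  ev_dhom : forall b, dhom (ev b);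
  ev_linear : forall g, linear (ev^~ g);
  ev_D : forall b g, ev (lca_D b) g = - ev b (dy g);
  ev_br : forall b c (g : pow (pow A)),
    ev b (pmap (ev c) (flip g)) - ev c (pmap (ev b) g) =
    - lext (fun l r => ev r (mrgl l g)) (lca_br b c) }.

(** The outer variable is contracted with b; the inner one is a parameter carried along. *)
Definition powev A (ev : R -> pow A -> A) : R -> pow (pow A) -> pow A :=
  fun b g => pmap (ev b) (flip g).

Definition evhom A B (evA : R -> pow A -> A) (evB : R -> pow B -> B) (f : A -> B) : Prop :=
  dhom f /\ forall b g, f (evA b g) = evB b (pmap f g).

Lemma powev_is_ev A (ev : R -> pow A -> A) : is_ev ev -> is_ev (powev ev).
Proof.
move=> hev; split.
- move=> b; apply: (@dhom_comp _ _ _ _ _ (pmap (ev b))); last exact: flip_dhom.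
  exact/pmap_dhom/ev_dhom.
- move=> g s u v; apply: funext => n; rewrite !powE; exact: ev_linear.
- move=> b g; apply: funext => n; rewrite !powE /powev /pmap ev_D //.
  congr (- ev _ _); apply: funext => i; by rewrite /dy /flip powE.
move=> b c g; apply: funext => n; rewrite !powE.
(* Freezing the exponent of the parameter reduces the claim to [ev_br] over A. *)
pose gn : pow (pow A) := fun j i => g j i n.
have := ev_br hev b c gn; set l1 := ev b _; set l2 := ev c _ => e.
have -> : powev ev b (pmap (powev ev c) (flip g)) n = l1 by [].
have -> : powev ev c (pmap (powev ev b) g) n = l2 by [].
rewrite e; congr (- _).
have ln : linear (fun h : pow A => h n) by [].
rewrite (lext_comp _ _ ln); apply: eq_lext => l r.
rewrite /powev /pmap; congr (ev _ _); apply: funext => i.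
rewrite /flip /mrgl /mrg pow_sum; apply: eq_bigr => s _.
by rewrite /pmap iter_dy_eval.
Qed.

Lemma pmap_evhom A B (evA : R -> pow A -> A) (evB : R -> pow B -> B) (f : A -> B) :
  evhom evA evB f -> evhom (powev evA) (powev evB) (pmap f).
Proof.
move=> [hf ef]; split=> [|b g]; first exact: pmap_dhom.
by apply: funext => n; rewrite /powev /pmap ef.
Qed.

Section EvHoms.
Variables (A : lcaModuleAlgebra R) (ev : R -> pow A -> A).
Hypothesis hev : is_ev ev.

Let lev b : linear (ev b). Proof. by case: (ev_dhom hev b). Qed.

Lemma flip_evhom : evhom (powev (powev ev)) (powev (powev ev)) (@flip F R A).
Proof. by split; first exact: flip_dhom. Qed.

Lemma dy_evhom : evhom (powev ev) (powev ev) (@dy F R A).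
Proof.
split=> [|b g]; first exact: dy_dhom.
apply: funext => n; rewrite /dy /powev /pmap -(linear_fun_muln (lev b)).
by congr (ev _ _); apply: funext => i; rewrite powE.
Qed.

Lemma mrg_evhom : evhom (powev (powev ev)) (powev ev) (@mrg F R A).
Proof.
split=> [|b g]; first exact: mrg_dhom.
apply: funext => n; rewrite /mrg /powev /pmap -(linear_fun_sum (lev b)).
by congr (ev _ _); apply: funext => i; rewrite pow_sum.
Qed.

End EvHoms.

Lemma evhom_comp A B C (evA : R -> pow A -> A) (evB : R -> pow B -> B) (evC : R -> pow C -> C)
    (f : B -> C) (g : A -> B) :
  evhom evB evC f -> evhom evA evB g -> evhom evA evC (fun x => f (g x)).
Proof.
move=> [hf ef] [hg eg]; split=> [|b x]; first exact: dhom_comp.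
by rewrite eg ef.
Qed.

Lemma mrgl_evhom A (ev : R -> pow A -> A) l : is_ev ev ->
  evhom (powev (powev ev)) (powev ev) (@mrgl F R A l).
Proof.
move=> hev; apply: (evhom_comp (mrg_evhom hev)); apply: pmap_evhom.
by elim: l => [|l ih]; [split|apply: evhom_comp (dy_evhom hev) ih].
Qed.

Lemma cmap_dy_flip A k (w : chain_space (pow (pow A)) k) :
  cmap (@dy F R (pow A)) (cmap (@flip F R A) w) = cmap (@flip F R A) (cmap (pmap (@dy F R A)) w).
Proof.
have hf := @flip_dhom F R A; have hd := @dy_dhom F R; have hpd := pmap_dhom (hd A).
rewrite (cmap_comp (hd _) hf) (cmap_comp hf hpd); apply: eq_cmap => g; apply: funext => m.
by apply: funext => n; rewrite /dy !powE.
Qed.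

Lemma cmap_pmap_dy_flip A k (w : chain_space (pow (pow A)) k) :
  cmap (pmap (@dy F R A)) (cmap (@flip F R A) w) = cmap (@flip F R A) (cmap (@dy F R (pow A)) w).
Proof.
have hf := @flip_dhom F R A; have hd := @dy_dhom F R; have hpd := pmap_dhom (hd A).
rewrite (cmap_comp hpd hf) (cmap_comp hf (hd _)); apply: eq_cmap => g; apply: funext => m.
by apply: funext => n; rewrite /pmap /flip /dy !powE.
Qed.

(* minus the Lie derivative along the letter b, whose variable is the one of pow A *)
Fixpoint theta k : forall A, (R -> pow A -> A) -> R -> chain_space (pow A) k -> chain_space A k :=
  match k with
  | 0 => fun A ev b => cmap (ev b)
  | k'.+1 => fun A ev b => crec (fun c w =>
      ecr c (theta (powev ev) b (cmap (@flip F R A) w)) - ebr b c w)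
  end.

(** Either b passes c or it is bracketed with c. The equation for [theta] on e_c w is available only
    once [crec_ok] is known for this step, hence the simultaneous induction on [theta_basic] and
    [theta_ok]. *)
Definition theta_step k A (ev : R -> pow A -> A) b c (w : chain_space (pow (pow A)) k) :
  chain_space A k.+1 := ecr c (theta (powev ev) b (cmap (@flip F R A) w)) - ebr b c w.

(** Naturality in A is part of the induction because the step uses it twice: for [dy], in the
    relation for the letter D c, and for [flip], in the alternation. *)
Definition theta_basic k : Prop := forall A (ev : R -> pow A -> A), is_ev ev ->
  [/\ forall b, linear (@theta k A ev b),
      forall w, linear (fun b => @theta k A ev b w),
      forall b w, @theta k A ev (lca_D b) w = - theta ev b (cmap (@dy F R A) w) &
      forall B (evB : R -> pow B -> B) (f : A -> B) b w, is_ev evB -> evhom ev evB f ->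
        cmap f (@theta k A ev b w) = theta evB b (cmap (pmap f) w)].

Lemma theta_basic0 : theta_basic 0.
Proof.
move=> A ev hev; have he b := ev_dhom hev b; split=> /=.
- by move=> b; apply: cmap_linear.
- move=> w s u v; have hs := dhom_scale s (he u).
  rewrite -cmapZ // -cmapD //; apply: eq_cmap => g; exact: ev_linear.
- move=> b w; rewrite cmap_comp //; last exact: dy_dhom.
  have hd := dhom_comp (he b) (@dy_dhom F R A).
  rewrite -scaleN1r -cmapZ //; apply: eq_cmap => g; by rewrite ev_D // scaleN1r.
- move=> B evB f b w hevB [hf ef]; have hB := ev_dhom hevB b; have hpf := pmap_dhom hf.
  by rewrite !cmap_comp //; apply: eq_cmap => g; rewrite ef.
Qed.

Lemma theta_rec k A (ev : R -> pow A -> A) b c (w : chain_space (pow (pow A)) k) :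
  crec_ok (fun c w => @theta_step k A ev b c w) ->
  theta ev b (ecr c w) = theta_step ev b c w.
Proof. by move=> h; exact: (crecE h c w). Qed.

Definition theta_ok k : Prop := forall A (ev : R -> pow A -> A), is_ev ev ->
  forall b, crec_ok (fun c w => @theta_step k A ev b c w).

Lemma theta_basicS k : theta_basic k -> theta_ok k -> theta_basic k.+1.
Proof.
move=> bk ok A ev hev; have [l1 l2 tD tN] := bk _ _ (powev_is_ev hev).
have ok1 := ok _ _ hev; have hfl := @flip_dhom F R A; have hdy := @dy_dhom F R.
have li b : linear (@theta k.+1 A ev b) by exact: crec_linear (ok1 b).
split=> //.
- move=> w s u v; move: w; apply: ecr_ext; first exact: li.
    by apply: linear_add; [apply: linear_scale|]; apply: li.
  move=> c w; rewrite !theta_rec // /theta_step l2 (ebr_linear1 c w) ecr_linear.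
  by rewrite scalerBr opprD addrACA.
- move=> b; apply: ecr_ext; first exact: li.
    by apply: linear_opp; apply: linear_comp (li _) (cmap_linear (hdy _)).
  move=> c w; rewrite cmap_ecr // !theta_rec // /theta_step tD ebr_D1.
  have -> : cmap (@flip F R A) (cmap (pmap (@dy F R A)) w) =
      cmap (@dy F R (pow A)) (cmap (@flip F R A) w).
    exact/esym/cmap_dy_flip.
  by rewrite (linear_funN (@ecr_linear _ _ _ _ _)) opprB opprK addrC.
- move=> B evB f b + hevB hf; have [hdf ef] := hf; have hpf := pmap_dhom hdf.
  have ok2 := ok _ _ hevB b; have hppf := pmap_dhom hpf; have hfl2 := @flip_dhom F R B.
  apply: ecr_ext.
  + exact: linear_comp (cmap_linear hdf) (li _).
  + exact: linear_comp (crec_linear ok2) (cmap_linear hpf).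
  move=> c w; rewrite cmap_ecr // !theta_rec // /theta_step.
  rewrite (linear_funB (cmap_linear hdf)) cmap_ebr // cmap_ecr //.
  rewrite (tN _ (powev evB)) //; [|exact: powev_is_ev|exact: pmap_evhom].
  by rewrite !cmap_comp.
Qed.

(** Brings the outermost variable to the innermost place: it belongs to a letter d that is pulled to
    the front past an inserted bracket. *)
Definition rot A (g : pow (pow (pow A))) : pow (pow (pow A)) := pmap (@flip F R A) (flip g).

Lemma rot_dhom A : dhom (@rot A).
Proof. by apply: dhom_comp (@flip_dhom _ _ _); exact/pmap_dhom/flip_dhom. Qed.

Lemma cmap_rot A k (w : chain_space (pow (pow (pow A))) k) :
  cmap (@rot A) w = cmap (pmap (@flip F R A)) (cmap (@flip F R (pow A)) w).
Proof. by rewrite (cmap_comp (pmap_dhom (@flip_dhom _ _ _)) (@flip_dhom _ _ _)). Qed.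

Lemma cmap_rot_flip A k (w : chain_space (pow (pow (pow A))) k) :
  cmap (@rot A) (cmap (@flip F R (pow A)) w) = cmap (pmap (@flip F R A)) w.
Proof. by rewrite (cmap_comp (rot_dhom _) (@flip_dhom _ _ _)). Qed.

(** The braid relation between the two adjacent transpositions of three variables. *)
Lemma cmap_braid A k (w : chain_space (pow (pow (pow A))) k) :
  cmap (pmap (@flip F R A)) (cmap (@flip F R (pow A)) (cmap (pmap (@flip F R A)) w)) =
  cmap (@flip F R (pow A)) (cmap (pmap (@flip F R A)) (cmap (@flip F R (pow A)) w)).
Proof.
have h := @flip_dhom F R (pow A); have hp := pmap_dhom (@flip_dhom F R A).
apply: etrans (congr1 (cmap _) (cmap_comp h hp w)) _.
apply: etrans (cmap_comp hp (dhom_comp h hp) w) _.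
apply: etrans _ (esym (congr1 (cmap _) (cmap_comp hp h w))).
exact: etrans _ (esym (cmap_comp h (dhom_comp hp h) w)).
Qed.

(** The inserted bracket occupies a single slot, so d crosses one letter and one sign appears. *)
Lemma bri_ecr A k d (w : chain_space (pow (pow (pow A))) k) p :
  bri (ecr d w) p = - ecr d (bri (cmap (@rot A) w) p).
Proof.
rewrite /bri (lext_comp _ _ (@ecr_linear _ _ _ _ _)) -lextN; apply: eq_lext => l r.
have hm := @mrgl_dhom F R; have hf := @flip_dhom F R; have hr := rot_dhom A.
rewrite (cmap_ecr _ _ (hm _ _)) ecr_swap (cmap_comp (hf _) (pmap_dhom (hm _ _))) (cmap_comp (hm _ _) hr).
rewrite (@eq_cmap _ _ _ _ _ _ (fun x => mrgl l (rot x))) // => g; apply: funext => n.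
apply: funext => i; rewrite /flip /pmap /mrgl /mrg pow_sum.
by apply: eq_bigr => s _; rewrite /pmap iter_dy_eval.
Qed.

Lemma ebr_ecr A k b c d (w : chain_space (pow (pow (pow A))) k) :
  ebr b c (ecr d w) = - ecr d (ebr b c (cmap (@rot A) w)).
Proof. exact: bri_ecr. Qed.

Lemma theta_okP k : theta_basic k ->
  (forall A (ev : R -> pow A -> A), is_ev ev ->
    forall b, ecr_alt (fun c w => @theta_step k A ev b c w)) -> theta_ok k.
Proof.
move=> bk alt A ev hev b; have [l1 l2 tD tN] := bk _ _ (powev_is_ev hev).
have hf := @flip_dhom F R; have hd := @dy_dhom F R.
split; last exact: alt.
- move=> w; apply: linear_sub; first exact: ecr_linear_l.
  exact: ebr_linear2.
- move=> c; apply: linear_sub; last exact: ebr_linear.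
  apply: (linear_comp (@ecr_linear _ _ _ _ _)).
  exact: linear_comp (l1 _) (cmap_linear (hf _)).
- move=> c w; rewrite /theta_step ecr_D ebr_D2 opprB opprK addrC; congr (_ - ecr _ _).
  rewrite (tN _ (powev ev)); [|exact: powev_is_ev|exact: dy_evhom].
  by rewrite cmap_pmap_dy_flip.
Qed.

(** For alternation in c and d, the terms e_c e_d theta_b change sign by [ecr_swap], and the two
    terms in which b is bracketed with c or with d are exchanged; the braid relation brings the
    variables into agreement. *)
Lemma theta_okS k : theta_basic k -> theta_ok k -> theta_ok k.+1.
Proof.
move=> bk ok; have bk1 := theta_basicS bk ok; apply: (theta_okP bk1).
move=> A ev hev b c d w; rewrite /theta_step.
have hf := @flip_dhom F R; have hr := @rot_dhom; have hpf A' := pmap_dhom (hf A').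
rewrite !cmap_ecr // !theta_rec; try exact/ok/powev_is_ev.
rewrite /theta_step !(linear_funB (@ecr_linear _ _ _ _ _)) !ebr_ecr !opprK.
have [_ _ _ tN] := bk _ _ (powev_is_ev (powev_is_ev hev)).
rewrite ecr_swap (tN _ (powev (powev ev))); last 2 first.
- exact/powev_is_ev/powev_is_ev.
- exact: flip_evhom.
by rewrite cmap_braid cmap_rot_flip cmap_rot !opprD opprK addrAC.
Qed.

Lemma thetaP k : theta_basic k /\ theta_ok k.
Proof.
elim: k => [|k [bk ok]]; first by split; [|apply: theta_okP => //]; exact: theta_basic0.
by split; [exact: theta_basicS|exact: theta_okS].
Qed.

Section ThetaLaws.
Variables (A : lcaModuleAlgebra R) (ev : R -> pow A -> A) (k : nat).
Hypothesis hev : is_ev ev.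

Lemma theta_linear b : linear (@theta k A ev b).
Proof. by have [bk _] := thetaP k; have [] := bk _ _ hev. Qed.

Lemma theta_linear_l w : linear (fun b => @theta k A ev b w).
Proof. by have [bk _] := thetaP k; have [] := bk _ _ hev. Qed.

Lemma theta_D b w : @theta k A ev (lca_D b) w = - theta ev b (cmap (@dy F R A) w).
Proof. by have [bk _] := thetaP k; have [] := bk _ _ hev. Qed.

Lemma cmap_theta B (evB : R -> pow B -> B) (f : A -> B) b w : is_ev evB -> evhom ev evB f ->
  cmap f (@theta k A ev b w) = theta evB b (cmap (pmap f) w).
Proof. by have [bk _] := thetaP k; have [_ _ _ tN] := bk _ _ hev; exact: tN. Qed.

Lemma theta_ecr b c (w : chain_space (pow (pow A)) k) :
  theta ev b (ecr c w) = ecr c (theta (powev ev) b (cmap (@flip F R A) w)) - ebr b c w.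
Proof. have [_ ok] := thetaP k; apply: theta_rec; exact: ok. Qed.

End ThetaLaws.

End EvModules.

Global Opaque theta.

(** * The commutation relations of the Lie derivatives *)

Section Commutator.
Variables (F : fieldType) (R : lieConformalAlgebra F).
Implicit Types (A B C : lcaModuleAlgebra R) (W : lmodType F).

Section MergeThree.
Variable A : lcaModuleAlgebra R.
Implicit Type g : pow (pow (pow A)).

Lemma mrg_S (B : lcaModuleAlgebra R) (g : pow (pow B)) n :
  mrg g n.+1 = g 0%N n.+1 + mrg ((fun m => g m.+1) : pow (pow B)) n.
Proof. by rewrite /mrg big_ord_recl. Qed.

Lemma mrg_0 (B : lcaModuleAlgebra R) (g : pow (pow B)) : mrg g 0%N = g 0%N 0%N.
Proof. by rewrite /mrg big_ord1. Qed.

Lemma mrgA g : mrg (mrg g) = mrg (pmap (@mrg F R A) g).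
Proof.
apply: funext => n; elim: n g => [|n ih] g; first by rewrite !mrg_0 /pmap mrg_0.
pose g' : pow (pow (pow A)) := fun m => g m.+1.
rewrite mrg_S mrg_0 [RHS]mrg_S -[X in _ = _ + X](ih g') /pmap mrg_S -addrA; congr (_ + _).
have -> : (fun m => mrg g m.+1) = (fun m => g 0%N m.+1) + mrg g' :> pow (pow A).
  by apply: funext => m; rewrite mrg_S.
by rewrite (linear_funD (@mrg_linear _ _ _)).
Qed.

Let lid l := proj1 (iter_dy_dhom A l).

Lemma mrgl_mrgl m n g :
  mrgl m (mrgl n g) = mrg (mrg (pmap (pmap (iter m (@dy F R A))) (pmap (iter n (@dy F R (pow A))) g))).
Proof. by rewrite /mrgl -mrg_pmap. Qed.

Lemma mrgl_mrgl_flip m n g : mrgl n (mrgl m (pmap (@flip F R A) g)) = mrgl m (mrgl n g).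
Proof.
rewrite !mrgl_mrgl !mrgA; congr mrg; apply: funext => i; rewrite /pmap -[RHS]mrg_flip; congr mrg.
apply: funext => j; rewrite /flip; apply: funext => x.
have -> : iter m (@dy F R (pow A)) (flip (g i)) j = (fun y => iter m (@dy F R A) (g i y) j).
  by apply: funext => y; rewrite iter_dy_eval.
have -> : iter m (@dy F R A) (iter n (@dy F R (pow A)) (g i) x) =
    iter n (@dy F R (pow A)) (pmap (iter m (@dy F R A)) (g i)) x.
  by rewrite (iter_dy_pmap _ _ (lid m)).
by rewrite iter_dy_eval.
Qed.

Lemma iter_dy_pmap2 l g :
  iter l (pmap (pmap (@dy F R A))) g = pmap (pmap (iter l (@dy F R A))) g.
Proof.
elim: l g => [|l ih] g //; apply: etrans (congr1 (pmap (pmap (@dy F R A))) (ih g)) _.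
by [].
Qed.

Definition dyy (h : pow (pow A)) : pow (pow A) := dy h + pmap (@dy F R A) h.
Definition dy12 g : pow (pow (pow A)) := pmap (@dy F R (pow A)) g + pmap (pmap (@dy F R A)) g.

Lemma iter_dy12 n g : iter n dy12 g = pmap (iter n dyy) g.
Proof.
elim: n g => [|n ih] g //; apply: etrans (congr1 dy12 (ih g)) _.
by [].
Qed.

(** The derivative in the merged variable of b and c is the sum of the two derivatives before
    merging; this is the lambda + mu on the right side of the Jacobi identity. *)
Lemma mrgl_pmap_mrgl n l g : mrgl n (pmap (@mrgl F R A l) g) =
  mrgl 0 (mrgl 0 (iter n dy12 (iter l (pmap (pmap (@dy F R A))) g))).
Proof.
rewrite iter_dy_pmap2 iter_dy12 mrgl_mrgl mrgA /mrgl; congr mrg; apply: funext => i; rewrite /pmap /=.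
move: (fun _ => _) => h; elim: n h => [|n ih] h //.
apply: etrans (iterSr _ _ _) _; apply: etrans (congr1 (iter n _) (dy_mrg _)) _.
apply: etrans (ih _) _; apply: (congr1 (@mrg F R A)); exact/esym/iterSr.
Qed.

End MergeThree.

Opaque flip dy mrg pmap mrgl dy12.

Section Jacobi.
Variables (A : lcaModuleAlgebra R) (k : nat).
Implicit Types (w : chain_space (pow (pow (pow A))) k) (q : finfam (nat * nat)%type R).

(** The analogue of [bri] with two parameters: lambda and mu become the derivatives in the innermost
    and in the middle variable, and all three variables merge. Applied to the Jacobi identity of R
    it gives an identity between nested bracket insertions. *)
Definition bri2 w q : chain_space A k.+1 :=
  lext (fun e r => ecr r (cmap (fun g => mrgl e.1 (mrgl e.2 g)) w)) q.

Lemma bri2_linear w : linear (bri2 w).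
Proof. by apply: lext_linear => e; apply: ecr_linear_l. Qed.

Lemma bri2_mono w e r :
  bri2 w (mono e r) = ecr r (cmap (fun g => mrgl e.1 (mrgl e.2 g)) w).
Proof. by apply: lext_mono_lin; apply: ecr_linear_l. Qed.

Let hm (B : lcaModuleAlgebra R) l := @mrgl_dhom F R B l.
Let hd (B : lcaModuleAlgebra R) := @dy_dhom F R B.

Lemma bri2_lm b c d w :
  bri2 w (act_lm (@lca_br F R) b c d) =
  lext (fun l r => ebr b r (cmap (@mrgl F R (pow A) l) w)) (lca_br c d).
Proof.
rewrite /act_lm (lext_comp _ _ (bri2_linear w)); apply: eq_lext => n r.
rewrite (lext_comp _ _ (bri2_linear w)) /ebr /bri; apply: eq_lext => m u.
by rewrite bri2_mono (cmap_comp (hm _ _) (hm _ _)).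
Qed.

Lemma bri2_ml b c d w :
  bri2 w (act_ml (@lca_br F R) b c d) =
  lext (fun l r => ebr c r (cmap (@mrgl F R (pow A) l) (cmap (pmap (@flip F R A)) w))) (lca_br b d).
Proof.
rewrite /act_ml (lext_comp _ _ (bri2_linear w)); apply: eq_lext => n r.
rewrite (lext_comp _ _ (bri2_linear w)) /ebr /bri; apply: eq_lext => m u.
have hp := pmap_dhom (@flip_dhom F R A).
rewrite bri2_mono (cmap_comp (hm _ _) hp) (cmap_comp (hm _ _) (dhom_comp (hm _ _) hp)).
congr ecr; apply: eq_cmap => g; exact/esym/mrgl_mrgl_flip.
Qed.

Let db : pow (pow (pow A)) -> pow (pow (pow A)) := pmap (pmap (@dy F R A)).
Let dc : pow (pow (pow A)) -> pow (pow (pow A)) := pmap (@dy F R (pow A)).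
Let hdb : dhom db. Proof. exact/pmap_dhom/pmap_dhom/hd. Qed.
Let hdc : dhom dc. Proof. exact/pmap_dhom/hd. Qed.
Let hdbc : dhom (@dy12 A). Proof. exact: (dhom_add hdc hdb). Qed.

Lemma bri2_mulL w q : bri2 w (mulL q) = bri2 (cmap db w) q.
Proof.
rewrite /bri2 /mulL lext_shift => [|e]; last exact: ecr_linear_l.
apply: eq_lext => -[m n] r /=; rewrite (cmap_comp (dhom_comp (hm _ _) (hm _ _)) hdb).
congr ecr; apply: eq_cmap => g; rewrite mrglS mrgl_pmap //; exact: (proj1 (hd _)).
Qed.

Lemma bri2_mulM w q : bri2 w (mulM q) = bri2 (cmap dc w) q.
Proof.
rewrite /bri2 /mulM lext_shift => [|e]; last exact: ecr_linear_l.
apply: eq_lext => -[m n] r /=; rewrite (cmap_comp (dhom_comp (hm _ _) (hm _ _)) hdc).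
by congr ecr; apply: eq_cmap => g; rewrite mrglS.
Qed.

Lemma bri2_linear_l q : linear (fun w => bri2 w q).
Proof.
apply: lext_linear_l => e r; apply: (linear_comp (@ecr_linear _ _ _ _ _)).
exact: cmap_linear (dhom_comp (hm _ _) (hm _ _)).
Qed.

Lemma bri2_mulLM w q : bri2 w (mulL q + mulM q) = bri2 (cmap (@dy12 A) w) q.
Proof.
rewrite (linear_funD (bri2_linear w)) bri2_mulL bri2_mulM addrC.
rewrite -(linear_funD (bri2_linear_l q)); apply: (congr1 (fun v => bri2 v q)).
exact/esym/(cmapD _ hdc hdb).
Qed.

Lemma iter_dhom (B : lcaModuleAlgebra R) (f : B -> B) n : dhom f -> dhom (iter n f).
Proof. by move=> hf; elim: n => [|n ih] //; apply: dhom_comp ih. Qed.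

Lemma bri2_iter (f : pow (pow (pow A)) -> pow (pow (pow A))) (T : _ -> _) :
  dhom f -> (forall w q, bri2 w (T q) = bri2 (cmap f w) q) ->
  forall n w q, bri2 w (iter n T q) = bri2 (cmap (iter n f) w) q.
Proof.
move=> hf fT; elim=> [|n ih] w q; first by rewrite cmap_id.
apply: etrans (fT _ _) _; apply: etrans (ih _ _) _.
apply: (congr1 (fun v => bri2 v q)); rewrite (cmap_comp (iter_dhom n hf) hf).
by apply: eq_cmap => g; exact/esym/iterSr.
Qed.

Lemma bri2_br b c d w :
  bri2 w (act_br (@lca_br F R) (@lca_br F R) b c d) =
  lext (fun l r => ebr r d (cmap (pmap (@mrgl F R A l)) w)) (lca_br b c).
Proof.
rewrite /act_br (lext_comp _ _ (bri2_linear w)); apply: eq_lext => l r.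
rewrite (lext_comp _ _ (bri2_linear w)) /ebr /bri; apply: eq_lext => n u.
rewrite (bri2_iter hdb bri2_mulL).
rewrite (bri2_iter hdbc bri2_mulLM) bri2_mono.
have hn := iter_dhom n hdbc; have hl := iter_dhom l hdb.
rewrite (cmap_comp hn hl) (cmap_comp (dhom_comp (hm _ _) (hm _ _)) (dhom_comp hn hl)).
rewrite (cmap_comp (hm _ _) (pmap_dhom (hm _ _))).
apply: (congr1 (ecr u)); apply: eq_cmap => g; exact/esym/mrgl_pmap_mrgl.
Qed.

Lemma ebr_jacobi b c d w :
  lext (fun l r => ebr b r (cmap (@mrgl F R (pow A) l) w)) (lca_br c d) -
  lext (fun l r => ebr c r (cmap (@mrgl F R (pow A) l) (cmap (pmap (@flip F R A)) w))) (lca_br b d) =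
  lext (fun l r => ebr r d (cmap (pmap (@mrgl F R A l)) w)) (lca_br b c).
Proof.
have e := congr1 (bri2 w) (@lca_br_jacobi F R b c d).
by rewrite (linear_funB (bri2_linear w)) bri2_lm bri2_ml bri2_br in e.
Qed.

End Jacobi.

Section ThetaBracket.
Variables (A : lcaModuleAlgebra R) (ev : R -> pow A -> A).
Hypothesis hev : is_ev ev.

Let hev1 := powev_is_ev hev.
Let hev2 := powev_is_ev hev1.

Definition thbr k b c (w : chain_space (pow (pow A)) k) : chain_space A k :=
  lext (fun l r => theta ev r (cmap (@mrgl F R A l) w)) (lca_br b c).

(* moves the innermost variable to the outermost position *)
Definition rot2 (B : lcaModuleAlgebra R) (g : pow (pow (pow B))) : pow (pow (pow B)) :=
  flip (pmap (@flip F R B) g).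

Lemma rot2_dhom (B : lcaModuleAlgebra R) : dhom (@rot2 B).
Proof. exact: dhom_comp (@flip_dhom _ _ _) (pmap_dhom (@flip_dhom F R B)). Qed.

Lemma cmap_rot2 (B : lcaModuleAlgebra R) k (w : chain_space (pow (pow (pow B))) k) :
  cmap (@rot2 B) w = cmap (@flip F R _) (cmap (pmap (@flip F R B)) w).
Proof. exact/esym/(cmap_comp (@flip_dhom _ _ _) (pmap_dhom (@flip_dhom F R B))). Qed.

Lemma cmap_rot2_flip (B : lcaModuleAlgebra R) k (w : chain_space (pow (pow (pow B))) k) :
  cmap (@rot2 B) (cmap (pmap (@flip F R B)) w) = cmap (@flip F R _) w.
Proof.
have hp := pmap_dhom (@flip_dhom F R B).
rewrite cmap_rot2; apply: (congr1 (cmap _)); apply: etrans (cmap_comp hp hp w) _.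
Transparent flip pmap.
exact: cmap_id.
Opaque flip pmap.
Qed.

Lemma theta_bri k b (w : chain_space (pow (pow (pow A))) k) p :
  theta ev b (bri w p) = bri (theta (powev (powev ev)) b (cmap (@rot2 A) w)) p -
    lext (fun l r => ebr b r (cmap (@mrgl F R (pow A) l) w)) p.
Proof.
rewrite (lext_comp _ _ (theta_linear hev b)) /bri -lextN -lextD; apply: eq_lext => l r.
have hm B := @mrgl_dhom F R B l.
have e : cmap (@flip F R A) (cmap (@mrgl F R (pow A) l) w) =
    cmap (pmap (@mrgl F R A l)) (cmap (@rot2 A) w).
  apply: etrans (cmap_comp (@flip_dhom _ _ _) (hm _) w) _.
  apply: etrans _ (esym (cmap_comp (pmap_dhom (hm _)) (rot2_dhom A) w)).
  apply: eq_cmap => g; apply: funext => n; apply: funext => i.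
  Transparent flip pmap mrg mrgl.
  rewrite /rot2 /flip /pmap /mrgl /mrg pow_sum.
  by apply: eq_bigr => s _; rewrite /pmap iter_dy_eval.
  Opaque flip pmap mrg mrgl.
apply: etrans (theta_ecr hev _ _ _) _; apply: (congr1 (fun v => v - _)); apply: (congr1 (ecr r)).
apply: etrans (congr1 (theta _ b) e) _.
exact/esym/(cmap_theta hev2 _ _ hev1 (mrgl_evhom _ hev)).
Qed.

(** The counterpart of [ev_br] on chains: -theta is a representation, which accounts for the minus
    sign. *)
Definition theta_comm k : Prop :=
  forall (w : chain_space (pow (pow A)) k) b c,
    theta ev b (theta (powev ev) c w) - theta ev c (theta (powev ev) b (cmap (@flip F R A) w)) =
    - thbr b c w.

End ThetaBracket.

Lemma thbr_linear A (ev : R -> pow A -> A) k b c : is_ev ev -> linear (@thbr A ev k b c).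
Proof.
move=> hev; apply: lext_linear_l => l r.
exact: linear_comp (theta_linear hev _) (cmap_linear (mrgl_dhom _ _)).
Qed.

Lemma thbr_ecr A (ev : R -> pow A -> A) k b c d (w : chain_space (pow (pow (pow A))) k) :
  is_ev ev -> thbr ev b c (ecr d w) = ecr d (thbr (powev ev) b c (cmap (@rot F R A) w)) -
    lext (fun l r => ebr r d (cmap (pmap (@mrgl F R A l)) w)) (lca_br b c).
Proof.
move=> hev; rewrite /thbr (lext_comp _ _ (@ecr_linear _ _ _ _ _)) -lextN -lextD.
apply: eq_lext => l r; have hm B := @mrgl_dhom F R B l.
apply: etrans (congr1 (theta ev r) (cmap_ecr _ _ (hm _))) _.
apply: etrans (theta_ecr hev _ _ _) _.
apply: (congr1 (fun v => v - _)); apply: (congr1 (ecr d)); apply: (congr1 (theta _ r)).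
apply: etrans (cmap_comp (@flip_dhom _ _ _) (pmap_dhom (hm _)) w) _.
apply: etrans _ (esym (cmap_comp (hm _) (rot_dhom A) w)).
apply: eq_cmap => g; apply: funext => n; apply: funext => i.
Transparent flip pmap mrg mrgl.
rewrite /rot /flip /pmap /mrgl /mrg pow_sum.
by apply: eq_bigr => s _; rewrite /pmap iter_dy_eval.
Opaque flip pmap mrg mrgl.
Qed.

Lemma theta0 A (ev : R -> pow A -> A) b : theta (k := 0) ev b = cmap (ev b).
Proof. by []. Qed.

Lemma thetaC0 A (ev : R -> pow A -> A) : is_ev ev -> theta_comm ev 0.
Proof.
move=> hev w b c; have hev1 := powev_is_ev hev.
have hl p : dhom (fun g : pow (pow A) => lext (fun l r => ev r (mrgl l g)) p).
  split=> [|g].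
    apply: lext_linear_l => l r; apply: linear_comp (proj1 (ev_dhom hev r)) (proj1 (mrgl_dhom _ _)).
  rewrite (lext_comp _ _ (@lcm_D_linear F R A)); apply: eq_lext => l r.
  by rewrite (proj2 (mrgl_dhom _ _)) (proj2 (ev_dhom hev r)).
(* In degree 0 the sum over the coefficients of the bracket is moved inside [cmap], where it can be
   compared with [ev_br]. *)
have e p : lext (fun l r => theta ev r (cmap (@mrgl F R A l) w)) p =
    cmap (fun g : pow (pow A) => lext (fun l r => ev r (mrgl l g)) p) w.
  move: p; apply: mono_ext.
  - by apply: lext_linear => l; apply: theta_linear_l.
  - move=> s p q; have hs := dhom_scale s (hl p); rewrite -(cmapZ s w (hl p)) -(cmapD _ hs (hl q)).
    apply: eq_cmap => g; apply: lext_linear => l; exact: ev_linear.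
  move=> l r; rewrite lext_mono_lin; last exact: theta_linear_l.
  apply: etrans (cmap_comp (ev_dhom hev r) (mrgl_dhom _ _) w) _.
  by apply: eq_cmap => g; rewrite lext_mono_lin //; exact: ev_linear.
have h3 := hl (lca_br b c); set f3 := (fun g => _) in e h3 *.
have h1 : dhom (fun g => ev b (powev ev c g)).
  by apply: dhom_comp (ev_dhom hev b) (ev_dhom hev1 c).
have h2 : dhom (fun g => ev c (pmap (ev b) g)).
  by apply: dhom_comp (ev_dhom hev c) _; apply/pmap_dhom/(ev_dhom hev).
have e1 : theta ev b (theta (powev ev) c w) = cmap (fun g => ev b (powev ev c g)) w.
  by rewrite !theta0; apply: (cmap_comp (ev_dhom hev b) (ev_dhom hev1 c)).
have e2 : theta ev c (theta (powev ev) b (cmap (@flip F R A) w)) =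
    cmap (fun g => ev c (pmap (ev b) g)) w.
  rewrite !theta0; apply: etrans (congr1 (cmap _) (cmap_comp (ev_dhom hev1 b) (@flip_dhom _ _ _) w)) _.
  apply: etrans (cmap_comp (ev_dhom hev c) (dhom_comp (ev_dhom hev1 b) (@flip_dhom _ _ _)) w) _.
  apply: eq_cmap => g; apply: (congr1 (ev c)); apply: funext => n.
  Transparent flip pmap.
  by [].
  Opaque flip pmap.
rewrite e1 e2 /thbr e; apply/eqP; rewrite subr_eq -scaleN1r -(cmapZ _ _ h3); apply/eqP.
apply: etrans _ (cmapD _ (dhom_scale _ h3) h2); apply: eq_cmap => g.
by rewrite scaleN1r -(ev_br hev) subrK.
Qed.

Lemma theta_theta_ecr A (ev : R -> pow A -> A) k b c d (w : chain_space (pow (pow (pow A))) k) :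
  is_ev ev ->
  theta ev b (theta (powev ev) c (ecr d w)) =
  ecr d (theta (powev ev) b (theta (powev (powev ev)) c (cmap (@rot F R A) w)))
  - ebr b d (theta (powev (powev ev)) c (cmap (@flip F R (pow A)) w))
  - (ebr c d (theta (powev (powev ev)) b (cmap (@rot2 A) w)) -
     lext (fun l r => ebr b r (cmap (@mrgl F R (pow A) l) w)) (lca_br c d)).
Proof.
move=> hev; have hev1 := powev_is_ev hev; have hev2 := powev_is_ev hev1.
rewrite (theta_ecr hev1) (linear_funB (theta_linear hev b)) theta_bri //.
apply: (congr1 (fun v => v - _)); apply: etrans (theta_ecr hev _ _ _) _.
apply: (congr1 (fun v => v - _)); apply: (congr1 (ecr d)); apply: (congr1 (theta _ b)).
apply: etrans (cmap_theta hev2 _ _ hev2 (flip_evhom _)) _.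
by rewrite cmap_rot.
Qed.

(** On e_d w, the terms where both derivatives act on w are settled by induction over A[[y]], the
    mixed terms cancel, and the terms where both b and c are bracketed with d match by the Jacobi
    identity. *)
Lemma theta_commP A (ev : R -> pow A -> A) k : is_ev ev -> theta_comm ev k.
Proof.
elim: k A ev => [|k ih] A ev hev; first exact: thetaC0.
have hev1 := powev_is_ev hev; have hev2 := powev_is_ev hev1.
move=> w b c; move: w; apply: ecr_ext.
- apply: linear_sub; first exact: linear_comp (theta_linear hev _) (theta_linear hev1 _).
  apply: (linear_comp (theta_linear hev _)).
  exact: linear_comp (theta_linear hev1 _) (cmap_linear (@flip_dhom _ _ _)).
- exact/linear_opp/thbr_linear.
move=> d w; rewrite (thbr_ecr _ _ _ _ hev) -ebr_jacobi (theta_theta_ecr _ _ _ _ hev).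
rewrite (cmap_ecr _ _ (@flip_dhom _ _ _)) (theta_theta_ecr _ _ _ _ hev).
rewrite -[cmap (@flip F R (pow A)) (cmap _ w)]cmap_rot2 cmap_rot2_flip.
have e : cmap (@rot F R A) (cmap (pmap (@flip F R A)) w) =
    cmap (@flip F R (pow A)) (cmap (@rot F R A) w) by rewrite !cmap_rot cmap_braid.
have eX := ih _ _ hev1 (cmap (@rot F R A) w) b c.
have {eX} eX := congr1 (ecr d) eX.
rewrite (linear_funB (@ecr_linear _ _ _ _ _)) (linear_funN (@ecr_linear _ _ _ _ _)) in eX.
rewrite e -[ecr d (thbr _ _ _ _)]opprK -eX.
zmod.
Qed.

End Commutator.

(** * The boundary operator *)

Section Differential.
Variables (F : fieldType) (R : lieConformalAlgebra F).
Implicit Types (A B C : lcaModuleAlgebra R) (W : lmodType F).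

(* the boundary operator, determined by its supercommutator with the prepending of
   a letter b, which is the Lie derivative theta b *)
Fixpoint bv k : forall A, (R -> pow A -> A) -> chain_space A k.+1 -> chain_space A k :=
  match k return forall A, (R -> pow A -> A) -> chain_space A k.+1 -> chain_space A k with
  | 0 => fun A ev => crec (fun b w => theta ev b w)
  | k'.+1 => fun A ev => crec (fun b w => theta ev b w - ecr b (bv (powev ev) w))
  end.

Definition bv_step k A (ev : R -> pow A -> A) b : chain_space (pow A) k -> chain_space A k :=
  match k return chain_space (pow A) k -> chain_space A k with
  | 0 => fun w => theta ev b w
  | k'.+1 => fun w => theta ev b w - ecr b (bv (powev ev) w)
  end.

Definition bv_basic k : Prop := forall A (ev : R -> pow A -> A), is_ev ev ->
  [/\ linear (@bv k A ev),
      forall B (evB : R -> pow B -> B) (f : A -> B) w, is_ev evB -> evhom ev evB f ->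
        cmap f (@bv k A ev w) = bv evB (cmap f w) &
      forall b w, @bv k A ev (ecr b w) = bv_step ev b w].

Lemma bv_basicP k : (forall A (ev : R -> pow A -> A), is_ev ev -> crec_ok (@bv_step k A ev)) ->
  (forall A B (evA : R -> pow A -> A) (evB : R -> pow B -> B) f b w, is_ev evA -> is_ev evB ->
     evhom evA evB f -> cmap f (@bv_step k A evA b w) = bv_step evB b (cmap (pmap f) w)) ->
  bv_basic k.
Proof.
move=> ok nat A ev hev; have okA := ok _ _ hev.
have bvE B (evB : R -> pow B -> B) : @bv k B evB = crec (@bv_step k B evB) by case: (k).
have l B (evB : R -> pow B -> B) : is_ev evB -> linear (@bv k B evB).
  by move=> hB; rewrite bvE; apply: crec_linear; apply: ok.
have e B (evB : R -> pow B -> B) b w : is_ev evB -> @bv k B evB (ecr b w) = bv_step evB b w.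
  by move=> hB; rewrite bvE; apply: crecE; apply: ok.
split=> [|B evB f|b w]; [exact: l| |exact: e].
move=> + hevB hf; apply: ecr_ext.
- exact: linear_comp (cmap_linear (proj1 hf)) (l _ _ hev).
- exact: linear_comp (l _ _ hevB) (cmap_linear (proj1 hf)).
move=> b w; rewrite (cmap_ecr _ _ (proj1 hf)) (e _ _ _ _ hev) (e _ _ _ _ hevB).
exact: nat.
Qed.

Lemma bv_stepS_nat k A B (evA : R -> pow A -> A) (evB : R -> pow B -> B) (f : A -> B) b w :
  bv_basic k -> is_ev evA -> is_ev evB -> evhom evA evB f ->
  cmap f (@bv_step k.+1 A evA b w) = bv_step evB b (cmap (pmap f) w).
Proof.
move=> bk hA hB hf; have hA1 := powev_is_ev hA; have hB1 := powev_is_ev hB.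
have [_ bN _] := bk _ _ hA1.
rewrite /bv_step (linear_funB (cmap_linear (proj1 hf))) (cmap_theta hA _ _ hB hf).
by rewrite (cmap_ecr _ _ (proj1 hf)) (bN _ _ _ _ hB1 (pmap_evhom hf)).
Qed.

Lemma bv_step_ok0 A (ev : R -> pow A -> A) : is_ev ev -> crec_ok (@bv_step 0 A ev).
Proof.
move=> hev; split=> //.
- by move=> w; apply: theta_linear_l.
- by move=> b; apply: theta_linear.
- by move=> b w; apply: theta_D.
Qed.

Lemma cmap_flipK A k (w : chain_space (pow (pow A)) k) :
  cmap (@flip F R A) (cmap (@flip F R A) w) = w.
Proof.
rewrite (cmap_comp (@flip_dhom _ _ _) (@flip_dhom _ _ _)).
Transparent flip.
exact: cmap_id.
Opaque flip.
Qed.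

(** Naturality is needed one degree lower as well, since the step on e_c w contains e_b e_c delta;
    for k = 0 this term is absent and the truncated predecessor is harmless. *)
Lemma bv_step_okS k A (ev : R -> pow A -> A) : bv_basic k.-1 -> bv_basic k -> is_ev ev ->
  crec_ok (@bv_step k.+1 A ev).
Proof.
move=> bk' bk hev; have hev1 := powev_is_ev hev; have [lb bN bE] := bk _ _ hev1.
split.
- by move=> w; apply: linear_sub; [exact: theta_linear_l|exact: ecr_linear_l].
- move=> b; apply: linear_sub; first exact: theta_linear.
  exact: linear_comp (@ecr_linear _ _ _ _ _) lb.
- move=> b w; rewrite /bv_step (theta_D hev) ecr_D (bN _ _ _ _ hev1 (dy_evhom hev)).
  by rewrite opprB opprK addrC.
(* In theta_b e_c - e_b theta_c + e_b e_c delta the first two terms exchange roles up to sign and up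
   to an inserted bracket, which is itself skew. *)
move=> b c w; rewrite /bv_step !bE !(theta_ecr hev) [ebr b c w]ebr_skew cmap_flipK.
case: k => [|k] in bk bk' lb bN bE w *; rewrite /bv_step; first by zmod.
have hev2 := powev_is_ev hev1;
rewrite !(linear_funB (@ecr_linear _ _ _ _ _)) ecr_swap.
have [_ bN2 _] := (bk' : bv_basic k) _ _ hev2.
rewrite (bN2 _ _ _ _ hev2 (flip_evhom _)); zmod.
Qed.

Lemma bvP k : bv_basic k.
Proof.
have b0 : bv_basic 0.
  apply: bv_basicP; first exact: bv_step_ok0.
  by move=> A B evA evB f b w hA hB hf; apply: cmap_theta.
suff [] : bv_basic k.-1 /\ bv_basic k by [].
elim: k => [|k [ih' ih]]; split=> //; apply: bv_basicP.
- by move=> A ev; apply: bv_step_okS.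
- by move=> A B evA evB f b w hA hB hf; apply: bv_stepS_nat.
Qed.

Section BvLaws.
Variables (A : lcaModuleAlgebra R) (ev : R -> pow A -> A) (k : nat).
Hypothesis hev : is_ev ev.

Lemma bv_linear : linear (@bv k A ev).
Proof. by have [] := @bvP k _ _ hev. Qed.

Lemma cmap_bv B (evB : R -> pow B -> B) (f : A -> B) w : is_ev evB -> evhom ev evB f ->
  cmap f (@bv k A ev w) = bv evB (cmap f w).
Proof. by have [_ bN _] := @bvP k _ _ hev; exact: bN. Qed.

Lemma bv_ecr0 b w : @bv 0 A ev (ecr b w) = theta ev b w.
Proof. by have [_ _ bE] := @bvP 0 _ _ hev; exact: bE. Qed.

Lemma bv_ecrS b w : @bv k.+1 A ev (ecr b w) = theta ev b w - ecr b (bv (powev ev) w).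
Proof. by have [_ _ bE] := @bvP k.+1 _ _ hev; exact: bE. Qed.

End BvLaws.

Global Opaque bv.

Lemma bv_bri k A (ev : R -> pow A -> A) (w : chain_space (pow (pow A)) k.+1) p : is_ev ev ->
  bv ev (bri w p) = lext (fun l r => theta ev r (cmap (@mrgl F R A l) w)) p -
    bri (bv (powev (powev ev)) w) p.
Proof.
move=> hev; have hev1 := powev_is_ev hev; have hev2 := powev_is_ev hev1.
rewrite (lext_comp _ _ (bv_linear hev)) /bri -lextN -lextD; apply: eq_lext => l r.
rewrite (bv_ecrS hev); apply: (congr1 (fun v => _ - v)); apply: (congr1 (ecr r)).
exact/esym/(cmap_bv hev2 _ hev1 (mrgl_evhom _ hev)).
Qed.

Lemma bv_bri0 A (ev : R -> pow A -> A) (w : chain_space (pow (pow A)) 0) p : is_ev ev ->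
  bv ev (bri w p) = lext (fun l r => theta ev r (cmap (@mrgl F R A l) w)) p.
Proof.
move=> hev; rewrite (lext_comp _ _ (bv_linear hev)); apply: eq_lext => l r.
by rewrite (bv_ecr0 hev).
Qed.

(** On e_c w, the rule delta e_c = theta_c - e_c delta leaves the commutator of theta_b and theta_c,
    which cancels against delta of the inserted bracket; the rest is the induction hypothesis. *)
Lemma bv_theta k A (ev : R -> pow A -> A) b (w : chain_space (pow A) k.+1) : is_ev ev ->
  bv ev (theta ev b w) = theta ev b (bv (powev ev) w).
Proof.
elim: k A ev b w => [|k ih] A ev b w hev.
  have hev1 := powev_is_ev hev; have hev2 := powev_is_ev hev1; move: w; apply: ecr_ext.
  - exact: linear_comp (bv_linear hev) (theta_linear hev _).
  - exact: linear_comp (theta_linear hev _) (bv_linear hev1).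
  move=> c w; rewrite (theta_ecr hev) (bv_ecr0 hev1) (linear_funB (bv_linear hev)) (bv_ecr0 hev).
  rewrite /ebr (bv_bri0 _ _ hev); have := theta_commP hev w b c; rewrite /thbr => e.
  by apply/eqP; rewrite subr_eq -[lext _ _]opprK -e; apply/eqP; zmod.
have hev1 := powev_is_ev hev; have hev2 := powev_is_ev hev1; move: w; apply: ecr_ext.
- exact: linear_comp (bv_linear hev) (theta_linear hev _).
- exact: linear_comp (theta_linear hev _) (bv_linear hev1).
move=> c w; rewrite (theta_ecr hev) (bv_ecrS hev1) (linear_funB (bv_linear hev)) (bv_ecrS hev).
rewrite /ebr (bv_bri _ _ hev); have := theta_commP hev w b c; rewrite /thbr => e.
rewrite (linear_funB (theta_linear hev _)) (theta_ecr hev) /ebr.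
rewrite (ih _ _ _ _ hev1) -(cmap_bv hev2 _ hev2 (flip_evhom _)).
rewrite -[lext _ _]opprK -e; zmod.
Qed.

(** delta delta e_b = delta theta_b - theta_b delta + e_b delta delta, and delta commutes with
    theta_b. *)
Lemma bv_bv k A (ev : R -> pow A -> A) (w : chain_space A k.+2) : is_ev ev ->
  bv ev (bv ev w) = 0.
Proof.
elim: k A ev w => [|k ih] A ev w hev; have hev1 := powev_is_ev hev; move: w; apply: ecr_ext.
- exact: linear_comp (bv_linear hev) (bv_linear hev).
- exact: linear_zero.
- move=> b w; rewrite (bv_ecrS hev) (linear_funB (bv_linear hev)) (bv_ecr0 hev).
  by rewrite (bv_theta _ _ hev) subrr.
- exact: linear_comp (bv_linear hev) (bv_linear hev).
- exact: linear_zero.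
- move=> b w; rewrite (bv_ecrS hev) (linear_funB (bv_linear hev)) (bv_ecrS hev).
  rewrite (bv_theta _ _ hev) (ih _ _ _ hev1) (linear_fun0 (@ecr_linear _ _ _ _ _)); zmod.
Qed.

End Differential.

(** * Chains of all degrees *)

Section Total.
Variables (F : fieldType) (R : lieConformalAlgebra F).
Implicit Types (A B C : lcaModuleAlgebra R) (W : lmodType F).

(** Identities of operators are stated on the sum over all degrees: there h + k and k + h need no
    transport between different types. *)
Definition din A k (w : chain_space A k) : Chains A := dinj (fun k => chain_space A k) k w.

Lemma din_linear A k : linear (@din A k). Proof. exact: dinj_linear. Qed.

Definition tE A b : Chains (pow A) -> Chains A := dlift (fun k w => din (ecr b w)).
Definition tmap A B (f : A -> B) : Chains A -> Chains B := dlift (fun k w => din (cmap f w)).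
Definition tth A (ev : R -> pow A -> A) b : Chains (pow A) -> Chains A :=
  dlift (fun k w => din (theta ev b w)).
Definition tbv A (ev : R -> pow A -> A) : Chains A -> Chains A :=
  dlift (fun k => match k return chain_space A k -> Chains A with
    | 0 => fun _ => 0 | k'.+1 => fun w => din (bv ev w) end).
Definition tbr A b c : Chains (pow (pow A)) -> Chains A := dlift (fun k w => din (ebr b c w)).

Section TotalMaps.
Variable A : lcaModuleAlgebra R.

Let l1 b k : linear (fun w : chain_space (pow A) k => din (ecr b w)).
Proof. exact: linear_comp (@din_linear _ _) (@ecr_linear _ _ _ _ _). Qed.

Lemma tE_linear b : linear (@tE A b). Proof. exact/dlift_linear. Qed.
Lemma tE_din b k (w : chain_space (pow A) k) : tE b (din w) = din (ecr b w).
Proof. by rewrite /tE dliftE. Qed.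

Lemma tE_linear_l w : linear (fun b => @tE A b w).
Proof.
rewrite /tE /dlift; apply: linear_bigsum => k.
exact: linear_comp (@din_linear _ _) (@ecr_linear_l _ _ _ _ _).
Qed.

Let l2 B (f : A -> B) k : dhom f -> linear (fun w : chain_space A k => din (cmap f w)).
Proof. by move=> hf; exact: linear_comp (@din_linear _ _) (cmap_linear hf). Qed.

Lemma tmap_linear B (f : A -> B) : dhom f -> linear (tmap f).
Proof. by move=> hf; apply: dlift_linear => k; apply: l2. Qed.
Lemma tmap_din B (f : A -> B) k (w : chain_space A k) : dhom f -> tmap f (din w) = din (cmap f w).
Proof. by move=> hf; rewrite /tmap dliftE // => i; apply: l2. Qed.

Let l5 b c k : linear (fun w : chain_space (pow (pow A)) k => din (ebr b c w)).
Proof. exact: linear_comp (@din_linear _ _) (@ebr_linear _ _ _ _ _ _). Qed.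
Lemma tbr_linear b c : linear (@tbr A b c). Proof. exact: dlift_linear. Qed.
Lemma tbr_din b c k (w : chain_space (pow (pow A)) k) : tbr b c (din w) = din (ebr b c w).
Proof. by rewrite /tbr dliftE. Qed.

Variable ev : R -> pow A -> A.
Hypothesis hev : is_ev ev.

Let l3 b k : linear (fun w : chain_space (pow A) k => din (theta ev b w)).
Proof. exact: linear_comp (@din_linear _ _) (theta_linear hev _). Qed.

Lemma tth_linear b : linear (tth ev b). Proof. exact: dlift_linear. Qed.
Lemma tth_din b k (w : chain_space (pow A) k) : tth ev b (din w) = din (theta ev b w).
Proof. by rewrite /tth dliftE. Qed.

Let l4 k : linear (match k return chain_space A k -> Chains A with
    | 0 => fun _ => 0 | k'.+1 => fun w => din (bv ev w) end).
Proof.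
case: k => [|k]; first exact: linear_zero.
exact: linear_comp (@din_linear _ _) (bv_linear hev).
Qed.

Lemma tbv_linear : linear (tbv ev). Proof. exact: dlift_linear. Qed.
Lemma tbv_din0 (w : chain_space A 0) : tbv ev (din w) = 0.
Proof. by rewrite /tbv dliftE. Qed.
Lemma tbv_dinS k (w : chain_space A k.+1) : tbv ev (din w) = din (bv ev w).
Proof. by rewrite /tbv dliftE. Qed.

Lemma tbv_tbv w : tbv ev (tbv ev w) = 0.
Proof.
move: w; apply: dsum_ext => [||k w].
- exact: linear_comp tbv_linear tbv_linear.
- exact: linear_zero.
case: k w => [|[|k]] w; rewrite -/(din w).
- by rewrite tbv_din0 (linear_fun0 tbv_linear).
- by rewrite tbv_dinS tbv_din0.
- by rewrite !tbv_dinS (bv_bv _ hev) (linear_fun0 (@din_linear _ _)).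
Qed.

End TotalMaps.

Lemma total_ext A W (f g : Chains A -> W) : linear f -> linear g ->
  (forall k (w : chain_space A k), f (din w) = g (din w)) -> f =1 g.
Proof. exact: dsum_ext. Qed.

Section TotalLaws.
Variable A : lcaModuleAlgebra R.

Lemma tE_D b (w : Chains (pow A)) : tE (lca_D b) w = - tE b (tmap (@dy F R A) w).
Proof.
have hd := @dy_dhom F R A; move: w; apply: total_ext => [||k w].
- exact: tE_linear.
- by apply: linear_opp; exact: linear_comp (@tE_linear _ _) (tmap_linear hd).
- by rewrite (tmap_din _ hd) !tE_din ecr_D (linear_funN (@din_linear _ _)).
Qed.

Lemma tE_swap b c (w : Chains (pow (pow A))) : tE b (tE c w) = - tE c (tE b (tmap (@flip F R A) w)).
Proof.
have hf := @flip_dhom F R A; move: w; apply: total_ext => [||k w].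
- exact: linear_comp (@tE_linear _ _) (@tE_linear _ _).
- apply: linear_opp; apply: (linear_comp (@tE_linear _ _)).
  exact: linear_comp (@tE_linear _ _) (tmap_linear hf).
- by rewrite (tmap_din _ hf) !tE_din ecr_swap (linear_funN (@din_linear _ _)).
Qed.

Lemma tmap_tE B (f : A -> B) b (w : Chains (pow A)) : dhom f ->
  tmap f (tE b w) = tE b (tmap (pmap f) w).
Proof.
move=> hf; have hp := pmap_dhom hf; move: w; apply: total_ext => [||k w].
- exact: linear_comp (tmap_linear hf) (@tE_linear _ _).
- exact: linear_comp (@tE_linear _ _) (tmap_linear hp).
- by rewrite (tmap_din _ hp) !tE_din (tmap_din _ hf) (cmap_ecr _ _ hf).
Qed.

Lemma tmap_comp B C (f : B -> C) (g : A -> B) (w : Chains A) : dhom f -> dhom g ->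
  tmap f (tmap g w) = tmap (fun x => f (g x)) w.
Proof.
move=> hf hg; have hfg := dhom_comp hf hg; move: w; apply: total_ext => [||k w].
- exact: linear_comp (tmap_linear hf) (tmap_linear hg).
- exact: tmap_linear.
- by rewrite (tmap_din _ hg) (tmap_din _ hf) (tmap_din _ hfg) (cmap_comp hf hg).
Qed.

Lemma eq_tmap B (f g : A -> B) : f =1 g -> tmap f =1 tmap g.
Proof. by move=> fg; have -> : f = g by apply: funext. Qed.

Lemma tmap_id (f : A -> A) w : f =1 id -> tmap f w = w.
Proof.
move=> ef; have hf : dhom f by split=> [s x y|x]; rewrite !ef.
move: w; apply: total_ext => [||k w] //; first exact: tmap_linear.
by rewrite (tmap_din _ hf) cmap_id.
Qed.

Lemma tmapD B (f g : A -> B) w : dhom f -> dhom g ->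
  tmap (fun x => f x + g x) w = tmap f w + tmap g w.
Proof.
move=> hf hg; have hfg := dhom_add hf hg; move: w; apply: total_ext => [||k w].
- exact: tmap_linear.
- by apply: linear_add; apply: tmap_linear.
- by rewrite (tmap_din _ hf) (tmap_din _ hg) (tmap_din _ hfg) (cmapD _ hf hg) (linear_funD (@din_linear _ _)).
Qed.

Lemma tmapZ B (f : A -> B) s w : dhom f -> tmap (fun x => s *: f x) w = s *: tmap f w.
Proof.
move=> hf; have hfg := dhom_scale s hf; move: w; apply: total_ext => [||k w].
- exact: tmap_linear.
- by apply: linear_scale; apply: tmap_linear.
- by rewrite (tmap_din _ hf) (tmap_din _ hfg) (cmapZ _ _ hf) (linear_funZ (@din_linear _ _)).
Qed.

Variable ev : R -> pow A -> A.
Hypothesis hev : is_ev ev.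

Lemma tth_tE b c (w : Chains (pow (pow A))) :
  tth ev b (tE c w) = tE c (tth (powev ev) b (tmap (@flip F R A) w)) - tbr b c w.
Proof.
have hf := @flip_dhom F R A; have hev1 := powev_is_ev hev; move: w; apply: total_ext => [||k w].
- exact: linear_comp (tth_linear hev _) (@tE_linear _ _).
- apply: linear_sub; last exact: tbr_linear.
  apply: (linear_comp (@tE_linear _ _)).
  exact: linear_comp (tth_linear hev1 _) (tmap_linear hf).
- rewrite (tmap_din _ hf) (tth_din hev1) !tE_din (tth_din hev) tbr_din (theta_ecr hev).
  by rewrite (linear_funB (@din_linear _ _)).
Qed.

Lemma tbv_tE b (w : Chains (pow A)) : tbv ev (tE b w) = tth ev b w - tE b (tbv (powev ev) w).
Proof.
have hev1 := powev_is_ev hev; move: w; apply: total_ext => [||k w].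
- exact: linear_comp (tbv_linear hev) (@tE_linear _ _).
- apply: linear_sub; first exact: tth_linear.
  exact: linear_comp (@tE_linear _ _) (tbv_linear hev1).
case: k w => [|k] w; rewrite (tth_din hev) tE_din (tbv_dinS hev).
  by rewrite (tbv_din0 hev1) (linear_fun0 (@tE_linear _ _)) subr0 (bv_ecr0 hev).
by rewrite (tbv_dinS hev1) tE_din (bv_ecrS hev) (linear_funB (@din_linear _ _)).
Qed.

Lemma tmap_tbv B (evB : R -> pow B -> B) (f : A -> B) w : is_ev evB -> evhom ev evB f ->
  tmap f (tbv ev w) = tbv evB (tmap f w).
Proof.
move=> hB hf; have hd := proj1 hf; move: w; apply: total_ext => [||k w].
- exact: linear_comp (tmap_linear hd) (tbv_linear hev).
- exact: linear_comp (tbv_linear hB) (tmap_linear hd).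
case: k w => [|k] w; rewrite (tmap_din _ hd).
  by rewrite (tbv_din0 hev) (tbv_din0 hB) (linear_fun0 (tmap_linear hd)).
by rewrite (tbv_dinS hev) (tbv_dinS hB) (tmap_din _ hd) (cmap_bv hev _ hB hf).
Qed.

End TotalLaws.
End Total.

Global Opaque tE tmap tth tbv tbr din.

(** * The wedge product *)

Section Wedge.
Variables (F : fieldType) (R : lieConformalAlgebra F).
Implicit Types (A B C : lcaModuleAlgebra R) (W : lmodType F).

Definition pairing A1 A2 A3 (mu : A1 -> A2 -> A3) : Prop :=
  bilinear_op mu /\ forall x y, lcm_D (mu x y) = mu (lcm_D x) y + mu x (lcm_D y).

Definition powl A1 A2 A3 (mu : A1 -> A2 -> A3) : pow A1 -> A2 -> pow A3 :=
  fun f y n => mu (f n) y.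
Definition powr A1 A2 A3 (mu : A1 -> A2 -> A3) : A1 -> pow A2 -> pow A3 :=
  fun x g n => mu x (g n).

Lemma powl_pairing A1 A2 A3 (mu : A1 -> A2 -> A3) : pairing mu -> pairing (powl mu).
Proof.
move=> [[ml mr] mD]; split=> [|f y].
  by split=> [y s f g|f s y z]; apply: funext => n; rewrite !powE /powl ?ml ?mr.
apply: funext => n; rewrite !powE /powl !powE mD (linear_funB (ml _)) (linear_fun_muln (ml _)).
zmod.
Qed.

Lemma powr_pairing A1 A2 A3 (mu : A1 -> A2 -> A3) : pairing mu -> pairing (powr mu).
Proof.
move=> [[ml mr] mD]; split=> [|y f].
  by split=> [y s f g|f s y z]; apply: funext => n; rewrite !powE /powr ?powE ?ml ?mr.
apply: funext => n; rewrite !powE /powr ?powE mD (linear_funB (mr _)) (linear_fun_muln (mr _)).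
zmod.
Qed.

Definition opp_pair A1 A2 A3 (mu : A1 -> A2 -> A3) : A2 -> A1 -> A3 := fun y x => mu x y.

Lemma opp_pairing A1 A2 A3 (mu : A1 -> A2 -> A3) : pairing mu -> pairing (opp_pair mu).
Proof. by move=> [[ml mr] mD]; split=> [|y x]; [split|rewrite /opp_pair mD addrC]. Qed.

Lemma pairing_dhom A1 A2 A3 (mu : A1 -> A2 -> A3) x : pairing mu -> lcm_D x = 0 -> dhom (mu x).
Proof.
by move=> [[ml mr] mD] Dx; split=> [|y] //; rewrite mD Dx (linear_fun0 (ml _)) add0r.
Qed.

Definition m0 : expo 0 := fun _ => 0%N.

Lemma expo0 (m : expo 0) : m = m0. Proof. exact: fam0. Qed.

Lemma series0_D A (phi : xseries A 0) : lcm_D (phi m0) = 0.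
Proof. by rewrite -series_sum big_ord0. Qed.

(** Only the left factor is taken apart, so A1 and A3 turn into power series while A2 stays; hence
    three different modules. A left factor phi of degree 0 has D phi = 0, which makes multiplication
    by it a morphism. *)
Fixpoint wdg h : forall A1 A2 A3, (A1 -> A2 -> A3) -> chain_space A1 h -> Chains A2 -> Chains A3 :=
  match h with
  | 0 => fun A1 A2 A3 mu => clift (fun _ phi => tmap (mu (phi m0)))
  | h'.+1 => fun A1 A2 A3 mu => crec (fun b X w => tE b (wdg (powl mu) X w))
  end.

Definition wdg_basic h : Prop := forall A1 A2 A3 (mu : A1 -> A2 -> A3), pairing mu ->
  [/\ linear (@wdg h _ _ _ mu), forall X, linear (@wdg h _ _ _ mu X) &
    forall B1 B2 B3 (nu : B1 -> B2 -> B3) f1 f2 f3 X w, pairing nu ->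
      dhom f1 -> dhom f2 -> dhom f3 -> (forall x y, f3 (mu x y) = nu (f1 x) (f2 y)) ->
      tmap f3 (@wdg h _ _ _ mu X w) = wdg nu (cmap f1 X) (tmap f2 w)].

Lemma wdg0_ok A1 A2 A3 (mu : A1 -> A2 -> A3) : pairing mu ->
  chain_ok (fun (_ : 'I_0 -> R) (phi : xseries A1 0) => tmap (mu (phi m0))).
Proof.
move=> hmu; have hd (phi : xseries A1 0) : dhom (mu (phi m0)).
  by apply: pairing_dhom => //; exact: series0_D.
split; try by move=> a [].
- move=> a s phi psi; apply: funext => w.
  rewrite -[RHS]/(s *: tmap _ w + tmap _ w) -(tmapZ _ _ (hd phi)).
  rewrite -(tmapD _ (dhom_scale s (hd phi)) (hd psi)); apply: eq_tmap => y.
  by have [[ml _] _] := hmu; exact: ml.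
- move=> a s phi; have -> : s = 1%g by apply/perm.permP => -[].
  rewrite odd_perm1 scale1r; congr (tmap (mu _)); rewrite /= /permS; congr (xseries_val phi _); exact: expo0.
Qed.

Lemma wdg0E A1 A2 A3 (mu : A1 -> A2 -> A3) a (phi : xseries A1 0) : pairing mu ->
  wdg mu (chain a phi) = tmap (mu (phi m0)).
Proof. by move=> hmu; apply: cliftE; exact: wdg0_ok. Qed.

Lemma wdg_basic0 : wdg_basic 0.
Proof.
have hl A1 A2 A3 (mu : A1 -> A2 -> A3) : pairing mu -> linear (@wdg 0 _ _ _ mu).
  by move=> hmu; apply: clift_linear; exact: wdg0_ok.
have hd A1 A2 A3 (mu : A1 -> A2 -> A3) (phi : xseries A1 0) : pairing mu -> dhom (mu (phi m0)).
  by move=> hmu; apply: pairing_dhom => //; exact: series0_D.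
move=> A1 A2 A3 mu hmu; split; first exact: hl.
  move=> X s u v; move: X; apply: chain_ext.
  - by move=> t X Y; rewrite hl.
  - move=> t X Y; rewrite hl //.
    change (s *: (t *: wdg mu X u + wdg mu Y u) + (t *: wdg mu X v + wdg mu Y v) =
      t *: (s *: wdg mu X u + wdg mu X v) + (s *: wdg mu Y u + wdg mu Y v)).
    by rewrite !scalerDr !scalerA [s * t]mulrC addrACA.
  - by move=> a phi; rewrite wdg0E // (tmap_linear (hd _ _ _ _ _ _)).
move=> B1 B2 B3 nu f1 f2 f3 X w hnu h1 h2 h3 e; move: X; apply: chain_ext.
- move=> s X Y; rewrite hl // -(tmap_linear h3); exact: erefl.
- move=> s X Y; rewrite (cmap_linear h1) hl //.
move=> a phi; rewrite (wdg0E _ _ hmu) (cmapE h1) /tch (wdg0E _ _ hnu).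
rewrite (serE (dhom_series h1 (xseries_valP phi))) /=.
rewrite (tmap_comp _ h3 (hd _ _ _ _ _ hmu)) (tmap_comp _ _ h2).
  by apply: eq_tmap => y; rewrite e.
by apply: pairing_dhom => //; rewrite -(proj2 h1) series0_D (linear_fun0 (proj1 h1)).
Qed.

Definition wdg_step h A1 A2 A3 (mu : A1 -> A2 -> A3) b (X : chain_space (pow A1) h) :
  Chains A2 -> Chains A3 := fun w => tE b (wdg (powl mu) X w).

Lemma wdg_step_ok h A1 A2 A3 (mu : A1 -> A2 -> A3) : wdg_basic h -> pairing mu ->
  (forall B1 B2 B3 (nu : B1 -> B2 -> B3), pairing nu ->
    ecr_alt (@wdg_step h _ _ _ nu)) -> crec_ok (@wdg_step h _ _ _ mu).
Proof.
move=> bh hmu alt; have hp := powl_pairing hmu; have [lX lw nat] := bh _ _ _ _ hp.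
split; last exact: alt.
- by move=> X s u v; apply: funext => w; apply: tE_linear_l.
- move=> b s X Y; apply: funext => w; rewrite /wdg_step lX.
  exact: (@tE_linear _ _ A3 b s (wdg (powl mu) X w) (wdg (powl mu) Y w)).
- move=> b X; apply: funext => w; have hd := @dy_dhom F R.
  rewrite /wdg_step tE_D; apply: (congr1 (fun v => - tE b v)).
  have e x y : dy (powl mu x y) = powl mu (dy x) y.
    have [[ml _] _] := hmu; apply: funext => n.
    Transparent dy.
    by rewrite /dy /powl (linear_fun_muln (ml _)).
    Opaque dy.
  apply: etrans (nat _ _ _ _ _ _ _ X w hp (hd _) (@dhom_id _ _ _) (hd _) e) _.
  by rewrite [tmap _ w]tmap_id.
Qed.

Lemma wdg_stepE h A1 A2 A3 (mu : A1 -> A2 -> A3) b X : crec_ok (@wdg_step h _ _ _ mu) ->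
  @wdg h.+1 _ _ _ mu (ecr b X) = wdg_step mu b X.
Proof. by move=> ok; exact: (crecE ok b X). Qed.

Lemma wdg_altS h : wdg_basic h ->
  (forall A1 A2 A3 (mu : A1 -> A2 -> A3), pairing mu -> crec_ok (@wdg_step h _ _ _ mu)) ->
  forall A1 A2 A3 (mu : A1 -> A2 -> A3), pairing mu -> ecr_alt (@wdg_step h.+1 _ _ _ mu).
Proof.
move=> bh ok A1 A2 A3 mu hmu b c X; apply: funext => w.
have hp := powl_pairing hmu; have hpp := powl_pairing hp; have [_ _ nat] := bh _ _ _ _ hpp.
have hf := @flip_dhom F R.
rewrite -[RHS]/(- wdg_step mu c (ecr b (cmap (@flip F R A1) X)) w) {1 2}/wdg_step.
rewrite !(wdg_stepE _ _ (ok _ _ _ _ hp)) /wdg_step tE_swap.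
apply: (congr1 (fun v => - tE c (tE b v))).
have e x y : flip (powl (powl mu) x y) = powl (powl mu) (flip x) y.
  Transparent flip.
  by [].
  Opaque flip.
apply: etrans (nat _ _ _ _ _ _ _ X w hpp (hf _) (@dhom_id _ _ _) (hf _) e) _.
by rewrite [tmap _ w]tmap_id.
Qed.

Lemma wdg_basicS h : wdg_basic h ->
  (forall A1 A2 A3 (mu : A1 -> A2 -> A3), pairing mu -> crec_ok (@wdg_step h _ _ _ mu)) ->
  wdg_basic h.+1.
Proof.
move=> bh ok A1 A2 A3 mu hmu; have hp := powl_pairing hmu; have [lX lw nat] := bh _ _ _ _ hp.
have hl B1 B2 B3 (nu : B1 -> B2 -> B3) : pairing nu -> linear (@wdg h.+1 _ _ _ nu).
  by move=> hnu; apply: crec_linear; exact: ok.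
have hle B1 B2 B3 (nu : B1 -> B2 -> B3) w : pairing nu -> linear (fun X => @wdg h.+1 _ _ _ nu X w).
  by move=> hnu s X Y; rewrite hl.
split; first exact: hl.
  move=> X s u v; move: X; apply: ecr_ext; first exact: hle.
    by apply: linear_add; [apply: linear_scale|]; exact: hle.
  move=> b X; rewrite (wdg_stepE _ _ (ok _ _ _ _ hmu)) /wdg_step lw tE_linear; exact: erefl.
move=> B1 B2 B3 nu f1 f2 f3 X w hnu h1 h2 h3 e; have hpn := powl_pairing hnu.
have h3p := pmap_dhom h3; have h1p := pmap_dhom h1.
move: X; apply: ecr_ext.
- exact: linear_comp (tmap_linear h3) (hle _ _ _ _ w hmu).
- exact: linear_comp (hle _ _ _ _ (tmap f2 w) hnu) (cmap_linear h1).
move=> b X; rewrite (cmap_ecr _ _ h1) (wdg_stepE _ _ (ok _ _ _ _ hmu)) (wdg_stepE _ _ (ok _ _ _ _ hnu)).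
rewrite /wdg_step (tmap_tE _ _ h3); apply: (congr1 (tE b)).
apply: (nat _ _ _ _ _ _ _ X w hpn h1p h2 h3p) => x y; apply: funext => n.
Transparent pmap.
exact: e.
Opaque pmap.
Qed.

Lemma wdgP h : wdg_basic h /\
  (forall A1 A2 A3 (mu : A1 -> A2 -> A3), pairing mu -> crec_ok (@wdg_step h _ _ _ mu)).
Proof.
elim: h => [|h [bh ok]].
  split=> [|A1 A2 A3 mu hmu]; first exact: wdg_basic0.
  by apply: wdg_step_ok => //; exact: wdg_basic0.
have bS := wdg_basicS bh ok; split=> // A1 A2 A3 mu hmu.
by apply: wdg_step_ok => // B1 B2 B3 nu hnu; exact: (wdg_altS bh ok).
Qed.

Definition tw A1 A2 A3 (mu : A1 -> A2 -> A3) (x : Chains A1) (w : Chains A2) : Chains A3 :=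
  dlift (fun h X => wdg mu X w) x.

Section WedgeLaws.
Variables (A1 A2 A3 : lcaModuleAlgebra R) (mu : A1 -> A2 -> A3).
Hypothesis hmu : pairing mu.

Let lX h w : linear (fun X => @wdg h _ _ _ mu X w).
Proof. by move=> s X Y; have [bh _] := wdgP h; have [l _ _] := bh _ _ _ _ hmu; rewrite l. Qed.

Lemma tw_linear w : linear (tw mu ^~ w).
Proof. by apply: dlift_linear => h; apply: lX. Qed.

Lemma tw_linear_r x : linear (tw mu x).
Proof.
apply: linear_bigsum => h; have [bh _] := wdgP h.
by have [_ l _] := bh _ _ _ _ hmu; apply: l.
Qed.

Lemma tw_din h (X : chain_space A1 h) w : tw mu (din X) w = wdg mu X w.
Proof.
Transparent din.
by rewrite /tw /din dliftE.
Opaque din.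
Qed.

Lemma tw_chain0 a (phi : xseries A1 0) w : tw mu (din (chain a phi)) w = tmap (mu (phi m0)) w.
Proof. by rewrite tw_din wdg0E. Qed.

End WedgeLaws.

Section WedgeLaws2.
Variables (A1 A2 A3 : lcaModuleAlgebra R) (mu : A1 -> A2 -> A3).
Hypothesis hmu : pairing mu.

Lemma tw_tE b (x : Chains (pow A1)) w : tw mu (tE b x) w = tE b (tw (powl mu) x w).
Proof.
have hp := powl_pairing hmu; move: x; apply: total_ext => [||h X].
- exact: linear_comp (tw_linear hmu w) (@tE_linear _ _ _ _).
- exact: linear_comp (@tE_linear _ _ _ _) (tw_linear hp w).
rewrite tE_din !tw_din //; have [_ ok] := wdgP h; by rewrite (wdg_stepE _ _ (ok _ _ _ _ hmu)).
Qed.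

Lemma tmap_tw B1 B2 B3 (nu : B1 -> B2 -> B3) f1 f2 f3 x w : pairing nu ->
  dhom f1 -> dhom f2 -> dhom f3 -> (forall x y, f3 (mu x y) = nu (f1 x) (f2 y)) ->
  tmap f3 (tw mu x w) = tw nu (tmap f1 x) (tmap f2 w).
Proof.
move=> hnu h1 h2 h3 e; move: x; apply: total_ext => [||h X].
- exact: linear_comp (tmap_linear h3) (tw_linear hmu w).
- exact: linear_comp (tw_linear hnu _) (tmap_linear h1).
rewrite (tmap_din _ h1) !tw_din //; have [bh _] := wdgP h; have [_ _ nat] := bh _ _ _ _ hmu.
exact: nat.
Qed.

End WedgeLaws2.

(** The letter c crosses the h letters of X, while its variable stays with the right factor. *)
Lemma tw_tE_r h A1 A2 A3 (mu : A1 -> A2 -> A3) c (X : chain_space A1 h) w : pairing mu ->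
  tw mu (din X) (tE c w) = (-1) ^+ h *: tE c (tw (powr mu) (din X) w).
Proof.
have ld B k : linear (@din F R B k) := @din_linear _ _ B k.
elim: h A1 A2 A3 mu X w => [|h ih] A1 A2 A3 mu X w hmu; have hr := powr_pairing hmu; move: X.
  apply: chain_ext => [||a phi].
  - exact: linear_comp (tw_linear hmu _) (ld _ _).
  - apply/linear_scale; apply: (linear_comp (@tE_linear _ _ _ _)).
    exact: linear_comp (tw_linear hr _) (ld _ _).
  rewrite scale1r !tw_chain0 // tmap_tE; last by apply: pairing_dhom => //; exact: series0_D.
  Transparent pmap.
  by [].
  Opaque pmap.
have hl := powl_pairing hmu; have hrl := powr_pairing hl; have hlr := powl_pairing hr.
apply: ecr_ext => [||b X].
- exact: linear_comp (tw_linear hmu _) (ld _ _).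
- apply/linear_scale; apply: (linear_comp (@tE_linear _ _ _ _)).
  exact: linear_comp (tw_linear hr _) (ld _ _).
rewrite -tE_din !tw_tE // (ih _ _ _ _ _ _ hl) (linear_funZ (@tE_linear _ _ _ _)) tE_swap.
rewrite exprS mulN1r scaleNr scalerN; apply: (congr1 (fun v => - (_ *: tE c (tE b v)))).
have hf := @flip_dhom F R A3.
have e x y : flip (powr (powl mu) x y) = powl (powr mu) x y.
  Transparent flip.
  by [].
  Opaque flip.
apply: etrans (tmap_tw hrl _ _ hlr (@dhom_id _ _ _) (@dhom_id _ _ _) hf e) _.
by rewrite !tmap_id.
Qed.

(** The four pairings are unrelated because the induction changes the first module, and those of the
    products that contain it, but not the others. *)
Lemma tw_assoc A1 A2 A3 A12 A23 A123 (m12 : A1 -> A2 -> A12) (m3 : A12 -> A3 -> A123)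
    (m23 : A2 -> A3 -> A23) (m1 : A1 -> A23 -> A123) x y w :
  pairing m12 -> pairing m3 -> pairing m23 -> pairing m1 ->
  (forall u v z, m3 (m12 u v) z = m1 u (m23 v z)) ->
  tw m3 (tw m12 x y) w = tw m1 x (tw m23 y w).
Proof.
move=> h12 h3 h23 h1 e; move: x; apply: total_ext => [||h X].
- exact: linear_comp (tw_linear h3 w) (tw_linear h12 y).
- exact: (tw_linear h1).
have ld B k : linear (@din F R B k) := @din_linear _ _ B k.
elim: h A1 A12 A123 m12 m3 m1 h12 h3 h1 e X => [|h ih] A1 A12 A123 m12 m3 m1 h12 h3 h1 e X; move: X.
  apply: chain_ext => [||a phi].
  - apply: linear_comp (tw_linear h3 w) _; exact: linear_comp (tw_linear h12 y) (ld _ _).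
  - exact: linear_comp (tw_linear h1 _) (ld _ _).
  have hd := pairing_dhom h12 (series0_D phi); have hd1 := pairing_dhom h1 (series0_D phi).
  rewrite !tw_chain0 //.
  apply: esym; apply: etrans (tmap_tw h23 _ _ h3 hd (@dhom_id _ _ _) hd1 _) _ => //.
  by rewrite [tmap _ w]tmap_id.
have hl12 := powl_pairing h12; have hl3 := powl_pairing h3; have hl1 := powl_pairing h1.
apply: ecr_ext => [||b X].
- apply: linear_comp (tw_linear h3 w) _; exact: linear_comp (tw_linear h12 y) (ld _ _).
- exact: linear_comp (tw_linear h1 _) (ld _ _).
rewrite -tE_din !tw_tE //; apply: (congr1 (tE b)); apply: ih => // u v z.
by apply: funext => n; apply: e.
Qed.

(** Induction on h moves the letters of X through Y by [tw_tE_r]; for h = 0 a second induction on k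
    is needed, as the recursion of the other product runs over Y. *)
Lemma tw_comm h k A1 A2 A3 (mu : A1 -> A2 -> A3) (X : chain_space A1 h) (Y : chain_space A2 k) :
  pairing mu -> tw mu (din X) (din Y) = (-1) ^+ (h * k) *: tw (opp_pair mu) (din Y) (din X).
Proof.
have ld B l : linear (@din F R B l) := @din_linear _ _ B l.
elim: h A1 A3 mu X => [|h ih] A1 A3 mu X hmu; have ho := opp_pairing hmu; move: X; last first.
  have hl := powl_pairing hmu.
  apply: ecr_ext => [||b X].
  - exact: linear_comp (tw_linear hmu _) (ld _ _).
  - apply: linear_scale; exact: linear_comp (tw_linear_r ho _) (ld _ _).
  rewrite -tE_din tw_tE // (ih _ _ _ _ hl) (tw_tE_r _ _ _ ho) scalerA mulSn addnC exprD -mulrA.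
  rewrite -signr_odd -expr2 sqrr_sign mulr1 (linear_funZ (@tE_linear _ _ _ _)).
  by rewrite signr_odd.
rewrite mul0n expr0; apply: chain_ext => [||a phi].
- exact: linear_comp (tw_linear hmu _) (ld _ _).
- apply: linear_scale; exact: linear_comp (tw_linear_r ho _) (ld _ _).
rewrite scale1r tw_chain0 //; move: Y.
elim: k A2 A3 mu hmu ho => [|k ih] A2 A3 mu hmu ho.
  have hd := pairing_dhom hmu (series0_D phi).
  apply: chain_ext => [||b psi].
  - exact: linear_comp (tmap_linear hd) (ld _ _).
  - exact: linear_comp (tw_linear ho _) (ld _ _).
  have hd' := pairing_dhom ho (series0_D psi).
  rewrite tw_chain0 // !tmap_din // !cmapE // (fam0 a b) /tch; do 2!apply: congr1.
  by apply: (congr1 (@ser _ _ _ _)); apply: funext => m /=; rewrite (expo0 m).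
have hd := pairing_dhom hmu (series0_D phi).
have hr := powr_pairing hmu; have hor := opp_pairing hr.
apply: ecr_ext => [||b Y].
- exact: linear_comp (tmap_linear hd) (ld _ _).
- exact: linear_comp (tw_linear ho _) (ld _ _).
rewrite -tE_din tw_tE // (tmap_tE _ _ hd); apply: (congr1 (tE b)).
apply: etrans _ (ih _ _ _ hr hor Y).
Transparent pmap.
by [].
Opaque pmap.
Qed.

Section Explicit.
Variables (A1 A2 A3 : lcaModuleAlgebra R) (mu : A1 -> A2 -> A3).
Hypothesis hmu : pairing mu.

Definition prodP h k (phi : expo h -> A1) (psi : expo k -> A2) : expo (h + k) -> A3 :=
  fun m => mu (phi (m \o lshift k)) (psi (m \o @rshift h k)).

Lemma prodP_series h k (phi : expo h -> A1) (psi : expo k -> A2) :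
  phi \in @is_series F R A1 h -> psi \in @is_series F R A2 k ->
  prodP phi psi \in @is_series F R A3 (h + k).
Proof.
have [[ml mr] mD] := hmu; move=> /asboolP hp /asboolP hq; apply/asboolP => m.
rewrite /prodP mD -hp -hq big_split_ord /=.
rewrite (linear_fun_sum (ml _)) (linear_fun_sum (mr _)).
congr (_ + _); apply: eq_bigr => i _; rewrite /derX.
  rewrite (linear_fun_muln (ml _)); congr (mu (phi _) (psi _) *+ _).
  by apply: funext => l; rewrite /upd /= eq_rlshift.
rewrite (linear_fun_muln (mr _)); congr (mu (phi _) (psi _) *+ _).
  by apply: funext => l; rewrite /upd /= eq_lrshift.
by apply: funext => l; rewrite /upd /= (inj_eq (@rshift_inj _ _)).
Qed.
End Explicit.

Lemma lshift_fcons T h k (x : T) (a : 'I_(h + k) -> T) :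
  (fcons x a : 'I_(h.+1 + k) -> T) \o lshift k = fcons x (a \o lshift k).
Proof.
apply: funext => i; have [j ->|->] := unliftP ord0 i; rewrite /= ?fconsS ?fcons0.
  have -> : lshift k (lift ord0 j) = lift ord0 (lshift k j) :> 'I_(h + k).+1 by apply: val_inj.
  by rewrite fconsS.
have -> : lshift k (ord0 : 'I_h.+1) = ord0 :> 'I_(h + k).+1 by apply: val_inj.
by rewrite fcons0.
Qed.

Lemma rshift_fcons T h k (x : T) (a : 'I_(h + k) -> T) :
  (fcons x a : 'I_(h.+1 + k) -> T) \o @rshift h.+1 k = a \o @rshift h k.
Proof.
apply: funext => i /=.
have -> : rshift h.+1 i = lift ord0 (rshift h i) :> 'I_(h + k).+1 by apply: val_inj.
by rewrite fconsS.
Qed.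

Lemma catf_lshift T h k (a : 'I_h -> T) (b : 'I_k -> T) : catf a b \o lshift k = a.
Proof. by apply: funext => i; rewrite /catf /= -[lshift k i]/(unsplit (inl i)) unsplitK. Qed.

Lemma catf_rshift T h k (a : 'I_h -> T) (b : 'I_k -> T) : catf a b \o @rshift h k = b.
Proof. by apply: funext => i; rewrite /catf /= -[rshift h i]/(unsplit (inr i)) unsplitK. Qed.

Lemma shift_ext T h k (u v : 'I_(h + k) -> T) :
  u \o lshift k = v \o lshift k -> u \o @rshift h k = v \o @rshift h k -> u = v.
Proof.
move=> el er; apply: funext => i; case: (fintype.split_ordP i) => j ->.
  exact: (congr1 (@^~ j) el).
exact: (congr1 (@^~ j) er).
Qed.

Lemma fcons_catf T h k x (a : 'I_h -> T) (b : 'I_k -> T) :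
  fcons x (catf a b) = catf (fcons x a) b :> ('I_(h + k).+1 -> T).
Proof.
apply: (@shift_ext T h.+1 k); first by rewrite lshift_fcons !catf_lshift.
by rewrite rshift_fcons !catf_rshift.
Qed.

Lemma tw_chain A1 A2 A3 (mu : A1 -> A2 -> A3) h k a b (phi : xseries A1 h) (psi : xseries A2 k) :
  pairing mu -> tw mu (din (chain a phi)) (din (chain b psi)) =
    din (tch (catf a b) (prodP mu phi psi)).
Proof.
move=> hmu; elim: h A1 A3 mu hmu a phi => [|h ih] A1 A3 mu hmu a phi.
  have hd := pairing_dhom hmu (series0_D phi).
  rewrite tw_chain0 // tmap_din // cmapE //; apply: (congr1 (@din F R A3 _)).
  have -> : catf a b = b by rewrite -[RHS](catf_rshift a b); apply: funext => i /=; congr catf; apply: val_inj.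
  congr (tch b _); apply: funext => m; rewrite /prodP /= [_ \o lshift k]expo0.
  by congr (mu _ (psi _)); apply: funext => i /=; congr m; apply: val_inj.
have hl := powl_pairing hmu; rewrite ecr_chain -tE_din tw_tE // /tch (ih _ _ _ hl).
have hc := cur_series (xseries_valP phi); rewrite (serE hc) tE_din /tch ecrE.
have hP := prodP_series hl hc (xseries_valP psi).
rewrite (serE hP) fcons_catf fcons_eta; apply: (congr1 (@din F R A3 _)); congr (tch _ _).
apply: funext => m; rewrite -[m]fcons_eta unc_fcons /prodP.
by rewrite lshift_fcons rshift_fcons.
Qed.

End Wedge.

(** * The derived bracket *)

Section SecondOrder.
Variables (F : fieldType) (R : lieConformalAlgebra F).
Implicit Types (A B C : lcaModuleAlgebra R) (W : lmodType F).

Let ld B k : linear (@din F R B k). Proof. exact: din_linear. Qed.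

Lemma tw_swap h k A1 A2 A3 B (mu : A1 -> A2 -> A3) (nu2 : B -> A2 -> A2) (nu3 : B -> A3 -> A3)
    (X : chain_space A1 h) (Y : chain_space B k) w :
  pairing mu -> pairing nu2 -> pairing nu3 ->
  (forall x m z, mu x (nu2 m z) = nu3 m (mu x z)) ->
  tw mu (din X) (tw nu2 (din Y) w) = (-1) ^+ (h * k) *: tw nu3 (din Y) (tw mu (din X) w).
Proof.
elim: h A1 A3 mu nu3 X => [|h ih] A1 A3 mu nu3 X hmu h2 h3 e; move: X.
  apply: chain_ext => [||a phi].
  - exact: linear_comp (tw_linear hmu _) (@ld _ _).
  - apply: linear_scale; apply: linear_comp (tw_linear_r h3 (din Y)) _.
    exact: linear_comp (tw_linear hmu _) (@ld _ _).
  have hd := pairing_dhom hmu (series0_D phi).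
  rewrite mul0n scale1r !tw_chain0 //.
  apply: etrans (tmap_tw h2 _ _ h3 (@dhom_id _ _ _) hd hd _) _ => //.
  by rewrite [tmap _ (din Y)]tmap_id.
have hl := powl_pairing hmu; have hr3 := powr_pairing h3.
apply: ecr_ext => [||b X].
- exact: linear_comp (tw_linear hmu _) (@ld _ _).
- apply: linear_scale; apply: linear_comp (tw_linear_r h3 (din Y)) _.
  exact: linear_comp (tw_linear hmu _) (@ld _ _).
rewrite -tE_din !tw_tE // (tw_tE_r _ _ _ h3) (ih _ _ _ (powr nu3)) //; last first.
  by move=> x m z; apply: funext => n; apply: e.
by rewrite (linear_funZ (@tE_linear _ _ _ _)) scalerA mulSn addnC exprD -mulrA -expr2 sqrr_sign mulr1.
Qed.

Lemma tbrE A b c (w : Chains (pow (pow A))) :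
  tbr b c w = lext (fun l r => tE r (tmap (@mrgl F R A l) w)) (lca_br b c).
Proof.
have hm l := @mrgl_dhom F R A l.
move: w; apply: total_ext => [||k w].
- exact: tbr_linear.
- apply: lext_linear_l => l r; exact: linear_comp (@tE_linear _ _ _ _) (tmap_linear (hm l)).
rewrite tbr_din /ebr /bri (lext_comp _ _ (@ld _ _)); apply: eq_lext => l r.
by rewrite tmap_din // tE_din.
Qed.

Lemma tmap_tbr A B (f : A -> B) b c (w : Chains (pow (pow A))) : dhom f ->
  tmap f (tbr b c w) = tbr b c (tmap (pmap (pmap f)) w).
Proof.
move=> hf; have h2 := pmap_dhom (pmap_dhom hf).
move: w; apply: total_ext => [||k w].
- exact: linear_comp (tmap_linear hf) (@tbr_linear _ _ _ _ _).
- exact: linear_comp (@tbr_linear _ _ _ _ _) (tmap_linear h2).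
by rewrite tmap_din // !tbr_din tmap_din // cmap_ebr.
Qed.

Lemma tw_tbr A B k (nu : B -> A -> A) b c (Y : chain_space B k) (w : Chains (pow (pow A))) :
  pairing nu ->
  tw nu (din Y) (tbr b c w) = (-1) ^+ k *: tbr b c (tw (powr (powr nu)) (din Y) w).
Proof.
move=> hnu; have hr := powr_pairing hnu; have hrr := powr_pairing hr.
rewrite !tbrE (lext_comp _ _ (tw_linear_r hnu _)) -lextZ; apply: eq_lext => l r.
rewrite (tw_tE_r _ _ _ hnu); apply: (congr1 (fun v => _ *: tE r v)); apply: esym.
have hm := @mrgl_dhom F R A l.
apply: etrans (tmap_tw hrr _ _ hr (@dhom_id _ _ _) hm hm _) _.
  move=> x y; have [[_ mr] _] := hnu.
  Transparent mrgl mrg pmap.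
  apply: funext => n; rewrite /mrgl /mrg /powr /pmap (linear_fun_sum (mr x)).
  apply: eq_bigr => s _; exact: (congr1 (@^~ _) (iter_dy_pmap _ _ (mr x))).
  Opaque mrgl mrg pmap.
by rewrite [tmap _ (din Y)]tmap_id.
Qed.

Lemma dhom_sub A B (f g : A -> B) : dhom f -> dhom g -> dhom (fun x => f x - g x).
Proof.
move=> [lf Df] [lg Dg]; split=> [|x]; first exact: linear_sub.
by rewrite Df Dg (linear_funB (@lcm_D_linear _ _ _)).
Qed.

(* the commutator of theta_c with the multiplication by an element of degree 0 *)
Definition kap A1 A2 A3 (mu : A1 -> A2 -> A3) (ev2 : R -> pow A2 -> A2) (ev3 : R -> pow A3 -> A3)
  c x (xi : pow A2) : A3 := ev3 c (powr mu x xi) - mu x (ev2 c xi).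

Section FirstOrder.

Lemma kap_dhom A1 A2 A3 (mu : A1 -> A2 -> A3) ev2 ev3 c x :
  pairing mu -> is_ev ev2 -> is_ev ev3 -> lcm_D x = 0 -> dhom (kap mu ev2 ev3 c x).
Proof.
move=> hmu h2 h3 Dx; apply: dhom_sub.
  exact: dhom_comp (ev_dhom h3 c) (pairing_dhom (powr_pairing hmu) Dx).
exact: dhom_comp (pairing_dhom hmu Dx) (ev_dhom h2 c).
Qed.

(** Inserted brackets do not see the coefficients and cancel in the commutator; only the action of c
    on the coefficients, already present in degree 0, survives. *)
Lemma tth_mul A1 A2 A3 (mu : A1 -> A2 -> A3) ev2 ev3 c x w :
  pairing mu -> is_ev ev2 -> is_ev ev3 -> lcm_D x = 0 ->
  tth ev3 c (tmap (powr mu x) w) - tmap (mu x) (tth ev2 c w) = tmap (kap mu ev2 ev3 c x) w.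
Proof.
move=> hmu h2 h3 Dx; move: w.
have lin B2 B3 (nu : A1 -> B2 -> B3) e2 e3 : pairing nu -> is_ev e2 -> is_ev e3 ->
    linear (fun w => tth e3 c (tmap (powr nu x) w) - tmap (nu x) (tth e2 c w)).
  move=> hnu g2 g3; apply: linear_sub.
    exact: linear_comp (tth_linear g3 _) (tmap_linear (pairing_dhom (powr_pairing hnu) Dx)).
  exact: linear_comp (tmap_linear (pairing_dhom hnu Dx)) (tth_linear g2 _).
have link B2 B3 (nu : A1 -> B2 -> B3) e2 e3 : pairing nu -> is_ev e2 -> is_ev e3 ->
    linear (tmap (kap nu e2 e3 c x)).
  by move=> hnu g2 g3; apply: tmap_linear; apply: kap_dhom.
apply: total_ext; [exact: lin|exact: link|]; move=> k.
elim: k A2 A3 mu ev2 ev3 hmu h2 h3 => [|k ih] A2 A3 mu ev2 ev3 hmu h2 h3 w.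
  have hr := powr_pairing hmu; have hd := pairing_dhom hmu Dx; have hdr := pairing_dhom hr Dx.
  have hk := kap_dhom c hmu h2 h3 Dx.
  rewrite (tmap_din _ hdr) (tth_din h2) (tth_din h3) (tmap_din _ hd) (tmap_din _ hk).
  rewrite -(linear_funB (@ld _ _)) !theta0 (cmap_comp (ev_dhom h3 c) hdr) (cmap_comp hd (ev_dhom h2 c)).
  apply: (congr1 (@din _ _ _ _)); apply/eqP; rewrite subr_eq -cmapD //; last first.
    exact: dhom_comp hd (ev_dhom h2 c).
  by apply/eqP; apply: eq_cmap => g; rewrite /kap subrK.
have hr := powr_pairing hmu; have hrr := powr_pairing hr.
have hd := pairing_dhom hmu Dx; have hdr := pairing_dhom hr Dx; have hdrr := pairing_dhom hrr Dx.
have h21 := powev_is_ev h2; have h31 := powev_is_ev h3; have hk := kap_dhom c hmu h2 h3 Dx.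
have hf := @flip_dhom F R.
move: w; apply: ecr_ext => [||d w].
- exact: linear_comp (lin _ _ _ _ _ hmu h2 h3) (@ld _ _).
- exact: linear_comp (link _ _ _ _ _ hmu h2 h3) (@ld _ _).
rewrite -tE_din (tmap_tE _ _ hdr) (tth_tE h3) (tth_tE h2) (tmap_tE _ _ hk).
rewrite (linear_funB (tmap_linear hd)) (tmap_tE _ _ hd) (tmap_tbr _ _ _ hd).
have -> : pmap (powr mu x) = pmap (pmap (mu x)) :> (pow (pow A2) -> pow (pow A3)).
  Transparent pmap.
  by [].
  Opaque pmap.
have ih' := ih _ _ _ _ _ hr h21 h31 (cmap (@flip F R _) w).
rewrite -(tmap_din _ (hf _)) in ih'.
have e1 : tmap (powr (powr mu) x) (tmap (@flip F R A2) (din w)) =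
    tmap (@flip F R A3) (tmap (pmap (pmap (mu x))) (din w)).
  apply: etrans (tmap_comp _ hdrr (hf _)) _.
  apply: etrans _ (esym (tmap_comp _ (hf _) (pmap_dhom (pmap_dhom hd)))); apply: eq_tmap => g.
  Transparent flip pmap.
  by [].
  Opaque flip pmap.
have e2 : tmap (kap (powr mu) (powev ev2) (powev ev3) c x) (tmap (@flip F R A2) (din w)) =
    tmap (pmap (kap mu ev2 ev3 c x)) (din w).
  apply: etrans (tmap_comp _ (kap_dhom c hr h21 h31 Dx) (hf _)) _; apply: eq_tmap => g.
  Transparent flip pmap.
  by [].
  Opaque flip pmap.
rewrite e1 e2 in ih'; rewrite -ih' (linear_funB (@tE_linear _ _ _ _)).
have -> : powr mu x = pmap (mu x).
  Transparent pmap.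
  by [].
  Opaque pmap.
zmod.
Qed.

End FirstOrder.

Definition com A1 A2 A3 (mu : A1 -> A2 -> A3) (ev2 : R -> pow A2 -> A2) (ev3 : R -> pow A3 -> A3)
    c h (X : chain_space A1 h) (w : Chains (pow A2)) : Chains A3 :=
  tth ev3 c (tw (powr mu) (din X) w) - tw mu (din X) (tth ev2 c w).

Lemma com_linear A1 A2 A3 (mu : A1 -> A2 -> A3) ev2 ev3 c h w : pairing mu -> is_ev ev3 ->
  linear (fun X : chain_space A1 h => com mu ev2 ev3 c X w).
Proof.
move=> hmu h3; have hr := powr_pairing hmu; apply: linear_sub.
  apply: linear_comp (tth_linear h3 c) _; exact: linear_comp (tw_linear hr _) (@ld _ _).
exact: linear_comp (tw_linear hmu _) (@ld _ _).
Qed.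

Lemma com_ecr A1 A2 A3 (mu : A1 -> A2 -> A3) ev2 ev3 c b h (X : chain_space (pow A1) h) w :
  pairing mu -> is_ev ev3 ->
  com mu ev2 ev3 c (ecr b X) w =
    tE b (com (powl mu) ev2 (powev ev3) c X w) - tbr c b (tw (powl (powr mu)) (din X) w).
Proof.
move=> hmu h3; have hr := powr_pairing hmu; have hl := powl_pairing hmu.
have hlr := powl_pairing hr; have hrl := powr_pairing hl.
rewrite /com -tE_din !tw_tE // (tth_tE h3) (linear_funB (@tE_linear _ _ _ _)).
have -> : tmap (@flip F R A3) (tw (powl (powr mu)) (din X) w) = tw (powr (powl mu)) (din X) w.
  apply: etrans (tmap_tw hlr _ _ hrl (@dhom_id _ _ _) (@dhom_id _ _ _) (@flip_dhom _ _ _) _) _.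
    Transparent flip.
    by [].
    Opaque flip.
  by rewrite !tmap_id.
zmod.
Qed.

(* theta_c is a differential operator of order one *)
Lemma com_tw h k A1 A2 A3 B (mu : A1 -> A2 -> A3) ev2 ev3 (nu2 : B -> A2 -> A2)
    (nu3 : B -> A3 -> A3) c (X : chain_space A1 h) (Y : chain_space B k) w :
  pairing mu -> pairing nu2 -> pairing nu3 -> is_ev ev2 -> is_ev ev3 ->
  (forall x m z, mu x (nu2 m z) = nu3 m (mu x z)) ->
  (forall c x m xi, kap mu ev2 ev3 c x (powr nu2 m xi) = nu3 m (kap mu ev2 ev3 c x xi)) ->
  com mu ev2 ev3 c X (tw (powr nu2) (din Y) w) =
    (-1) ^+ (h * k) *: tw nu3 (din Y) (com mu ev2 ev3 c X w).
Proof.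
elim: h A1 A3 mu ev3 nu3 X => [|h ih] A1 A3 mu ev3 nu3 X hmu h2 h3 he2 he3 e ek; move: X.
  have hr := powr_pairing hmu; have hr2 := powr_pairing h2.
  apply: chain_ext => [||a phi].
  - exact: com_linear.
  - apply: linear_scale; apply: linear_comp (tw_linear_r h3 (din Y)) _; exact: com_linear.
  have Dx := series0_D phi; have hk := kap_dhom c hmu he2 he3 Dx.
  have comE u : com mu ev2 ev3 c (chain a phi) u = tmap (kap mu ev2 ev3 c (phi m0)) u.
    by rewrite /com !tw_chain0 // tth_mul.
  rewrite mul0n scale1r !comE.
  apply: etrans (tmap_tw hr2 _ _ h3 (@dhom_id _ _ _) hk hk _) _; first exact: ek.
  by rewrite [tmap _ (din Y)]tmap_id.
have hr := powr_pairing hmu; have hl := powl_pairing hmu; have hlr := powl_pairing hr.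
have hr2 := powr_pairing h2; have hr3 := powr_pairing h3; have hrr3 := powr_pairing hr3.
apply: ecr_ext => [||b X].
- exact: com_linear.
- apply: linear_scale; apply: linear_comp (tw_linear_r h3 (din Y)) _; exact: com_linear.
rewrite !com_ecr // (ih _ _ _ _ (powr nu3)) //; last 3 first.
- exact: powev_is_ev.
- by move=> x m z; apply: funext => n; apply: e.
- move=> c' x m xi; apply: funext => n.
  Transparent pmap flip.
  exact: (ek c' (x n) m xi).
  Opaque pmap flip.
rewrite (tw_swap _ _ _ hlr hr2 hrr3); last first.
  by move=> x m z; apply: funext => n; apply: funext => i; apply: e.
rewrite (linear_funB (tw_linear_r h3 _)) (tw_tE_r _ _ _ h3) (tw_tbr _ _ _ _ h3) -scalerBr scalerA.
rewrite mulSn addnC exprD -mulrA -expr2 sqrr_sign mulr1 scalerBr.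
by rewrite (linear_funZ (@tE_linear _ _ _ _)) (linear_funZ (@tbr_linear _ _ _ _ _)).
Qed.

Variable M : lcaModuleAlgebra R.

Local Notation mul := (@lcma_mul F R M).
Local Notation act := (@lcm_act F R M).

(* modules over M on which ev differs from an M-linear map by the action of R on M *)
Record mact A (ev : R -> pow A -> A) (mu : M -> A -> A) : Prop := MAct {
  mact_ev : is_ev ev;
  mact_pairing : pairing mu;
  mact_assoc : forall m m' x, mu m (mu m' x) = mu (mul m m') x;
  mact_leib : forall c m (xi : pow A), ev c (powr mu m xi) =
    mu m (ev c xi) - lext (fun n v => mu v (xi n) *+ n`!) (act c m) }.

Lemma mul_pairing : pairing mul.
Proof. by split; [exact: lcma_mul_bilinear|exact: lcma_D_derivation]. Qed.

Section Mact.
Variables (A : lcaModuleAlgebra R) (ev : R -> pow A -> A) (mu : M -> A -> A).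
Hypothesis hA : mact ev mu.

Let hmu := mact_pairing hA.
Let hev := mact_ev hA.
Let ml x : linear (mu ^~ x). Proof. by have [[]] := hmu. Qed.
Let mr m : linear (mu m). Proof. by have [[]] := hmu. Qed.

Lemma mact_comm m m' x : mu m (mu m' x) = mu m' (mu m x).
Proof. by rewrite !(mact_assoc hA) lcma_mulC. Qed.

Lemma powr_mact : mact (powev ev) (powr mu).
Proof.
split; [exact: powev_is_ev|exact: powr_pairing| |].
  by move=> m m' x; apply: funext => n; exact: (mact_assoc hA).
move=> c m xi; apply: funext => n; rewrite !powE.
Transparent pmap flip.
apply: etrans (mact_leib hA c m (fun i => xi i n)) _.
have ln : linear (fun h : pow A => h n) by [].
rewrite (lext_comp _ _ ln); apply: (congr1 (fun v => _ - v)); apply: eq_lext => i v.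
by rewrite pow_muln.
Opaque pmap flip.
Qed.

(** By the Leibniz rule [kap] is, up to sign, the action of c on x followed by multiplication, and
    multiplications commute. *)
Lemma mact_kap c x m xi : kap mu ev ev c x (powr mu m xi) = mu m (kap mu ev ev c x xi).
Proof.
rewrite /kap; have e y zeta : ev c (powr mu y zeta) - mu y (ev c zeta) =
    - lext (fun n v => mu v (zeta n) *+ n`!) (act c y).
  by rewrite (mact_leib hA); zmod.
rewrite !e (linear_funN (mr m)); congr (- _); rewrite (lext_comp _ _ (mr m)).
by apply: eq_lext => n v; rewrite (linear_fun_muln (mr m)) /powr mact_comm.
Qed.

(* the supercommutator [[delta, X], Y] of operators on chains, delta being tbv ev *)
Definition Qop h k (X : chain_space M h) (Y : chain_space M k) (w : Chains A) : Chains A :=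
  tbv ev (tw mu (din X) (tw mu (din Y) w)) - (-1) ^+ h *: tw mu (din X) (tbv ev (tw mu (din Y) w))
  - (-1) ^+ (h.+1 * k) *: (tw mu (din Y) (tbv ev (tw mu (din X) w)) -
      (-1) ^+ h *: tw mu (din Y) (tw mu (din X) (tbv ev w))).

Lemma Qop_linear h k (X : chain_space M h) (Y : chain_space M k) : linear (Qop X Y).
Proof.
have lb := tbv_linear hev; have lX := tw_linear_r hmu (din X); have lY := tw_linear_r hmu (din Y).
apply: linear_sub.
  apply: linear_sub; first exact: linear_comp lb (linear_comp lX lY).
  apply: linear_scale; exact: linear_comp lX (linear_comp lb lY).
apply: linear_scale; apply: linear_sub.
  exact: linear_comp lY (linear_comp lb lX).
apply: linear_scale; exact: linear_comp lY (linear_comp lX lb).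
Qed.

End Mact.

(** Taking the supercommutator with e_c replaces delta by theta_c, and [[theta_c, X], Y] = 0 by
    [com_tw]. *)
Lemma Qop_tE A (ev : R -> pow A -> A) (mu : M -> A -> A) h k (X : chain_space M h)
    (Y : chain_space M k) c w : mact ev mu ->
  Qop ev mu X Y (tE c w) = (-1) ^+ (h + k).+1 *: tE c (Qop (powev ev) (powr mu) X Y w).
Proof.
move=> hA; have hA1 := powr_mact hA; have hmu := mact_pairing hA; have hev := mact_ev hA.
have hr := powr_pairing hmu; have lE := @tE_linear F R A c.
have hcom := com_tw c X Y w hmu hmu hmu hev hev (fun x m z => mact_comm hA x m z) (mact_kap hA).
rewrite /com in hcom.
have lb := tbv_linear hev; have lX := tw_linear_r hmu (din X); have lY := tw_linear_r hmu (din Y).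
have XE v : tw mu (din X) (tE c v) = (-1) ^+ h *: tE c (tw (powr mu) (din X) v) by apply: tw_tE_r.
have YE v : tw mu (din Y) (tE c v) = (-1) ^+ k *: tE c (tw (powr mu) (din Y) v) by apply: tw_tE_r.
have bE v : tbv ev (tE c v) = tth ev c v - tE c (tbv (powev ev) v) by apply: tbv_tE.
move: hcom; rewrite /Qop !YE !XE !bE.
rewrite ?(linear_funB lX, linear_funZ lX, linear_funB lY, linear_funZ lY, linear_funB lb, linear_funZ lb, YE, XE, bE).
rewrite ?(linear_funB lE, linear_funZ lE).
rewrite -[(-1) ^+ h]signr_odd -[(-1) ^+ k]signr_odd -[(-1) ^+ (h * k)]signr_odd.
rewrite -[(-1) ^+ (h.+1 * k)]signr_odd -[(-1) ^+ (h + k).+1]signr_odd.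
rewrite !oddM !oddS !oddD.
(* All signs depend only on the parities of h and k. *)
by case: (odd h); case: (odd k); rewrite /= ?expr0 ?expr1 ?scale1r ?scaleN1r => /eqP;
   rewrite subr_eq => /eqP ->; zmod.
Qed.

(** Both operators cross e_c with a sign, so agreement in degree 0 over every A propagates. The
    signs are compared on Z rather than as scalars because they differ for h = k = n = 0, the case
    in which Z will be 0. *)
Lemma Qop_ext h k n (X : chain_space M h) (Y : chain_space M k) (Z : chain_space M n) (s : F) :
  (-1) ^+ (h + k).+1 *: Z = (-1) ^+ n *: Z ->
  (forall A ev mu (x : chain_space A 0), mact ev mu ->
    Qop ev mu X Y (din x) = s *: tw mu (din Z) (din x)) ->
  forall A ev mu (w : Chains A), mact ev mu -> Qop ev mu X Y w = s *: tw mu (din Z) w.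
Proof.
move=> en h0 A ev mu w hA; have hmu := mact_pairing hA.
move: w; apply: total_ext; [exact: Qop_linear|exact: linear_scale (tw_linear_r hmu _)|].
move=> j; elim: j A ev mu hA hmu => [|j ih] A ev mu hA hmu w; first exact: h0.
move: w; apply: ecr_ext => [||c w].
- exact: linear_comp (Qop_linear hA X Y) (@ld _ _).
- by apply: linear_scale; exact: linear_comp (tw_linear_r hmu _) (@ld _ _).
have hA1 := powr_mact hA; have hr := powr_pairing hmu.
rewrite -tE_din Qop_tE // (ih _ _ _ hA1 hr) (tw_tE_r _ _ _ hmu).
rewrite (linear_funZ (@tE_linear _ _ _ _)) !scalerA ![_ * s]mulrC -!scalerA.
congr (s *: _); rewrite -!(linear_funZ (@tE_linear _ _ _ _)).
have lZ := linear_comp (tw_linear hr (din w)) (@ld M n).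
by rewrite -!(linear_funZ lZ) en.
Qed.

End SecondOrder.

(** * Explicit formulas *)

Lemma lift_lift0 n (j : 'I_n.+1) : lift (lift ord0 j) ord0 = ord0 :> 'I_n.+2.
Proof. exact: val_inj. Qed.

Lemma lift_liftS n (j : 'I_n.+1) (l : 'I_n) :
  lift (lift ord0 j) (lift ord0 l) = lift ord0 (lift j l).
Proof. by apply: val_inj; rewrite /= /bump; lia. Qed.

Lemma ins_fcons n (j : 'I_n.+1) s x (m : expo n) :
  ins (lift ord0 j) s (fcons x m) = fcons x (ins j s m).
Proof.
apply: funext => l; have [l' ->|->] := unliftP (lift ord0 j) l; last first.
  by rewrite ins_id fconsS ins_id.
rewrite ins_lift; have [l'' ->|->] := unliftP ord0 l'.
  by rewrite lift_liftS !fconsS ins_lift.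
by rewrite lift_lift0 !fcons0.
Qed.

Lemma fcons_comp_lift T n x (a : 'I_n.+1 -> T) j :
  fcons x a \o lift (lift ord0 j) = fcons x (a \o lift j).
Proof.
apply: funext => l; have [l' ->|->] := unliftP ord0 l.
  by rewrite /= lift_liftS !fconsS.
by rewrite /= lift_lift0 !fcons0.
Qed.

Section Explicit.
Variables (F : fieldType) (R : lieConformalAlgebra F).
Implicit Types (A B C : lcaModuleAlgebra R) (W : lmodType F).

(** [cur] for the i-th variable instead of the first: it is singled out as the variable of the
    coefficients. *)
Definition curi A n (i : 'I_n) (phi : expo n -> A) : expo n.-1 -> pow A :=
  fun m s => phi (ins i s m).

Lemma curi_series A n (i : 'I_n) (phi : expo n -> A) :
  phi \in @is_series F R A n -> curi i phi \in @is_series F R (pow A) n.-1.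
Proof.
move=> /asboolP h; apply/asboolP => m; apply: funext => s.
rewrite pow_D /curi -h (big_ord_lift i) {2}/derX ins_id upd_ins_id.
rewrite addrC addrK pow_sum; apply: eq_bigr => l _.
by rewrite /derX pow_muln ins_lift upd_ins_lift.
Qed.

Lemma tch_ext A n (a : 'I_n -> R) (phi psi : expo n -> A) : phi =1 psi -> tch a phi = tch a psi.
Proof. by move=> e; congr tch; apply: funext. Qed.

Lemma cmap_tch A B n (f : A -> B) a (phi : expo n -> A) : dhom f ->
  phi \in @is_series F R A n -> cmap f (tch a phi) = tch a (f \o phi).
Proof. by move=> hf h; rewrite /tch cmapE // (serE h). Qed.

Lemma ecr_tch A n b a (phi : expo n -> pow A) :
  phi \in @is_series F R (pow A) n -> ecr b (tch a phi) = tch (fcons b a) (unc phi).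
Proof. by move=> h; rewrite /tch ecrE (serE h). Qed.

Definition mrgi A n l (j : 'I_n) (psi : expo n -> pow A) : expo n.-1 -> pow A :=
  fun m => mrgl l (curi j psi m).

Lemma mrgi_series A n l (j : 'I_n) (psi : expo n -> pow A) :
  psi \in @is_series F R (pow A) n -> mrgi l j psi \in @is_series F R (pow A) n.-1.
Proof. by move=> h; exact: (dhom_series (@mrgl_dhom F R A l) (curi_series j h)). Qed.

(** The unrolled recursion. The bracket with a_j stays at the front, where the recursion produces
    it; its way across j letters costs the sign. *)
Lemma theta_chain A (ev : R -> pow A -> A) n c a (psi : xseries (pow A) n.+1) : is_ev ev ->
  theta ev c (chain a psi) = tch a (ev c \o psi) -
    \sum_(j < n.+1) (-1) ^+ j *: lext (fun l e => ecr e (tch (a \o lift j) (mrgi l j psi)))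
      (lca_br c (a j)).
Proof.
have hs B k (phi : xseries B k) := xseries_valP phi.
have bE B k (a' : 'I_k -> R) (phi : expo k -> pow (pow B)) p :
    phi \in @is_series F R (pow (pow B)) k ->
    bri (tch a' phi) p = lext (fun l e => ecr e (tch a' (fun m => mrgl l (phi m)))) p.
  move=> h; apply: eq_lext => l e; by rewrite (cmap_tch _ (@mrgl_dhom F R B l) h).
elim: n A ev a psi => [|n ih] A ev a psi hev; have h1 := cur_series (hs _ _ psi);
  have h2 := dhom_series (@flip_dhom F R A) h1; have hev1 := powev_is_ev hev;
  have h3 := dhom_series (ev_dhom hev c) (hs _ _ psi);
  rewrite ecr_chain theta_ecr // (cmap_tch _ (@flip_dhom _ _ _) h1).
  have h4 := dhom_series (ev_dhom hev1 c) h2.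
  rewrite theta0 (cmap_tch _ (ev_dhom hev1 c) h2) (ecr_tch _ _ h4) fcons_eta big_ord1 expr0 scale1r.
  rewrite /ebr (bE _ _ _ _ _ h1); congr (_ - _); apply: tch_ext => m.
  rewrite -[m]fcons_eta unc_fcons.
  Transparent pmap flip.
  by [].
  Opaque pmap flip.
have h4 := dhom_series (ev_dhom hev1 c) h2.
rewrite {1}/tch (ih _ _ _ _ hev1) (serE h2).
have lE := @ecr_linear F R A n.+1 (a ord0).
rewrite (linear_funB lE) (ecr_tch _ _ h4) fcons_eta [in RHS]big_ord_recl expr0 scale1r.
rewrite /ebr (bE _ _ _ _ _ h1) (linear_fun_sum lE).
have -> : tch a (unc (powev ev c \o (flip (A:=A) \o cur psi))) = tch a (ev c \o psi).
  apply: tch_ext => m; rewrite -[m]fcons_eta unc_fcons.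
  Transparent pmap flip.
  by [].
  Opaque pmap flip.
rewrite -addrA -opprD; congr (_ - _); rewrite addrC; congr (_ + _).
apply: eq_bigr => j _; rewrite (linear_funZ lE) (lext_comp _ _ lE) lift0 exprS mulN1r scaleNr -scalerN -lextN.
congr (_ *: _); apply: eq_lext => l e; have h5 := mrgi_series l j h2.
apply: etrans (ecr_swap _ _ _) _; apply: (congr1 -%R); apply: (congr1 (ecr e)).
have h6 := dhom_series (@flip_dhom F R A) h5.
rewrite (cmap_tch _ (@flip_dhom _ _ _) h5) (ecr_tch _ _ h6) -fcons_comp_lift fcons_eta.
apply: tch_ext => m; rewrite -[m]fcons_eta unc_fcons /= /mrgi /curi; apply: funext => y.
move: (m ord0) (m \o _) => x {}m.
(* Evaluation at the exponent of a spectator variable is linear, hence commutes with merging the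
   other two. *)
pose f (z : pow A) := z x; have lf : linear f by [].
Transparent pmap flip.
apply: etrans (congr1 (@^~ y) (esym (mrgl_pmap l _ lf))) _.
apply: (congr1 (fun g => mrgl l g y)); apply: funext => s; apply: funext => t.
by rewrite ins_fcons.
Opaque pmap flip.
Qed.

Lemma iter_derM A n l (i : 'I_n) (phi : xseries A n) :
  iter l (derM i) phi = iter l (derX i) phi :> (expo n -> A).
Proof. by elim: l => [|l ih] //; rewrite !iterS /= ih. Qed.

Lemma diag_series A n l (i j : 'I_n) (phi : expo n -> A) : phi \in @is_series F R A n -> i != j ->
  diagS i j (iter l (derX i) phi) \in @is_series F R A n.-1.
Proof.
move=> h nij; have := diagS_xseries (iter l (derM i) (XSeries h)) nij.
by rewrite iter_derM.
Qed.

(** The two kinds of summands of the boundary: in [bact] a letter acts on the coefficients, in [bbr]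
    two letters are bracketed, the result standing in the place of the first. *)
Definition bact A (ev : R -> pow A -> A) n (a : 'I_n -> R) (phi : expo n -> A) (i : 'I_n) :
  chain_space A n.-1 := (-1) ^+ i *: tch (a \o lift i) (ev (a i) \o curi i phi).

Definition bbr A n (a : 'I_n -> R) (phi : expo n -> A) (i j : 'I_n) : chain_space A n.-1 :=
  (-1) ^+ j *: lext (fun l e => tch (upd a i e \o lift j) (diagS i j (iter l (derX i) phi)))
    (lca_br (a i) (a j)).

Lemma iter_derXS A n l (i : 'I_n) (phi : expo n.+1 -> A) x m :
  iter l (derX i) (cur phi) m x = iter l (derX (lift ord0 i)) phi (fcons x m).
Proof.
elim: l m => [|l ih] m //; rewrite !iterS /derX powE fconsS upd_fconsS.
by congr (_ *+ _); apply: ih.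
Qed.

Lemma iter_derX0 A n l (phi : expo n.+1 -> A) x m :
  iter l (derX ord0) phi (fcons x m) = iter l (@dy F R A) (cur phi m) x.
Proof.
elim: l x => [|l ih] x //; rewrite !iterS /derX /dy fcons0 upd_fcons0.
by congr (_ *+ _); apply: ih.
Qed.

Lemma bact_fcons A (ev : R -> pow A -> A) n b (a : 'I_n.+1 -> R) (phi : expo n.+1 -> pow A) i :
  is_ev ev -> phi \in @is_series F R (pow A) n.+1 ->
  ecr b (bact (powev ev) a phi i) = - bact ev (fcons b a) (unc phi) (lift ord0 i).
Proof.
move=> hev h; have hev1 := powev_is_ev hev.
have h1 := dhom_series (ev_dhom hev1 (a i)) (curi_series i h).
rewrite (linear_funZ (@ecr_linear _ _ _ _ _)) (ecr_tch _ _ h1) /bact lift0 exprS mulN1r scaleNr opprK.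
rewrite fconsS -fcons_comp_lift; congr (_ *: _); apply: tch_ext => m; rewrite -[m]fcons_eta unc_fcons.
Transparent pmap flip.
rewrite /= /powev /pmap /flip; congr (ev _ _); apply: funext => s.
by rewrite /curi ins_fcons unc_fcons.
Opaque pmap flip.
Qed.

Lemma bbr_fcons A n b (a : 'I_n.+1 -> R) (phi : expo n.+1 -> pow A) i j : i != j ->
  phi \in @is_series F R (pow A) n.+1 ->
  ecr b (bbr a phi i j) = - bbr (fcons b a) (unc phi) (lift ord0 i) (lift ord0 j).
Proof.
move=> nij h; have lE := @ecr_linear F R A n b.
rewrite (linear_funZ lE) (lext_comp _ _ lE) /bbr lift0 exprS mulN1r scaleNr opprK.
rewrite !fconsS; congr (_ *: _); apply: eq_lext => l e; have h1 := diag_series l h nij.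
rewrite (ecr_tch _ _ h1) upd_fconsS fcons_comp_lift; apply: tch_ext => m.
rewrite -[m]fcons_eta unc_fcons; move: (m ord0) (m \o _) => x {}m.
rewrite /diagS pow_sum !ins_fcons fconsS; apply: eq_bigr => s _.
by rewrite !ins_fcons upd_fconsS fconsS -iter_derXS uncK.
Qed.

Lemma bbr0 A n (a : 'I_n.+2 -> R) (phi : expo n.+2 -> A) (j : 'I_n.+1) :
  phi \in @is_series F R A n.+2 ->
  (-1) ^+ j *: lext (fun l e => ecr e (tch ((a \o lift ord0) \o lift j) (mrgi l j (cur phi))))
      (lca_br (a ord0) ((a \o lift ord0) j)) = - bbr a phi ord0 (lift ord0 j).
Proof.
move=> h; rewrite /bbr lift0 exprS mulN1r scaleNr opprK; congr (_ *: _); apply: eq_lext => l e.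
have h1 := mrgi_series l j (cur_series h).
rewrite (ecr_tch _ _ h1) -fcons_comp_lift -(upd_fcons0 (a ord0)) fcons_eta; apply: tch_ext => m.
rewrite -[m]fcons_eta unc_fcons; move: (m ord0) (m \o _) => x {}m.
rewrite /diagS ins_fcons fcons0 /mrgi /mrgl.
Transparent mrg pmap.
rewrite /mrg /pmap; apply: eq_bigr => s _; rewrite ins_fcons fcons0 upd_fcons0.
by rewrite iter_derX0.
Opaque mrg pmap.
Qed.

(** A boundary of Chevalley-Eilenberg type. The terms with index 0 come from theta of the first
    letter, all others from the boundary of the shorter chain, whose sign is absorbed by the shift
    of the indices. *)
Lemma bv_chain A (ev : R -> pow A -> A) n a (phi : xseries A n.+1) : is_ev ev ->
  bv ev (chain a phi) = \sum_(i < n.+1) bact ev a phi i +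
    \sum_(i < n.+1) \sum_(j < n.+1 | (i < j)%N) bbr a phi i j :> chain_space A n.
Proof.
elim: n A ev a phi => [|n ih] A ev a phi hev; have hphi := xseries_valP phi;
  have h1 := cur_series hphi; have hev1 := powev_is_ev hev; rewrite ecr_chain.
  rewrite (bv_ecr0 hev) theta0 (cmap_tch _ (ev_dhom hev _) h1) big_ord1 /bact expr0 scale1r.
  rewrite big_ord1 big1 ?addr0 //; by case=> -[].
rewrite (bv_ecrS hev) {1 2}/tch theta_chain // (ih _ _ _ _ hev1) (serE h1).
have lE := @ecr_linear F R A n (a ord0).
rewrite (linear_funD lE) !(linear_fun_sum lE).
rewrite [in RHS]big_ord_recl -!addrA; congr (_ + _).
  by rewrite /bact expr0 scale1r.
have e4 (G : 'I_n.+2 -> 'I_n.+2 -> chain_space A n.+1) :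
    \sum_(i < n.+2) \sum_(j < n.+2 | (i < j)%N) G i j = \sum_(j < n.+1) G ord0 (lift ord0 j) +
    \sum_(i < n.+1) \sum_(j < n.+1 | (i < j)%N) G (lift ord0 i) (lift ord0 j).
  rewrite big_ord_recl; congr (_ + _); last apply: eq_bigr => i _;
    rewrite big_mkcond big_ord_recl /= add0r //.
  by rewrite [RHS]big_mkcond.
rewrite e4 opprD addrCA; congr (_ + _); rewrite -sumrN; last congr (_ + _).
- by apply: eq_bigr => i _; rewrite (bact_fcons _ _ _ hev) // curK fcons_eta opprK.
- by apply: eq_bigr => j _; rewrite (bbr0 _ _ hphi) opprK.
rewrite -sumrN; apply: eq_bigr => i _; rewrite (linear_fun_sum lE) -sumrN; apply: eq_bigr => j ij.
rewrite bbr_fcons // ?curK ?fcons_eta ?opprK //; by apply: contraTneq ij => ->; rewrite ltnn.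
Qed.

Lemma tbv_chain A (ev : R -> pow A -> A) n a (phi : xseries A n) : is_ev ev ->
  tbv ev (din (chain a phi)) = \sum_(i < n) din (bact ev a phi i) +
    \sum_(i < n) \sum_(j < n | (i < j)%N) din (bbr a phi i j).
Proof.
move=> hev; have ld m : linear (@din F R A m) by exact: din_linear.
case: n a phi => [|n] a phi; first by rewrite tbv_din0 // !big_ord0 addr0.
rewrite (tbv_dinS hev) bv_chain // (linear_funD (ld n)) !(linear_fun_sum (ld n)).
by congr (_ + _); apply: eq_bigr => i _; rewrite (linear_fun_sum (ld n)).
Qed.

End Explicit.

(** * Indices of concatenated families *)

Section Shifts.
Variables (T : Type) (h k : nat).

Lemma upd_lshift_l (u : 'I_(h + k) -> T) i x :
  upd u (lshift k i) x \o lshift k = upd (u \o lshift k) i x.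
Proof. by apply: funext => l; rewrite /upd /= eq_lshift. Qed.

Lemma upd_lshift_r (u : 'I_(h + k) -> T) i x : upd u (lshift k i) x \o @rshift h k = u \o @rshift h k.
Proof. by apply: funext => l; rewrite /upd /= eq_rlshift. Qed.

Lemma upd_rshift_l (u : 'I_(h + k) -> T) i x : upd u (rshift h i) x \o lshift k = u \o lshift k.
Proof. by apply: funext => l; rewrite /upd /= eq_lrshift. Qed.

Lemma upd_rshift_r (u : 'I_(h + k) -> T) i x :
  upd u (rshift h i) x \o @rshift h k = upd (u \o @rshift h k) i x.
Proof. by apply: funext => l; rewrite /upd /= eq_rshift. Qed.

Lemma upd_catf_l (a : 'I_h -> T) (b : 'I_k -> T) i x :
  upd (catf a b) (lshift k i) x = catf (upd a i x) b.
Proof.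
by apply: shift_ext; rewrite ?upd_lshift_l ?upd_lshift_r !(catf_lshift, catf_rshift).
Qed.

Lemma upd_catf_r (a : 'I_h -> T) (b : 'I_k -> T) i x :
  upd (catf a b) (rshift h i) x = catf a (upd b i x).
Proof.
by apply: shift_ext; rewrite ?upd_rshift_l ?upd_rshift_r !(catf_lshift, catf_rshift).
Qed.

Lemma catf_l (a : 'I_h -> T) (b : 'I_k -> T) i : catf a b (lshift k i) = a i.
Proof. exact: (congr1 (@^~ i) (catf_lshift a b)). Qed.

Lemma catf_r (a : 'I_h -> T) (b : 'I_k -> T) i : catf a b (rshift h i) = b i.
Proof. exact: (congr1 (@^~ i) (catf_rshift a b)). Qed.

End Shifts.

Lemma lift_lshift_l h k (i : 'I_h.+1) (l : 'I_h) :
  lift (lshift k i : 'I_(h + k).+1) (lshift k l) = lshift k (lift i l) :> 'I_(h.+1 + k).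
Proof. exact: val_inj. Qed.

Lemma lift_lshift_r h k (i : 'I_h.+1) (l : 'I_k) :
  lift (lshift k i : 'I_(h + k).+1) (rshift h l) = rshift h.+1 l :> 'I_(h.+1 + k).
Proof. by apply: val_inj; rewrite /= /bump; have := ltn_ord i; lia. Qed.

Lemma ins_lshift_l h k (i : 'I_h.+1) s (m : expo (h + k)) :
  (ins (lshift k i : 'I_(h.+1 + k)) s m) \o lshift k = ins i s (m \o lshift k).
Proof.
apply: funext => l /=; have [l' ->|->] := unliftP i l; last by rewrite !ins_id.
by rewrite -lift_lshift_l !ins_lift.
Qed.

Lemma ins_lshift_r h k (i : 'I_h.+1) s (m : expo (h + k)) :
  (ins (lshift k i : 'I_(h.+1 + k)) s m) \o @rshift h.+1 k = m \o @rshift h k.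
Proof. by apply: funext => l /=; rewrite -(lift_lshift_r i) ins_lift. Qed.

Lemma catf_lift_l T h k (a : 'I_h.+1 -> T) (b : 'I_k -> T) i :
  catf a b \o lift (lshift k i) = catf (a \o lift i) b :> ('I_(h + k) -> T).
Proof.
apply: shift_ext; apply: funext => l; rewrite /= ?lift_lshift_l ?lift_lshift_r.
  by rewrite !catf_l.
by rewrite !catf_r.
Qed.

(* the numbering of the variables other than the one numbered rshift h i *)
Definition cast_pred h k : 'I_(h + k) -> 'I_(h + k.+1).-1 :=
  cast_ord (congr1 predn (esym (addnS h k))).

Lemma lift_rshift_l h k (i : 'I_k.+1) (l : 'I_h) :
  lift (rshift h i) (cast_pred (lshift k l)) = lshift k.+1 l.
Proof. by apply: val_inj; rewrite /= /bump; have := ltn_ord l; lia. Qed.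

Lemma lift_rshift_r h k (i : 'I_k.+1) (l : 'I_k) :
  lift (rshift h i) (cast_pred (rshift h l)) = rshift h (lift i l).
Proof. by apply: val_inj; rewrite /= /bump; lia. Qed.

Lemma ins_rshift_l h k (i : 'I_k.+1) s (m : expo (h + k.+1).-1) :
  ins (rshift h i) s m \o lshift k.+1 = m \o @cast_pred h k \o lshift k.
Proof. by apply: funext => l /=; rewrite -(lift_rshift_l i) ins_lift. Qed.

Lemma ins_rshift_r h k (i : 'I_k.+1) s (m : expo (h + k.+1).-1) :
  ins (rshift h i) s m \o @rshift h k.+1 = ins i s (m \o @cast_pred h k \o @rshift h k).
Proof.
apply: funext => l /=; have [l' ->|->] := unliftP i l; last by rewrite !ins_id.
by rewrite -lift_rshift_r !ins_lift.
Qed.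

Lemma catf_lift_r T h k (a : 'I_h -> T) (b : 'I_k.+1 -> T) i :
  (catf a b \o lift (rshift h i)) \o @cast_pred h k = catf a (b \o lift i).
Proof.
apply: shift_ext; apply: funext => l; rewrite /= ?lift_rshift_l ?lift_rshift_r.
  by rewrite !catf_l.
by rewrite !catf_r.
Qed.

(** * The boundary of a product, term by term *)

Section Pieces.
Variables (F : fieldType) (R : lieConformalAlgebra F).
Implicit Types (A B C : lcaModuleAlgebra R) (W : lmodType F).

Let hs A n (phi : xseries A n) := xseries_valP phi.

(** The degrees (h + k.+1).-1 and h + k are equal but not convertible; inside the direct sum only a
    renumbering of letters and variables remains. *)
Lemma din_cast A n n' (e : n' = n) (a : 'I_n -> R) (phi : expo n -> A) (phi' : expo n' -> A) :
  (forall m, phi m = phi' (m \o cast_ord e)) ->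
  din (tch a phi) = din (tch (a \o cast_ord e) phi').
Proof.
case: n / e a phi => a phi h; apply: (congr1 (@din F R A n')).
have -> : a \o cast_ord erefl = a by apply: funext => i /=; rewrite cast_ord_id.
apply: tch_ext => m; rewrite h; congr phi'; apply: funext => i /=; rewrite cast_ord_id //.
Qed.

Lemma din_cast_pred A h k (a : 'I_(h + k.+1).-1 -> R) phi (phi' : expo (h + k) -> A) :
  (forall m, phi m = phi' (m \o @cast_pred h k)) ->
  din (tch a phi) = din (tch (a \o @cast_pred h k) phi').
Proof. exact: din_cast. Qed.

Lemma series_cast A n n' (e : n' = n) (phi : expo n' -> A) : phi \in @is_series F R A n' ->
  (fun m => phi (m \o cast_ord e)) \in @is_series F R A n.
Proof.
case: n / e => hphi; have -> // : (fun m => phi (m \o cast_ord erefl)) = phi.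
apply: funext => m; congr phi; apply: funext => i /=; rewrite cast_ord_id //.
Qed.

Lemma tchB A n a (phi psi : expo n -> A) :
  phi \in @is_series F R A n -> psi \in @is_series F R A n ->
  tch a (fun m => phi m - psi m) = tch a phi - tch a psi.
Proof.
move=> h1 h2; rewrite /tch -(linear_funB (@chain_series_linear _ _ _ _ a)); congr chain.
have h3 : (fun m => phi m - psi m) \in @is_series F R A n.
  by rewrite -[X in X \in _]/(phi - psi) rpredB.
by apply: xseriesP => m; rewrite (serE h3) -[RHS]/(ser phi m - ser psi m) (serE h1) (serE h2).
Qed.

Section Products.
Variables (A1 A2 A3 : lcaModuleAlgebra R) (mu : A1 -> A2 -> A3).
Hypothesis hmu : pairing mu.

Let ml x : linear (mu ^~ x). Proof. by have [[]] := hmu. Qed.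
Let mr m : linear (mu m). Proof. by have [[]] := hmu. Qed.

Lemma tw_tch h k a b (phi : expo h -> A1) (psi : expo k -> A2) :
  phi \in @is_series F R A1 h -> psi \in @is_series F R A2 k ->
  tw mu (din (tch a phi)) (din (tch b psi)) = din (tch (catf a b) (prodP mu phi psi)).
Proof. by move=> h1 h2; rewrite /tch tw_chain // (serE h1) (serE h2). Qed.

Lemma iter_derX_l h k l i (phi : expo h -> A1) (psi : expo k -> A2) :
  iter l (derX (lshift k i)) (prodP mu phi psi) = prodP mu (iter l (derX i) phi) psi.
Proof.
elim: l => [|l ih] //; rewrite !iterS ih; apply: funext => u.
by rewrite /derX /prodP upd_lshift_l upd_lshift_r (linear_fun_muln (ml _)).
Qed.

Lemma iter_derX_r h k l i (phi : expo h -> A1) (psi : expo k -> A2) :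
  iter l (derX (rshift h i)) (prodP mu phi psi) = prodP mu phi (iter l (derX i) psi).
Proof.
elim: l => [|l ih] //; rewrite !iterS ih; apply: funext => u.
by rewrite /derX /prodP upd_rshift_l upd_rshift_r (linear_fun_muln (mr _)).
Qed.

Lemma diagS_l h k i j (phi : expo h.+1 -> A1) (psi : expo k -> A2) m :
  diagS (lshift k i) (lshift k j) (prodP mu phi psi) m = prodP mu (diagS i j phi) psi m.
Proof.
rewrite /diagS /prodP (linear_fun_sum (ml _)).
have e s : ins (lshift k j : 'I_(h.+1 + k)) s m (lshift k i) = ins j s (m \o lshift k) i.
  exact: (congr1 (@^~ i) (ins_lshift_l _ _ _)).
rewrite e; apply: eq_bigr => s _.
by rewrite e upd_lshift_l upd_lshift_r ins_lshift_l ins_lshift_r.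
Qed.

Lemma diagS_r h k i j (phi : expo h -> A1) (psi : expo k.+1 -> A2) m :
  diagS (rshift h i) (rshift h j) (prodP mu phi psi) m =
    prodP mu phi (diagS i j psi) (m \o @cast_pred h k).
Proof.
rewrite /diagS /prodP (linear_fun_sum (mr _)).
have e s : ins (rshift h j) s m (rshift h i) = ins j s (m \o @cast_pred h k \o @rshift h k) i.
  exact: (congr1 (@^~ i) (ins_rshift_r _ _ _)).
rewrite e; apply: eq_bigr => s _.
by rewrite e upd_rshift_l upd_rshift_r ins_rshift_l ins_rshift_r.
Qed.

Lemma din_bbr_l h k a b i j (phi : expo h -> A1) (psi : expo k -> A2) : i != j ->
  phi \in @is_series F R A1 h -> psi \in @is_series F R A2 k ->
  din (bbr (catf a b) (prodP mu phi psi) (lshift k i) (lshift k j)) =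
    tw mu (din (bbr a phi i j)) (din (tch b psi)).
Proof.
case: h a i j phi => [|h] a i j phi; first by case: i.
move=> nij h1 h2; have lt := linear_comp (tw_linear hmu (din (tch b psi))) (@din_linear F R A1 h).
rewrite (linear_funZ lt) (linear_funZ (@din_linear _ _ _ _)) !catf_l; congr (_ *: _).
rewrite (lext_comp _ _ lt) (lext_comp _ _ (@din_linear _ _ _ _)); apply: eq_lext => l e.
rewrite (tw_tch _ _ (diag_series l h1 nij) h2) iter_derX_l (upd_catf_l a) catf_lift_l.
by congr din; apply: tch_ext => m; rewrite diagS_l.
Qed.

Lemma din_bbr_r h k a b i j (phi : expo h -> A1) (psi : expo k -> A2) : i != j ->
  phi \in @is_series F R A1 h -> psi \in @is_series F R A2 k ->
  din (bbr (catf a b) (prodP mu phi psi) (rshift h i) (rshift h j)) =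
    (-1) ^+ h *: tw mu (din (tch a phi)) (din (bbr b psi i j)).
Proof.
case: k b i j psi => [|k] b i j psi; first by case: i.
move=> nij h1 h2; have lt := linear_comp (tw_linear_r hmu (din (tch a phi))) (@din_linear F R A2 k).
rewrite (linear_funZ lt) (linear_funZ (@din_linear _ _ _ _)) !catf_r scalerA -exprD; congr (_ *: _).
rewrite (lext_comp _ _ lt) (lext_comp _ _ (@din_linear _ _ _ _)); apply: eq_lext => l e.
rewrite (tw_tch _ _ h1 (diag_series l h2 nij)) iter_derX_r (upd_catf_r a) -(catf_lift_r a).
apply: din_cast_pred => m; exact: diagS_r.
Qed.

Lemma curi_l h k i (phi : expo h.+1 -> A1) (psi : expo k -> A2) m :
  curi (lshift k i) (prodP mu phi psi) m =
    powl mu (curi i phi (m \o lshift k)) (psi (m \o @rshift h k)).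
Proof.
by apply: funext => s; rewrite /curi /prodP /powl ins_lshift_l ins_lshift_r.
Qed.

Lemma curi_r h k i (phi : expo h -> A1) (psi : expo k.+1 -> A2) m :
  curi (rshift h i) (prodP mu phi psi) m =
    powr mu (phi (m \o @cast_pred h k \o lshift k)) (curi i psi (m \o @cast_pred h k \o @rshift h k)).
Proof.
by apply: funext => s; rewrite /curi /prodP /powr ins_rshift_l ins_rshift_r.
Qed.

End Products.
End Pieces.

(** * The derived bracket on chains of degree zero *)

Section DegreeZero.
Variables (F : fieldType) (R : lieConformalAlgebra F) (M A : lcaModuleAlgebra R).
Variables (ev : R -> pow A -> A) (mu : M -> A -> A).
Hypothesis hA : mact ev mu.
Variable x0 : A.
Hypothesis Dx0 : lcm_D x0 = 0.
Variables (h k : nat) (a : 'I_h -> R) (b : 'I_k -> R) (phi : xseries M h) (psi : xseries M k).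

Local Notation mul := (@lcma_mul F R M).
Local Notation act := (@lcm_act F R M).

Let hmu := mact_pairing hA.
Let hev := mact_ev hA.
Let ho := opp_pairing hmu.
Let ml x : linear (mu ^~ x). Proof. by have [[]] := hmu. Qed.
Let mr m : linear (mu m). Proof. by have [[]] := hmu. Qed.

Let g (m : M) : A := mu m x0.
Let hg : dhom g.
Proof. by split=> [|m]; [exact: ml|have [_ ->] := hmu; rewrite Dx0 (linear_fun0 (mr _)) addr0]. Qed.

Let hphi := xseries_valP phi.
Let hpsi := xseries_valP psi.
Let gphi := dhom_series hg hphi.
Let gpsi := dhom_series hg hpsi.

(** The element x0 can be absorbed by either factor: by phi when a letter of the first chain acts,
    by psi when a letter of the second one does. *)
Let prodl : g \o prodM phi psi = prodP (opp_pair mu) (g \o phi) psi.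
Proof.
by apply: funext => u; rewrite /= /prodS /g /prodP /opp_pair lcma_mulC (mact_assoc hA).
Qed.

Let prodr : g \o prodM phi psi = prodP mu phi (g \o psi).
Proof. by apply: funext => u; rewrite /= /prodS /g /prodP (mact_assoc hA). Qed.

Let gprod := dhom_series hg (xseries_valP (prodM phi psi)).

Let evmu c m (xi : pow A) : ev c (powr mu m xi) =
  mu m (ev c xi) - lext (fun n v => mu v (xi n) *+ n`!) (act c m).
Proof. exact: (mact_leib hA). Qed.

Let gev (u : nat -> M) p : g (lext (fun n v => mul v (u n) *+ n`!) p) =
  lext (fun n v => mu v (g (u n)) *+ n`!) p.
Proof.
rewrite (lext_comp _ _ (proj1 hg)); apply: eq_lext => n v.
by rewrite (linear_fun_muln (proj1 hg)) /g (mact_assoc hA).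
Qed.

(** By the Leibniz rule the letter a_i acts on its own factor, giving a term of the boundary of that
    factor, or on psi, giving [evalL]. *)
Lemma din_bact_l i : din (bact ev (catf a b) (g \o prodM phi psi) (lshift k i)) =
  tw (opp_pair mu) (din (bact ev a (g \o phi) i)) (din (chain b psi)) -
  (-1) ^+ i *: tmap g (din (chain (catf a b \o lift (lshift k i)) (evalL (a i) phi psi i))).
Proof.
case: h a phi hphi gphi prodl gprod i => [|h'] a' phi' hphi' gphi' prodl' gprod' i; first by case: i.
have ld n := @din_linear F R A n; rewrite tmap_din // cmapE //.
have lt := linear_comp (tw_linear ho (din (chain b psi))) (ld h').
have h1 := dhom_series (ev_dhom hev (a' i)) (curi_series i gphi').
have h2 := dhom_series hg (xseries_valP (evalL (a' i) phi' psi i)).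
have h3 := prodP_series ho h1 hpsi.
rewrite (linear_funZ lt) (linear_funZ (ld _)) catf_l /= -(tch_chain b psi) (tw_tch ho _ _ h1 hpsi).
rewrite -scalerBr -catf_lift_l -(linear_funB (ld _)) -(tchB _ h3 h2) prodl'; congr (_ *: din _).
apply: tch_ext => m; rewrite /= curi_l /=; apply: etrans (evmu _ _ _) _; congr (_ - _).
rewrite /evalL /= /evalS gev ins_lshift_r; apply: eq_lext => n v.
by rewrite ins_lshift_l.
Qed.

Lemma din_bact_r i : din (bact ev (catf a b) (g \o prodM phi psi) (rshift h i)) =
  (-1) ^+ h *: tw mu (din (chain a phi)) (din (bact ev b (g \o psi) i)) -
  (-1) ^+ (h + i) *: tmap g (din (chain (catf a b \o lift (rshift h i)) (evalR (b i) phi psi i))).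
Proof.
case: k b psi hpsi gpsi prodr gprod i => [|k'] b' psi' hpsi' gpsi' prodr' gprod' i; first by case: i.
have ld n := @din_linear F R A n; rewrite tmap_din // cmapE //.
have lt := linear_comp (tw_linear_r hmu (din (chain a phi))) (ld k').
have h1 := dhom_series (ev_dhom hev (b' i)) (curi_series i gpsi').
have h2 := dhom_series hg (xseries_valP (evalR (b' i) phi psi' i)).
have h3 := prodP_series hmu hphi h1.
rewrite (linear_funZ lt) (linear_funZ (ld _)) catf_r /= -(tch_chain a phi) (tw_tch hmu _ _ hphi h1).
rewrite scalerA -exprD -scalerBr -(catf_lift_r a).
have e := @din_cast_pred F R A h k' (catf a b' \o lift (rshift h i)) _
  (prodP mu phi (ev (b' i) \o curi i (g \o psi'))) (fun m => erefl).
rewrite -e -(linear_funB (ld _)) -(tchB _ (series_cast _ h3) h2) prodr'; congr (_ *: din _).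
apply: tch_ext => m; rewrite /= curi_r; apply: etrans (evmu _ _ _) _; congr (_ - _).
rewrite /evalR /= /evalS gev ins_rshift_l; apply: eq_lext => n v.
by rewrite ins_rshift_r.
Qed.

Lemma din_bbr_lr i j : din (bbr (catf a b) (g \o prodM phi psi) (lshift k i) (rshift h j)) =
  (-1) ^+ (h + j) *: tmap g (din (lext (fun l e =>
    chain (upd (catf a b) (lshift k i) e \o lift (rshift h j))
        (diagM i j (iter l (@derM F R M _ (lshift k i)) (prodM phi psi)))) (lca_br (a i) (b j)))).
Proof.
rewrite (linear_funZ (@din_linear _ _ _ _)) catf_l catf_r; congr (_ *: _).
rewrite tmap_din // (lext_comp _ _ (cmap_linear hg)); congr din; apply: eq_lext => l e.
rewrite cmapE //; apply: tch_ext => m.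
rewrite /= iter_derM /diagS (linear_fun_sum (proj1 hg)); apply: eq_bigr => s _.
set u := upd _ _ _; elim: l u => [|l ih] u //.
by rewrite !iterS /derX (linear_fun_muln (proj1 hg)) ih.
Qed.

(** As delta vanishes in degree 0, the double supercommutator is the boundary of the product minus
    the products with one boundary. What survives are the terms joining both factors: mixed
    brackets, [evalL] and [evalR]. *)
Lemma Qop_din0 (w : chain_space A 0) : (forall n (Z : chain_space M n), tw mu (din Z) (din w) = tmap g (din Z)) ->
  Qop ev mu (chain a phi) (chain b psi) (din w) =
    (-1) ^+ h *: tmap g (din (bracket_formula a phi b psi)).
Proof.
move=> wE; have ld B n := @din_linear F R B n; have lg := tmap_linear hg.
have lX := tw_linear_r hmu (din (chain a phi)); have lY := tw_linear_r hmu (din (chain b psi)).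
have lY' := tw_linear ho (din (chain b psi)).
rewrite /Qop tbv_din0 // (linear_fun0 lX) (linear_fun0 lY) scaler0 subr0 !wE !tmap_din // !cmapE //.
rewrite -(tch_chain a phi) (tw_tch hmu _ _ hphi gpsi) -prodr.
(* Graded commutativity puts the boundary of the first factor on the left and absorbs the sign of
   the supercommutator. *)
have comm (z : chain_space A h) : (-1) ^+ (h.+1 * k) *: tw mu (din (chain b psi)) (tbv ev (din z)) =
    tw (opp_pair mu) (tbv ev (din z)) (din (chain b psi)).
  case: h z => [|n] z; first by rewrite tbv_din0 // (linear_fun0 lY) scaler0 (linear_fun0 lY').
  rewrite tbv_dinS // (tw_comm _ _ hmu) scalerA -exprD -signr_odd.
  rewrite oddD !oddM /= negbK; case: (odd n); case: (odd k); rewrite /= ?expr0 ?expr1 ?scale1r //.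
rewrite /tch comm !tbv_chain // (serE gprod) (serE gphi) (serE gpsi).
have ltri (V : lmodType F) (f : 'I_(h + k) -> 'I_(h + k) -> V) :
    \sum_(i < h + k) \sum_(j < h + k | (i < j)%N) f i j =
    \sum_(i < h) \sum_(j < h | (i < j)%N) f (lshift k i) (lshift k j) +
    \sum_(i < h) \sum_(j < k) f (lshift k i) (rshift h j) +
    \sum_(i < k) \sum_(j < k | (i < j)%N) f (rshift h i) (rshift h j).
  rewrite big_split_ord -big_split /=; congr (_ + _); apply: eq_bigr => i _;
    rewrite big_mkcond big_split_ord /= -!big_mkcond /=.
    congr (_ + _); apply: eq_bigl => j; exact: ltn_addr (ltn_ord i).
  rewrite big_pred0 ?add0r; last first.
    by move=> j; apply/negbTE; rewrite -leqNgt; apply: leq_trans (ltnW (ltn_ord j)) (leq_addr _ _).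
  by apply: eq_bigl => j; rewrite ltn_add2l.
rewrite ser_val big_split_ord /= ltri.
have e1 : \sum_(i < h) din (bact ev (catf a b) (g \o prodM phi psi) (lshift k i)) =
    tw (opp_pair mu) (\sum_(i < h) din (bact ev a (g \o phi) i)) (din (chain b psi)) -
    \sum_(i < h) (-1) ^+ i *: tmap g (din (chain (catf a b \o lift (lshift k i)) (evalL (a i) phi psi i))).
  by rewrite (linear_fun_sum lY') -sumrB; apply: eq_bigr => i _; apply: din_bact_l.
have e2 : \sum_(i < k) din (bact ev (catf a b) (g \o prodM phi psi) (rshift h i)) =
    (-1) ^+ h *: tw mu (din (chain a phi)) (\sum_(i < k) din (bact ev b (g \o psi) i)) -
    \sum_(i < k) (-1) ^+ (h + i) *:
      tmap g (din (chain (catf a b \o lift (rshift h i)) (evalR (b i) phi psi i))).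
  by rewrite (linear_fun_sum lX) scaler_sumr -sumrB; apply: eq_bigr => i _; apply: din_bact_r.
have neq n (i j : 'I_n) : (i < j)%N -> i != j by move=> ij; apply: contraTneq ij => ->; rewrite ltnn.
have e3 : \sum_(i < h) \sum_(j < h | (i < j)%N)
      din (bbr (catf a b) (g \o prodM phi psi) (lshift k i) (lshift k j)) =
    tw (opp_pair mu) (\sum_(i < h) \sum_(j < h | (i < j)%N) din (bbr a (g \o phi) i j)) (din (chain b psi)).
  rewrite (linear_fun_sum lY'); apply: eq_bigr => i _; rewrite (linear_fun_sum lY').
  by apply: eq_bigr => j /neq ij; rewrite prodl (din_bbr_l ho a b ij gphi hpsi) tch_chain.
have e4 : \sum_(i < k) \sum_(j < k | (i < j)%N)
      din (bbr (catf a b) (g \o prodM phi psi) (rshift h i) (rshift h j)) =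
    (-1) ^+ h *: tw mu (din (chain a phi))
      (\sum_(i < k) \sum_(j < k | (i < j)%N) din (bbr b (g \o psi) i j)).
  rewrite (linear_fun_sum lX) scaler_sumr; apply: eq_bigr => i _; rewrite (linear_fun_sum lX) scaler_sumr.
  by apply: eq_bigr => j /neq ij; rewrite prodr (din_bbr_r hmu a b ij hphi gpsi) tch_chain.
rewrite e1 e2 e3 e4 (linear_funD lX) (linear_funD lY') scalerDr.
have lG : linear (fun z : chain_space M (h + k).-1 => (-1) ^+ h *: tmap g (din z)).
  by apply: linear_scale; exact: linear_comp lg (ld _ _).
rewrite -(tmap_din (bracket_formula a phi b psi) hg).
apply: etrans _ (esym (etrans (linear_funD lG _ _) (congr1 (fun z => z + _) (linear_funD lG _ _)))).
rewrite !(linear_fun_sum lG).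
(* The overall sign (-1)^h cancels the summand h in the exponents of the bracket formula. *)
have sgn n (z : chain_space M (h + k).-1) : (-1) ^+ h *: tmap g (din ((-1) ^+ (h + n) *: z)) =
    (-1) ^+ n *: tmap g (din z) :> Chains A.
  rewrite (linear_funZ (ld M (h + k).-1)) (linear_funZ lg) scalerA -exprD addnA -signr_odd.
  by rewrite !oddD addbb addFb signr_odd.
have e5 : \sum_(i < h) \sum_(j < k)
      din (bbr (catf a b) (g \o prodM phi psi) (lshift k i) (rshift h j)) =
    \sum_(i < h) (-1) ^+ h *: tmap g (din (\sum_(j < k) (-1) ^+ (h + (h + j).+1 + 1) *:
      lext (fun l e => chain (upd (catf a b) (lshift k i) e \o lift (rshift h j))
        (diagM i j (iter l (derM (lshift k i)) (prodM phi psi)))) (lca_br (a i) (b j)))).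
  apply: eq_bigr => i _; rewrite (linear_fun_sum lG); apply: eq_bigr => j _.
  by rewrite din_bbr_lr -addnA sgn addn1 !exprS !mulN1r opprK.
have e6 (V : lmodType F) n (s : nat -> nat) (f : 'I_n -> V) :
    \sum_(i < n) (-1) ^+ (s i).+1 *: f i = - \sum_(i < n) (-1) ^+ s i *: f i.
  by rewrite -sumrN; apply: eq_bigr => i _; rewrite exprS mulN1r scaleNr.
have e7 : \sum_(i < h) (-1) ^+ h *: tmap g (din ((-1) ^+ (h + i.+1) *:
      chain (catf a b \o lift (lshift k i)) (evalL (a i) phi psi i))) =
    - \sum_(i < h) (-1) ^+ i *: tmap g (din (chain (catf a b \o lift (lshift k i)) (evalL (a i) phi psi i))).
  by rewrite -(e6 _ _ (fun i => i)); apply: eq_bigr => i _; rewrite sgn.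
have e8 : \sum_(i < k) (-1) ^+ h *: tmap g (din ((-1) ^+ (h + (h + i).+1) *:
      chain (catf a b \o lift (rshift h i)) (evalR (b i) phi psi i))) =
    - \sum_(i < k) (-1) ^+ (h + i) *:
      tmap g (din (chain (catf a b \o lift (rshift h i)) (evalR (b i) phi psi i))).
  by rewrite -(e6 _ _ (fun i => (h + i)%N)); apply: eq_bigr => i _; rewrite sgn.
apply: etrans _ (esym (congr2 (fun u v => u + v) (congr2 (fun u v => u + v) (esym e5) e7) e8)).
set T1 := tw _ _ _; set T2 := \sum_(i < h) _; set T3 := _ *: tw _ _ _; set T4 := \sum_(i < k) _.
set T5 := tw _ _ _; set T6 := _ *: tw _ _ _; set T7 := \sum_(i < h) _ .
by zmod.
Qed.

End DegreeZero.

(* As Qop X Y supercommutes with the prepending of a letter, it is enough to compare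
   both sides on chains of degree 0 *)
Lemma Qop_bracket (F : fieldType) (R : lieConformalAlgebra F) (M A : lcaModuleAlgebra R)
    (ev : R -> pow A -> A) (mu : M -> A -> A) h k (a : 'I_h -> R) (b : 'I_k -> R)
    (phi : xseries M h) (psi : xseries M k) (w : Chains A) : mact ev mu ->
  Qop ev mu (chain a phi) (chain b psi) w =
    (-1) ^+ h *: tw mu (din (bracket_formula a phi b psi)) w.
Proof.
move=> hA; apply: Qop_ext hA; last move=> {A ev mu w} A ev mu w hA.
  have [e|e] := posnP (h + k); last first.
    have -> // : (-1) ^+ (h + k).+1 = (-1) ^+ (h + k).-1 :> F.
    by case: (h + k)%N e => [|n] // _; rewrite 2!exprS !mulN1r opprK.
  have [h0 k0] : h = 0%N /\ k = 0%N by lia.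
  subst h k; have -> : bracket_formula a phi b psi = 0 by rewrite /bracket_formula !big_ord0 !addr0.
  by rewrite !scaler0.
have hmu := mact_pairing hA; have ld := @din_linear F R A 0.
move: w; apply: chain_ext => [||c xi].
- exact: linear_comp (Qop_linear hA _ _) ld.
- apply: linear_scale; exact: linear_comp (tw_linear_r hmu _) ld.
have twE n (Z : chain_space M n) : tw mu (din Z) (din (chain c xi)) =
    tmap (fun m => mu m (xi m0)) (din Z).
  by rewrite tw_comm // muln0 scale1r tw_chain0 //; apply: opp_pairing.
by rewrite (Qop_din0 hA (series0_D xi)) // twE.
Qed.

(** * Functionals on the module *)

Section LinearMaps.
Variables (F : fieldType) (M W : lmodType F).

Definition is_lin : {pred M -> W} := fun f => `[< linear f >].

Lemma is_lin_closed : submod_closed is_lin.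
Proof.
split=> [|x f g /asboolP lf /asboolP lg]; apply/asboolP; first exact: linear_zero.
exact: linear_add (linear_scale x lf) lg.
Qed.

HB.instance Definition _ := GRing.isSubmodClosed.Build F (M -> W) is_lin is_lin_closed.

Record linmap := Linmap { linmap_val :> M -> W; linmap_valP : linmap_val \in is_lin }.

HB.instance Definition _ := [isSub for linmap_val].
HB.instance Definition _ := [Choice of linmap by <:].
HB.instance Definition _ := [SubChoice_isSubLmodule of linmap by <:].

Lemma linmap_linear (f : linmap) : linear f.
Proof. exact/asboolP/(linmap_valP f). Qed.

Lemma linmapP (f g : linmap) : f =1 g -> f = g.
Proof. by move=> e; apply: val_inj; apply: funext. Qed.

Definition mklin (f : M -> W) (lf : linear f) : linmap := Linmap (introT (asboolP _) lf).

End LinearMaps.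

Section Functionals.
Variables (F : fieldType) (R : lieConformalAlgebra F) (M : lcaModuleAlgebra R).
Variables (W : lmodType F) (dW : W -> W).
Hypothesis ldW : linear dW.

Local Notation D := (@lcm_D F R M).
Local Notation mul := (@lcma_mul F R M).
Local Notation act := (@lcm_act F R M).

Let lD : linear D. Proof. exact: lcm_D_linear. Qed.

(** The usual derivation of Hom(M, W), the commutator of xi with the derivations of M and W. *)
Definition nhomD (xi : linmap M W) (v : M) : W := dW (xi v) - xi (D v).

Lemma nhomD_linear xi : linear (nhomD xi).
Proof.
have l := linmap_linear xi.
by apply: linear_sub; [exact: linear_comp ldW l|exact: linear_comp l lD].
Qed.

Definition nD (x : (linmap M W * W)%type) : (linmap M W * W)%type :=
  (mklin (nhomD_linear x.1), dW x.2).

Lemma nD_linear : linear nD.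
Proof.
move=> s x y; rewrite /nD; congr (_, _); last exact: ldW.
apply: linmapP => v.
change (dW (s *: x.1 v + y.1 v) - (s *: x.1 (D v) + y.1 (D v)) =
  s *: (dW (x.1 v) - x.1 (D v)) + (dW (y.1 v) - y.1 (D v))).
by rewrite ldW scalerBr opprD addrACA.
Qed.

(* linear maps from M to W, augmented by W in order to remember the value of the
   linear map at the element of M by which it gets multiplied *)
Definition nmod : lcaModuleAlgebra R := triv R nD_linear.

(** The series g at d/dlambda applied to c_lambda v, at lambda = 0: a transpose of the action on M.
    The factor n! appears because [lcm_act] records coefficients of plain powers of lambda. *)
Definition nev_fun c (g : nat -> nmod) (v : M) : W := lext (fun n u => (g n).1 u *+ n`!) (act c v).

Let lfg (g : nat -> nmod) n : linear (fun u => (g n).1 u *+ n`!).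
Proof. exact/linear_muln/linmap_linear. Qed.

Lemma nev_linear c g : linear (nev_fun c g).
Proof.
have [_ ar] := @lcm_act_bilinear F R M.
apply: linear_comp _ (ar c); exact: lext_linear.
Qed.

(** The second component is 0 because the two terms on the right of the Leibniz rule [mact_leib]
    cancel there. *)
Definition nev c (g : pow nmod) : nmod := (mklin (nev_linear c g), 0 : W).

Lemma nmodP (x y : nmod) : (forall v, x.1 v = y.1 v) -> x.2 = y.2 -> x = y.
Proof. by case: x y => [f w] [f' w'] /= e ->; congr (_, _); exact: linmapP. Qed.

Lemma fst_eval v : linear (fun x : nmod => x.1 v). Proof. by []. Qed.
Lemma snd_linear : linear (fun x : nmod => x.2). Proof. by []. Qed.

Let bilA := @lcm_act_bilinear F R M.
Let bilM := @lcma_mul_bilinear F R M.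

Definition nlam (g : nat -> nmod) (p : finfam nat M) : W := lext (fun n u => (g n).1 u *+ n`!) p.

Lemma nlam_linear g : linear (nlam g).
Proof. exact: lext_linear. Qed.

Lemma nlam_linear_l p : linear (fun g : pow nmod => nlam g p).
Proof. by apply: lext_linear_l => n u; apply: linear_muln. Qed.

Lemma nevE c g v : (nev c g).1 v = nlam g (act c v). Proof. by []. Qed.

Lemma nlam_mulX1 (g : pow nmod) p : nlam g (mulX1 p) = nlam (dy g) p.
Proof.
rewrite /nlam /mulX1 lext_shift //; apply: eq_lext => n u.
Transparent dy.
by rewrite /dy (linear_fun_muln (fst_eval u)) -mulrnA.
Opaque dy.
Qed.

Lemma nev_ev_dhom c : dhom (nev c).
Proof.
have [_ s2] := @lcm_act_sesquilinear F R M; split=> [s g g'|g]; apply: nmodP.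
- by move=> v; rewrite nevE nlam_linear_l.
- by rewrite /= scaler0 addr0.
- move=> v; rewrite nevE -[RHS]/(dW (nlam g (act c v)) - nlam g (act c (D v))).
  rewrite s2 (linear_funD (nlam_linear g)) nlam_mulX1 opprD addrA.
  rewrite /nlam (lext_comp _ _ ldW) lext_fmap // -!lextN -!lextD; apply: eq_lext => n u.
  have -> : (lcm_D g n).1 u = dW ((g n).1 u) - (g n).1 (D u) - (dy g n).1 u by [].
  by rewrite (linear_fun_muln ldW) !mulrnBl.
- by rewrite /= (linear_fun0 ldW).
Qed.

(** A functional on M[lambda, mu], lambda being paired with the inner variable and mu with the outer
    one; it maps the Jacobi identity of the module to [ev_br]. *)
Definition nphi (g : pow (pow nmod)) (p : finfam (nat * nat)%type M) : W :=
  lext (fun e u => (g e.2 e.1).1 u *+ (e.1`! * e.2`!)) p.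

Let lphi g (e : (nat * nat)%type) : linear (fun u => ((g : pow (pow nmod)) e.2 e.1).1 u *+ (e.1`! * e.2`!)).
Proof. exact/linear_muln/linmap_linear. Qed.

Lemma nphi_linear g : linear (nphi g).
Proof. exact: lext_linear. Qed.

Lemma nphi_linear_l p : linear (fun g : pow (pow nmod) => nphi g p).
Proof. by apply: lext_linear_l => n u; apply: linear_muln. Qed.

Lemma nphi_mulL (g : pow (pow nmod)) p : nphi g (mulL p) = nphi (pmap (@dy F R nmod) g) p.
Proof.
rewrite /nphi /mulL lext_shift //; apply: eq_lext => -[n m] u /=.
Transparent dy pmap.
by rewrite /dy /pmap (linear_fun_muln (fst_eval u)) -mulrnA factS mulnA.
Opaque dy pmap.
Qed.

Lemma nphi_mulM (g : pow (pow nmod)) p : nphi g (mulM p) = nphi (dy g) p.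
Proof.
rewrite /nphi /mulM lext_shift //; apply: eq_lext => -[n m] u /=.
Transparent dy.
by rewrite /dy pow_muln (linear_fun_muln (fst_eval u)) -mulrnA factS mulnCA.
Opaque dy.
Qed.

(** The binomial theorem in dual form: powers of lambda + mu see g only on the diagonal. Induction
    by the chain rule avoids binomial coefficients. *)
Lemma nphi_sum (g : pow (pow nmod)) n u :
  nphi g (iter n (fun p => mulL p + mulM p) (mono (0, 0)%N u)) = (mrg g n).1 u *+ n`!.
Proof.
elim: n g => [|n ih] g.
  rewrite /nphi lext_mono_lin //.
  Transparent mrg.
  by rewrite /mrg big_ord1.
  Opaque mrg.
rewrite iterS (linear_funD (nphi_linear g)) nphi_mulL nphi_mulM addrC -(linear_funD (nphi_linear_l _)).
rewrite ih -dy_mrg factS.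
Transparent dy.
by rewrite /dy (linear_fun_muln (fst_eval u)) -mulrnA.
Opaque dy.
Qed.

Lemma nphi_br (g : pow (pow nmod)) l n u :
  nphi g (iter l (@mulL F M) (iter n (fun p => mulL p + mulM p) (mono (0, 0)%N u))) =
    (mrgl l g n).1 u *+ n`!.
Proof.
elim: l g => [|l ih] g; first by rewrite nphi_sum.
by rewrite iterS nphi_mulL ih mrglS.
Qed.

Lemma nev_is_ev : is_ev nev.
Proof.
have [s1 s2] := @lcm_act_sesquilinear F R M; split; first exact: nev_ev_dhom.
- move=> g s b c; apply: nmodP => [v|]; last by rewrite /= scaler0 addr0.
  by rewrite nevE (proj1 bilA) nlam_linear.
- move=> b g; apply: nmodP => [v|]; last by rewrite /= oppr0.
  by rewrite nevE s1 (linear_funN (nlam_linear g)) nlam_mulX1.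
move=> b c g; apply: nmodP => [v|]; last first.
  rewrite (linear_funN snd_linear) (lext_comp _ _ snd_linear) /= subrr.
  by rewrite /lext big1 ?oppr0.
have mn (V : lmodType F) i : linear (@mono F (nat * nat)%type V i) by exact: mono_linear.
(* Transposition reverses the order: nev b after nev c is dual to the action of b followed by that
   of c. *)
have e1 : (nev b (pmap (nev c) (flip g))).1 v = nphi g (act_ml act b c v).
  rewrite nevE /act_ml (lext_comp _ _ (nphi_linear g)); apply: eq_lext => n u.
  Transparent pmap flip.
  rewrite (lext_comp _ _ (nphi_linear g)) nevE /nlam.
  Opaque pmap flip.
  rewrite /lext -sumrMnl; apply: eq_bigr => m _.
  rewrite /nphi lext_mono_lin; last exact: lphi.
  Transparent flip.
  by rewrite /= /flip -mulrnA mulnC.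
  Opaque flip.
have e2 : (nev c (pmap (nev b) g)).1 v = nphi g (act_lm act b c v).
  rewrite nevE /act_lm (lext_comp _ _ (nphi_linear g)); apply: eq_lext => n u.
  Transparent pmap.
  rewrite (lext_comp _ _ (nphi_linear g)) nevE /nlam.
  Opaque pmap.
  rewrite /lext -sumrMnl; apply: eq_bigr => m _.
  by rewrite /nphi lext_mono_lin; [rewrite -mulrnA|exact: lphi].
rewrite (linear_funB (fst_eval v)) e1 e2 -[LHS]opprB -(linear_funB (nphi_linear g)) lcm_act_jacobi.
rewrite (linear_funN (fst_eval v)); congr (- _); rewrite (lext_comp _ _ (nphi_linear g)).
rewrite (lext_comp _ _ (fst_eval v)); apply: eq_lext => l r.
rewrite (lext_comp _ _ (nphi_linear g)) nevE; apply: eq_lext => n u; exact: nphi_br.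
Qed.

Definition nmul (m : M) (x : nmod) : nmod :=
  (mklin (linear_comp (linmap_linear x.1) (proj2 bilM m)), x.1 m).

Lemma nmul_mact : mact nev nmul.
Proof.
have [ml mr] := bilM; split; first exact: nev_is_ev.
- split=> [|m x].
    split=> [x s m m'|m s x y]; apply: nmodP => //= [v|].
    + by rewrite ml linmap_linear.
    + by rewrite linmap_linear.
  apply: nmodP => [v|] /=; last first.
    by rewrite /nhomD addrC subrK.
  change (dW (x.1 (mul m v)) - x.1 (mul m (D v)) =
    x.1 (mul (D m) v) + (dW (x.1 (mul m v)) - x.1 (D (mul m v)))).
  by rewrite lcma_D_derivation (linear_funD (linmap_linear x.1)); zmod.
- move=> m m' x; apply: nmodP => [v|] /=; last by rewrite lcma_mulC.
  by rewrite lcma_mulA [mul m' m]lcma_mulC.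
move=> c m xi; apply: nmodP => [v|]; last first.
  rewrite (linear_funB snd_linear) (lext_comp _ _ snd_linear) /=.
  rewrite -/(nlam xi _) /nev_fun -/(nlam xi _) -[LHS](subrr (nlam xi (act c m))); congr (_ - _).
  by apply: eq_lext => n u; rewrite (linear_fun_muln snd_linear).
rewrite (linear_funB (fst_eval v)) (lext_comp _ _ (fst_eval v)) /= /nev_fun lcma_act_derivation.
rewrite -![lext (fun n u => (xi n).1 u *+ n`!) _]/(nlam xi _) (linear_funD (nlam_linear xi)).
rewrite /nlam !lext_fmap //.
have -> : lext (fun n v0 => (nmul v0 (xi n) *+ n`!).1 v) (act c m) =
    lext (fun n v0 => (xi n).1 (mul v0 v) *+ n`!) (act c m).
  by apply: eq_lext => n u; rewrite (linear_fun_muln (fst_eval v)).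
by rewrite addrAC subrr add0r.
Qed.

End Functionals.

Section Unit.
Variables (F : fieldType) (R : lieConformalAlgebra F) (M : lcaModuleAlgebra R).

(* M augmented by its multiplication operators, so as to act faithfully even without unit *)
Definition bmod : lcaModuleAlgebra R := nmod M (@lcm_D_linear F R M).
Definition bev : R -> pow bmod -> bmod := @nev F R M M _ (@lcm_D_linear F R M).
Definition bmul : M -> bmod -> bmod := @nmul F R M M _ (@lcm_D_linear F R M).

Lemma bmul_mact : mact bev bmul.
Proof. exact: nmul_mact. Qed.

(** A substitute for a unit: the product of m with (id, 0) has second component id(m) = m. *)
Definition bunit : bmod := (mklin (@linear_id F M), 0 : M).

Lemma bunit_D : lcm_D bunit = 0.
Proof.
apply: nmodP => [v|] /=; first by rewrite /nhomD /= subrr.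
exact: linear_fun0 (@lcm_D_linear F R M).
Qed.

Lemma bunit_series : (fun _ : expo 0 => bunit) \in @is_series F R bmod 0.
Proof. by apply/asboolP => m; rewrite big_ord0 bunit_D. Qed.

Definition chain1 : chain_space bmod 0 := tch (fun _ => 0) (fun _ => bunit).

Definition bval (x : bmod) : M := x.2.

Lemma bval_dhom : dhom bval. Proof. by []. Qed.

Lemma bval_tw (x : Chains M) : tmap bval (tw bmul x (din chain1)) = x.
Proof.
have hmu := mact_pairing bmul_mact; have ho := opp_pairing hmu.
have hd : dhom (opp_pair bmul bunit) := pairing_dhom ho bunit_D.
move: x; apply: total_ext => [||k X].
- exact: linear_comp (tmap_linear bval_dhom) (tw_linear hmu _).
- exact: linear_id.
rewrite tw_comm // muln0 scale1r /chain1 /tch tw_chain0 // (serE bunit_series).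
by rewrite (tmap_comp _ bval_dhom hd) tmap_id.
Qed.

Lemma tw_inj (x y : Chains M) : (forall w, tw bmul x w = tw bmul y w) -> x = y.
Proof. by move=> e; rewrite -[x]bval_tw -[y]bval_tw e. Qed.

End Unit.

(** * The Gerstenhaber algebra of chains *)

(* V : superspace, x of parity p: Kop d p x is minus the supercommutator of x and d,
   and Bop d p q x y is the supercommutator of Kop d p x and y *)
Section DerivedBracket.
Variables (F : fieldType) (V : lmodType F) (d : V -> V).
Hypotheses (ld : linear d) (dd : forall w, d (d w) = 0).

Definition Kop (p : bool) (x : V -> V) (w : V) : V := (-1) ^+ p *: d (x w) - x (d w).
Definition Bop (p q : bool) (x y : V -> V) (w : V) : V :=
  Kop p x (y w) - (-1) ^+ (~~ p && q) *: y (Kop p x w).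

Lemma Kop_linear p x : linear x -> linear (Kop p x).
Proof.
move=> lx; apply: linear_sub; last exact: linear_comp.
by apply: linear_scale; apply: linear_comp.
Qed.

Lemma Kop_scale p a x w : Kop p (fun u => a *: x u) w = a *: Kop p x w.
Proof. by rewrite /Kop (linear_funZ ld) scalerA mulrC -scalerA -scalerBr. Qed.

(** This amounts to [d, [x, y]] = 0, which holds as x and y supercommute. *)
Lemma Bop_skew p q x y : linear x -> linear y ->
  (forall w, x (y w) = (-1) ^+ (p && q) *: y (x w)) ->
  forall w, Bop p q x y w = - ((-1) ^+ (~~ p && ~~ q) *: Bop q p y x w).
Proof.
move=> lx ly xy w; rewrite /Bop /Kop.
rewrite ?(linear_funB ly, linear_funZ ly, linear_funB lx, linear_funZ lx, linear_funB ld, linear_funZ ld, xy).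
by case: p q xy => -[] _; rewrite /= ?expr0 ?expr1 ?scale1r ?scaleN1r; zmod.
Qed.

(** Since d d = 0, [Kop] carries the derived bracket to the supercommutator. *)
Lemma Kop_Bop p q x y : linear x -> linear y -> forall w,
  Kop (~~ (p (+) q)) (Bop p q x y) w =
    Kop p x (Kop q y w) - (-1) ^+ (~~ p && ~~ q) *: Kop q y (Kop p x w).
Proof.
move=> lx ly w; rewrite /Bop /Kop.
rewrite ?(linear_funB ly, linear_funZ ly, linear_funB lx, linear_funZ lx, linear_funB ld, linear_funZ ld, dd).
rewrite ?(linear_fun0 ly, linear_fun0 lx, linear_fun0 ld, scaler0).
by case: p; case: q; rewrite /= ?expr0 ?expr1 ?scale1r ?scaleN1r; zmod.
Qed.

(** [Bop] is the adjoint action of [Kop p x], so by [Kop_Bop] this is the Jacobi identity of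
    supercommutators. *)
Lemma Bop_jacobi p q r x y z : linear x -> linear y -> linear z -> forall w,
  Bop p (~~ (q (+) r)) x (Bop q r y z) w =
    Bop (~~ (p (+) q)) r (Bop p q x y) z w +
    (-1) ^+ (~~ p && ~~ q) *: Bop q (~~ (p (+) r)) y (Bop p r x z) w.
Proof.
move=> lx ly lz w; have lK := Kop_linear p lx; have lL := Kop_linear q ly.
rewrite /Bop -/(Bop p q x y) !Kop_Bop // /Bop.
move: (Kop p x) (Kop q y) lK lL => K L lK lL.
rewrite ?(linear_funB lz, linear_funZ lz, linear_funB lK, linear_funZ lK, linear_funB lL, linear_funZ lL).
by case: p; case: q; case: r; rewrite /= ?expr0 ?expr1 ?scale1r ?scaleN1r; zmod.
Qed.

Lemma Bop_leibniz p q r x y z : linear x -> linear y -> linear z -> forall w,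
  Bop p (q (+) r) x (fun w => y (z w)) w =
    Bop p q x y (z w) + (-1) ^+ (~~ p && q) *: y (Bop p r x z w).
Proof.
move=> lx ly lz w; rewrite /Bop; have lK := Kop_linear p lx.
rewrite ?(linear_funB ly, linear_funZ ly).
by case: p {lK}; case: q; case: r; rewrite /= ?expr0 ?expr1 ?scale1r ?scaleN1r; zmod.
Qed.

End DerivedBracket.

Section Parity.
Variables (F : fieldType) (V : nat -> lmodType F).

Lemma dsum_parity_linear b s (u v : dsum V) :
  dsum_parity b u -> dsum_parity b v -> dsum_parity b (s *: u + v).
Proof. by move=> hu hv k hk; rewrite dsumDE dsumZE hu // hv // scaler0 addr0. Qed.

Lemma dsum_parity0 b : dsum_parity b (0 : dsum V).
Proof. by []. Qed.

Lemma dsum_parity_dinj k (v : V k) : dsum_parity (odd k) (dinj V k v).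
Proof. by move=> j hj; rewrite dinj_neq //; apply: contraNneq hj => ->. Qed.

Lemma dsum_parity_sum b (I : Type) (r : seq I) (P : pred I) (f : I -> dsum V) :
  (forall i, P i -> dsum_parity b (f i)) -> dsum_parity b (\sum_(i <- r | P i) f i).
Proof.
move=> h; elim/big_ind: _ => // u v hu hv.
by rewrite -[u]scale1r; apply: dsum_parity_linear.
Qed.

Lemma dsum_parity_ind b (S : dsum V -> Prop) :
  S 0 -> (forall u v, S u -> S v -> S (u + v)) ->
  (forall k v, odd k = b -> S (dinj V k v)) -> forall x, dsum_parity b x -> S x.
Proof.
move=> S0 SD Sd x hx; rewrite (dsum_sum x) big_seq; elim/big_ind: _ => // i.
rewrite mem_supp => xi; apply: Sd; apply/eqP; apply: contraNT xi => h.
by rewrite hx.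
Qed.

Lemma dsum_parity_ext b (W : lmodType F) (f g : dsum V -> W) : linear f -> linear g ->
  (forall k v, odd k = b -> f (dinj V k v) = g (dinj V k v)) ->
  forall x, dsum_parity b x -> f x = g x.
Proof.
move=> lf lg fg; apply: dsum_parity_ind => [|u v hu hv|k v hk]; last exact: fg.
  by rewrite !linear_fun0.
by rewrite !linear_funD // hu hv.
Qed.

Lemma dsum_superspace : is_superspace (@dsum_parity F V).
Proof.
split; [exact: dsum_parity0|exact: dsum_parity_linear| |].
  move=> v h0 h1; apply: dsumP => k; case e: (odd k); first by rewrite h0 ?e.
  by rewrite h1 ?e.
move=> v; exists (\sum_(i <- supp v | ~~ odd i) dinj V i (v i)).
exists (\sum_(i <- supp v | odd i) dinj V i (v i)); split.
- by apply: dsum_parity_sum => i /negbTE <-; apply: dsum_parity_dinj.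
- by apply: dsum_parity_sum => i oi; rewrite -[true]oi; apply: dsum_parity_dinj.
by rewrite {1}(dsum_sum v) (bigID odd) /= addrC.
Qed.

End Parity.

Section TotalDegree.
Variables (F : fieldType) (R : lieConformalAlgebra F) (A1 A2 A3 : lcaModuleAlgebra R).
Variable mu : A1 -> A2 -> A3.

Lemma din_id (A : lcaModuleAlgebra R) n (w : chain_space A n) : din w n = w.
Proof.
Transparent din.
exact: dinj_id.
Opaque din.
Qed.

Lemma tw_degree h k (X : chain_space A1 h) (Y : chain_space A2 k) : pairing mu ->
  tw mu (din X) (din Y) = din (tw mu (din X) (din Y) (h + k)%N).
Proof.
move=> hmu; have ld A n : linear (@din F R A n) by exact: din_linear.
have leval n : linear (fun x : Chains A3 => x n) by [].
have lX y : linear (fun X : chain_space A1 h => tw mu (din X) y).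
  exact: linear_comp (tw_linear hmu y) (ld _ _).
have lY x : linear (fun Y : chain_space A2 k => tw mu x (din Y)).
  exact: linear_comp (tw_linear_r hmu x) (ld _ _).
move: X; apply: chain_ext => [||a phi]; first exact: lX.
  exact: linear_comp (ld _ _) (linear_comp (leval _) (lX _)).
move: Y; apply: chain_ext => [||b psi]; first exact: lY.
  exact: linear_comp (ld _ _) (linear_comp (leval _) (lY _)).
by rewrite tw_chain // din_id.
Qed.

End TotalDegree.

Section ChainBracket.
Variables (F : fieldType) (R : lieConformalAlgebra F) (M : lcaModuleAlgebra R).

Let ld A n : linear (@din F R A n). Proof. exact: din_linear. Qed.

Lemma Qop_linear_l A (ev : R -> pow A -> A) (mu : M -> A -> A) h k (Y : chain_space M k) w :
  mact ev mu -> linear (fun X : chain_space M h => Qop ev mu X Y w).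
Proof.
move=> hA; have hmu := mact_pairing hA; have lb := tbv_linear (mact_ev hA).
have lt v : linear (fun X : chain_space M h => tw mu (din X) v).
  exact: linear_comp (tw_linear hmu v) (@ld _ _).
have lY := tw_linear_r hmu (din Y); apply: linear_sub.
  by apply: linear_sub; [exact: linear_comp lb (lt _)|exact: linear_scale].
apply: linear_scale; apply: linear_sub; first exact: linear_comp lY (linear_comp lb (lt _)).
by apply: linear_scale; exact: linear_comp lY (lt _).
Qed.

Lemma Qop_linear_r A (ev : R -> pow A -> A) (mu : M -> A -> A) h k (X : chain_space M h) w :
  mact ev mu -> linear (fun Y : chain_space M k => Qop ev mu X Y w).
Proof.
move=> hA; have hmu := mact_pairing hA; have lb := tbv_linear (mact_ev hA).
have lt v : linear (fun Y : chain_space M k => tw mu (din Y) v).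
  exact: linear_comp (tw_linear hmu v) (@ld _ _).
have lX := tw_linear_r hmu (din X); apply: linear_sub.
  apply: linear_sub; first exact: linear_comp lb (linear_comp lX (lt _)).
  by apply: linear_scale; exact: linear_comp lX (linear_comp lb (lt _)).
apply: linear_scale; apply: linear_sub; first exact: lt.
by apply: linear_scale; exact: lt.
Qed.

(* [X, Y], read off the action of the derived bracket on the chain of degree 0 on
   which the wedge product with X has the value X *)
Definition cbr (x y : Chains M) : Chains M :=
  dlift (fun h X => dlift (fun k Y =>
    (-1) ^+ h *: tmap (@bval F R M) (Qop (@bev F R M) (@bmul F R M) X Y (din (chain1 M)))) y) x.

Let lval : linear (tmap (@bval F R M)). Proof. exact: tmap_linear (@bval_dhom _ _ _). Qed.
Let hB := @bmul_mact F R M.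

Let lQr h X k : linear (fun Y : chain_space M k =>
  (-1) ^+ h *: tmap (@bval F R M) (Qop (@bev F R M) (@bmul F R M) (X : chain_space M h) Y (din (chain1 M)))).
Proof. apply: linear_scale; exact: linear_comp lval (Qop_linear_r _ _ hB). Qed.

Let lQl h (y : Chains M) : linear (fun X : chain_space M h => dlift (fun k Y =>
    (-1) ^+ h *: tmap (@bval F R M) (Qop (@bev F R M) (@bmul F R M) X Y (din (chain1 M)))) y).
Proof.
apply: linear_bigsum => k; apply: linear_scale.
exact: linear_comp lval (Qop_linear_l _ _ hB).
Qed.

Lemma cbr_bilinear : bilinear_op cbr.
Proof.
split=> [y|x]; first by apply: dlift_linear => h; apply: lQl.
by apply: linear_bigsum => h; exact: (dlift_linear (fun k => @lQr h (x h) k)).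
Qed.

Lemma cbr_din h k (X : chain_space M h) (Y : chain_space M k) : cbr (din X) (din Y) =
  (-1) ^+ h *: tmap (@bval F R M) (Qop (@bev F R M) (@bmul F R M) X Y (din (chain1 M))).
Proof.
Transparent din.
rewrite /cbr /din dliftE; last by move=> h'; apply: lQl.
by rewrite dliftE.
Opaque din.
Qed.

Lemma cbr_chain h k a b (phi : xseries M h) (psi : xseries M k) :
  cbr (din (chain a phi)) (din (chain b psi)) = din (bracket_formula a phi b psi).
Proof.
rewrite cbr_din Qop_bracket // (linear_funZ lval) bval_tw scalerA -exprD -signr_odd.
by rewrite oddD addbb scale1r.
Qed.

Lemma cbr_is_bracket : is_bracket cbr.
Proof. by split; [exact: cbr_bilinear|exact: cbr_chain]. Qed.

Section Action.
Variables (A : lcaModuleAlgebra R) (ev : R -> pow A -> A) (mu : M -> A -> A).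
Hypothesis hA : mact ev mu.
Let hmu := mact_pairing hA.

(** The bracket was read off one particular module, but on generators it is given by the bracket
    formula, so it acts by the derived bracket on every module. *)
Lemma tw_cbr_din h k (X : chain_space M h) (Y : chain_space M k) w :
  tw mu (cbr (din X) (din Y)) w =
    Bop (tbv ev) (odd h) (odd k) (tw mu (din X)) (tw mu (din Y)) w.
Proof.
have -> : Bop (tbv ev) (odd h) (odd k) (tw mu (din X)) (tw mu (din Y)) w =
    (-1) ^+ h *: Qop ev mu X Y w.
  rewrite /Qop /Bop /Kop (linear_funB (tw_linear_r hmu _)) (linear_funZ (tw_linear_r hmu _)).
  rewrite -[(-1) ^+ (h.+1 * k)]signr_odd -[(-1) ^+ h]signr_odd oddM /=.
  by case: (odd h); case: (odd k); rewrite /= ?expr0 ?expr1 ?scale1r ?scaleN1r; zmod.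
have [cl cr] := cbr_bilinear.
move: X; apply: chain_ext => [||a phi].
- apply: linear_comp (tw_linear hmu w) _; exact: linear_comp (cl _) (@ld _ _).
- apply: linear_scale; exact: Qop_linear_l.
move: Y; apply: chain_ext => [||b psi].
- apply: linear_comp (tw_linear hmu w) _; exact: linear_comp (cr _) (@ld _ _).
- apply: linear_scale; exact: Qop_linear_r.
by rewrite cbr_chain Qop_bracket // scalerA -exprD -signr_odd oddD addbb scale1r.
Qed.

Lemma tw_cbr p q x y w : dsum_parity p x -> dsum_parity q y ->
  tw mu (cbr x y) w = Bop (tbv ev) p q (tw mu x) (tw mu y) w.
Proof.
move=> px qy; have [cl cr] := cbr_bilinear; have lt := tw_linear hmu; have ltr := tw_linear_r hmu.
have lb := tbv_linear (mact_ev hA).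
have lK u : linear (fun x => Kop (tbv ev) p (tw mu x) u).
  by apply: linear_sub => //; apply: linear_scale; exact: linear_comp lb (lt _).
move: x px; apply: dsum_parity_ext => [||h X ph].
- exact: linear_comp (lt w) (cl y).
- by apply: linear_sub => //; apply: linear_scale; exact: linear_comp (ltr _) (lK _).
have lKX := Kop_linear lb p (ltr (din X)).
move: y qy; apply: dsum_parity_ext => [||k Y qk].
- exact: linear_comp (lt w) (cr _).
- by apply: linear_sub; [exact: linear_comp lKX (lt _)|exact: linear_scale].
Transparent din.
by rewrite -ph -qk; apply: tw_cbr_din.
Opaque din.
Qed.

End Action.

Let leval n : linear (fun x : Chains M => x n). Proof. by []. Qed.

Lemma cbr_degree h k (X : chain_space M h) (Y : chain_space M k) :
  cbr (din X) (din Y) = din (cbr (din X) (din Y) (h + k).-1).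
Proof.
have [cl cr] := cbr_bilinear.
have lX n (y : Chains M) : linear (fun X : chain_space M n => cbr (din X) y).
  exact: linear_comp (cl y) (@ld _ _).
have lY n (x : Chains M) : linear (fun Y : chain_space M n => cbr x (din Y)).
  exact: linear_comp (cr x) (@ld _ _).
move: X; apply: chain_ext => [||a phi]; first exact: lX.
  exact: linear_comp (@ld _ _) (linear_comp (@leval _) (lX _ _)).
move: Y; apply: chain_ext => [||b psi]; first exact: lY.
  exact: linear_comp (@ld _ _) (linear_comp (@leval _) (lY _ _)).
rewrite cbr_chain; apply: (congr1 (@din F R M _)).
Transparent din.
by rewrite /din dinj_id.
Opaque din.
Qed.

(** For h = k = 0 the truncated predecessor places the bracket in degree 0 instead of -1, with the
    wrong parity; parity is saved because all sums of the formula are empty. *)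
Lemma cbr_degree0 (X Y : chain_space M 0) : cbr (din X) (din Y) = 0.
Proof.
have [cl cr] := cbr_bilinear.
move: X; apply: chain_ext => [||a phi]; [exact: linear_comp (cl _) (@ld _ _)|exact: linear_zero|].
move: Y; apply: chain_ext => [||b psi]; [exact: linear_comp (cr _) (@ld _ _)|exact: linear_zero|].
rewrite cbr_chain -[RHS](linear_fun0 (@ld M (0 + 0).-1)); apply: (congr1 (@din F R M _)).
by rewrite /bracket_formula !big_ord0 !addr0.
Qed.

Lemma cbr_parity p q x y : dsum_parity p x -> dsum_parity q y ->
  dsum_parity (~~ (p (+) q)) (cbr x y).
Proof.
move=> px qy; have [cl cr] := cbr_bilinear; have lp := @dsum_parity_linear F (fun k => chain_space M k).
have hD b (u v : Chains M) : dsum_parity b u -> dsum_parity b v -> dsum_parity b (u + v).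
  by rewrite -[X in X + v]scale1r; apply: lp.
move: x px; apply: dsum_parity_ind => [|u v hu hv|h X ph].
- by rewrite (linear_fun0 (cl y)).
- by rewrite (linear_funD (cl y)); apply: hD.
move: y qy; apply: dsum_parity_ind => [|u v hu hv|k Y qk].
- by rewrite (linear_fun0 (cr _)).
- by rewrite (linear_funD (cr _)); apply: hD.
have [e|e] := posnP (h + k).
  have [h0 k0] : h = 0%N /\ k = 0%N by lia.
  by subst h k; rewrite (cbr_degree0 X Y).
rewrite (cbr_degree X Y) -ph -qk -oddD.
have -> : ~~ odd (h + k) = odd (h + k).-1 by case: (h + k)%N e => [|n] //= _; rewrite negbK.
Transparent din.
exact: dsum_parity_dinj.
Opaque din.
Qed.

Definition cwd : Chains M -> Chains M -> Chains M := tw (@lcma_mul F R M).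

Let hmul := @mul_pairing F R M.

Lemma cwd_is_wedge : is_wedge cwd.
Proof.
split; first by split=> [y|x]; [exact: tw_linear|exact: tw_linear_r].
move=> h k a b phi psi; apply: etrans (tw_chain a b phi psi hmul) _.
rewrite -(tch_chain (catf a b)).
Transparent din.
by [].
Opaque din.
Qed.

Lemma cwd_parity p q x y : dsum_parity p x -> dsum_parity q y -> dsum_parity (p (+) q) (cwd x y).
Proof.
move=> px qy; have [cl cr] := proj1 cwd_is_wedge.
have lp := @dsum_parity_linear F (fun k => chain_space M k).
have hD b (u v : Chains M) : dsum_parity b u -> dsum_parity b v -> dsum_parity b (u + v).
  by rewrite -[X in X + v]scale1r; apply: lp.
move: x px; apply: dsum_parity_ind => [|u v hu hv|h X ph].
- by rewrite (linear_fun0 (cl y)).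
- by rewrite (linear_funD (cl y)); apply: hD.
move: y qy; apply: dsum_parity_ind => [|u v hu hv|k Y qk].
- by rewrite (linear_fun0 (cr _)).
- by rewrite (linear_funD (cr _)); apply: hD.
rewrite [cwd _ _](tw_degree X Y hmul) -ph -qk -oddD.
Transparent din.
exact: dsum_parity_dinj.
Opaque din.
Qed.

Lemma cwd_comm_assoc : comm_assoc_superalgebra (@dsum_parity F _) cwd.
Proof.
have lL := tw_linear hmul; have lR := tw_linear_r hmul; split.
- exact: (proj1 cwd_is_wedge).
- exact: cwd_parity.
- move=> p q x y px qy; move: x px; apply: dsum_parity_ext => [||h X ph].
  + exact: lL.
  + by apply: linear_scale; exact: lR.
  move: y qy; apply: dsum_parity_ext => [||k Y qk].
  + exact: lR.
  + by apply: linear_scale; exact: lL.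
  apply: etrans (tw_comm X Y hmul) _; rewrite -signr_odd oddM ph qk.
  have -> // : opp_pair (@lcma_mul F R M) = @lcma_mul F R M.
  by apply: funext => m; apply: funext => n; rewrite /opp_pair lcma_mulC.
- by move=> x y z; apply/esym/tw_assoc => // u v w; rewrite lcma_mulA.
Qed.

Lemma chains_gerstenhaber : gerstenhaber (@dsum_parity F _) cwd cbr.
Proof.
have hB' := hB; have hmu := mact_pairing hB; have lR := tw_linear_r hmu; have hev := mact_ev hB.
have lb := tbv_linear hev; have dd := tbv_tbv hev; have lL := tw_linear hmu.
have [_ wp wc wa] := cwd_comm_assoc.
have wE x y w : tw (@bmul F R M) (cwd x y) w = tw (@bmul F R M) x (tw (@bmul F R M) y w).
  by apply: tw_assoc => // u v z; rewrite (mact_assoc hB).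
split; [exact: dsum_superspace|exact: cwd_comm_assoc| |].
- split; first exact: cbr_bilinear.
  + by move=> p q x y px qy; have := cbr_parity px qy; rewrite /rev_parity addNb addbN negbK.
  + move=> p q x y px qy; apply: tw_inj => w.
    rewrite (linear_funN (lL w)) (linear_funZ (lL w)) (tw_cbr hB _ qy px) (tw_cbr hB _ px qy).
    rewrite (Bop_skew lb) ?negbK // => u; rewrite -!wE (wc _ _ _ _ px qy).
    by rewrite (linear_funZ (lL u)).
  + move=> p q x y z px qy.
    have [cl cr] := cbr_bilinear.
    (* No parity is assumed for z, but [Bop] refers to one; by linearity z may be taken in a single
       degree. *)
    move: z; apply: (@dsum_ext _ _ (fun k => chain_space M k)) => [||r Z].
    * exact: linear_comp (cr _) (cr _).
    * apply: linear_add; first exact: cr.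
      by apply: linear_scale; exact: linear_comp (cr _) (cr _).
    have pz := dsum_parity_dinj Z; move: (dinj _ r Z) (odd r) pz => z r' pz {r Z}.
    apply: tw_inj => w; rewrite (linear_funD (lL w)) (linear_funZ (lL w)).
    have e p' q' u v (pu : dsum_parity p' u) (pv : dsum_parity q' v) :
        tw (@bmul F R M) (cbr u v) = Bop (tbv (@bev F R M)) p' q' (tw (@bmul F R M) u) (tw (@bmul F R M) v).
      by apply: funext => t; exact: tw_cbr.
    rewrite (e _ _ _ _ px (cbr_parity qy pz)) (e _ _ _ _ (cbr_parity px qy) pz).
    rewrite (e _ _ _ _ qy (cbr_parity px pz)) (e _ _ _ _ qy pz) (e _ _ _ _ px pz) (e _ _ _ _ px qy).
    by rewrite (Bop_jacobi lb dd) ?negbK.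
- move=> p q x y z px qy; have [cl cr] := cbr_bilinear; have [wl wr] := proj1 cwd_is_wedge.
  move: z; apply: (@dsum_ext _ _ (fun k => chain_space M k)) => [||r Z].
  + exact: linear_comp (cr _) (wr _).
  + apply: linear_add; first exact: wr.
    by apply: linear_scale; exact: linear_comp (wr _) (cr _).
  have pz := dsum_parity_dinj Z; move: (dinj _ r Z) (odd r) pz => z r' pz {r Z}.
  apply: tw_inj => w; rewrite (linear_funD (lL w)) (linear_funZ (lL w)) !wE.
  rewrite (tw_cbr hB _ px (wp _ _ _ _ qy pz)) (tw_cbr hB _ px pz) (tw_cbr hB _ px qy).
  rewrite -(Bop_leibniz lb p q r' (lR x) (lR y) (lR z)); apply: (congr1 (fun f => Bop _ _ _ _ f w)).
  by apply: funext => u; apply: wE.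
Qed.

End ChainBracket.

(** * The pairing of cochains with chains *)

Section Pairing.
Variables (F : fieldType) (R : lieConformalAlgebra F) (M : lcaModuleAlgebra R).
Implicit Type W : lmodType F.

Local Notation D := (@lcm_D F R M).

(** W gets the zero derivation, since the pairing must vanish on the image of the sum of the
    lambda_i and D; on functionals D is then minus the transpose. *)
Definition hmod W : lcaModuleAlgebra R := nmod M (@linear_zero F W W).
Definition hev W : R -> pow (hmod W) -> hmod W := @nev F R M W _ (@linear_zero F W W).
Definition hmul W : M -> hmod W -> hmod W := @nmul F R M W _ (@linear_zero F W W).

Lemma hmul_mact W : mact (@hev W) (@hmul W). Proof. exact: nmul_mact. Qed.

Definition mfact k (m : expo k) : nat := \prod_(i < k) (m i)`!.

Lemma mfact_upd k (m : expo k) i : mfact (upd m i (m i).+1) = ((m i).+1 * mfact m)%N.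
Proof.
rewrite /mfact (bigD1 i) //= [in RHS](bigD1 i) //= upd_id factS -mulnA; congr (_ * (_ * _))%N.
by apply: eq_bigr => j nj; rewrite upd_neq.
Qed.

Lemma mfact_comp k (m : expo k) (s : 'S_k) : mfact (m \o s) = mfact m.
Proof. by rewrite /mfact [RHS](reindex_inj (@perm_inj _ s)). Qed.

Lemma mfact_ins k (m : expo k.-1) (i : 'I_k) n : mfact (ins i n m) = (n`! * mfact m)%N.
Proof.
rewrite /mfact (bigD1_ord i) //= ins_id; congr (_ * _)%N.
by apply: eq_bigr => j _; rewrite ins_lift.
Qed.

Lemma mfact_split h k (m : expo (h + k)) :
  mfact m = (mfact (m \o lshift k) * mfact (m \o @rshift h k))%N.
Proof. by rewrite /mfact big_split_ord. Qed.

(* the value of the series at d/dlambda, applied to a polynomial, at lambda = 0 *)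
Definition pbar W k (xi : expo k -> hmod W) (p : vpoly k M) : W :=
  lext (fun (m : expo k) v => (xi m).1 v *+ mfact m) p.

Let lpb W k (xi : expo k -> hmod W) m : linear (fun v => (xi m).1 v *+ mfact m).
Proof. exact/linear_muln/linmap_linear. Qed.

Lemma pbar_linear W k (xi : expo k -> hmod W) : linear (pbar xi).
Proof. by apply: lext_linear => m; apply: lpb. Qed.

Lemma pbar_mono W k (xi : expo k -> hmod W) m v : pbar xi (mono m v) = (xi m).1 v *+ mfact m.
Proof. by apply: lext_mono_lin; apply: lpb. Qed.

Lemma pbar_linear_l W k (p : vpoly k M) : linear (fun xi : expo k -> hmod W => pbar xi p).
Proof. by apply: lext_linear_l => m v; apply: linear_muln. Qed.

Lemma pbar_mulX W k (xi : expo k -> hmod W) i p : pbar xi (mulX i p) = pbar (derX i xi) p.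
Proof.
rewrite /pbar /mulX lext_shift //; apply: eq_lext => m v.
by rewrite /derX (linear_fun_muln (fst_eval v)) mfact_upd -mulrnA.
Qed.

Lemma pbar_perm W k (xi : expo k -> hmod W) (s : 'S_k) p :
  pbar xi (permX (s^-1)%g p) = pbar (permS s xi) p.
Proof.
have ls := @permX_linear F k M (s^-1)%g.
move: p; apply: mono_ext => [||m v]; [exact: linear_comp (pbar_linear _) ls|exact: pbar_linear|].
by rewrite permX_mono invgK !pbar_mono mfact_comp.
Qed.

(** The sum of the lambda_i and D is transposed to the sum of the partial derivatives minus the
    derivation of the coefficients, which kills xi. *)
Lemma pbar_rel W k (xi : xseries (hmod W) k) g : coef_rel (M := M) g -> pbar xi g = 0.
Proof.
case=> p ->; move: p.
have lD : linear D by exact: lcm_D_linear.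
have lS : linear (fun p : vpoly k M => \sum_(i < k) mulX i p + fmap D p).
  by apply: linear_add; [apply: linear_bigsum => i; apply: mulX_linear|apply: fmap_linear].
apply: (mono_ext (linear_comp (pbar_linear xi) lS) (@linear_zero _ _ _)) => m v.
rewrite (linear_funD (pbar_linear xi)) (linear_fun_sum (pbar_linear xi)).
have e : \sum_(i < k) pbar xi (mulX i (mono m v)) = (\sum_(i < k) derX i xi m).1 v *+ mfact m.
  rewrite (linear_fun_sum (fst_eval v)) -sumrMnl; apply: eq_bigr => i _.
  by rewrite pbar_mulX pbar_mono.
rewrite e series_sum fmap_mono // pbar_mono -mulrnDl.
have -> : (lcm_D (xi m)).1 v = - (xi m).1 (D v) by rewrite -[RHS]add0r.
by rewrite addNr mul0rn.
Qed.

Definition sbar W k (xi : xseries (hmod W) k) : coef_space M k -> W := qlift (pbar xi).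

Lemma sbarE W k (xi : xseries (hmod W) k) p : sbar xi (coef_pi p) = pbar xi p.
Proof. by apply: qliftE; [exact: pbar_linear|exact: pbar_rel]. Qed.

Lemma sbar_linear W k (xi : xseries (hmod W) k) : linear (sbar xi).
Proof. by apply: qlift_linear; [exact: pbar_linear|exact: pbar_rel]. Qed.

Lemma coef_ind k (P : coef_space M k -> Prop) : (forall p, P (coef_pi p)) -> forall q, P q.
Proof. by move=> h q; rewrite -[q]lpi_repr; apply: h. Qed.

Definition pair W k (c : cochain M k) : chain_space (hmod W) k -> W :=
  clift (fun a xi => sbar xi (c a)).

Lemma pair_ok W k (c : cochain M k) : chain_ok (fun a (xi : xseries (hmod W) k) => sbar xi (c a)).
Proof.
have /asboolP [ct cD cp] := cochain_valP c; split=> [a i xi|a|a i xi|a s xi].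
- by move=> s u v; rewrite ct sbar_linear.
- move=> s xi eta; elim/coef_ind: (c a) => p; rewrite !sbarE; exact: pbar_linear_l.
- rewrite cD (linear_funN (sbar_linear _)); congr (- _); elim/coef_ind: (c a) => p.
  by rewrite coef_mulX_pi !sbarE pbar_mulX.
have := cp (s^-1)%g a; rewrite odd_permV -(linear_funZ (sbar_linear _)) => <-.
elim/coef_ind: (c _) => p; rewrite coef_permX_pi !sbarE; exact/esym/pbar_perm.
Qed.

Lemma pairE W k (c : cochain M k) a (xi : xseries (hmod W) k) : pair c (chain a xi) = sbar xi (c a).
Proof. exact: cliftE (pair_ok W c) _ _. Qed.

Lemma pair_linear_r W k (c : cochain M k) : linear (@pair W k c).
Proof. exact: clift_linear (pair_ok W c). Qed.

Lemma pair_linear W k (w : chain_space (hmod W) k) : linear (fun c : cochain M k => pair c w).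
Proof.
move=> s c c'; move: w; apply: chain_ext => [||a xi]; first exact: pair_linear_r.
  by apply: linear_add; [apply: linear_scale|]; exact: pair_linear_r.
rewrite !pairE; exact: sbar_linear.
Qed.

Definition tpair W (c : Cochains M) (w : Chains (hmod W)) : W := dlift (fun k w => pair (c k) w) w.

Lemma tpair_linear_r W (c : Cochains M) : linear (@tpair W c).
Proof. by apply: dlift_linear => k; apply: pair_linear_r. Qed.

Lemma tpair_linear W (w : Chains (hmod W)) : linear (fun c : Cochains M => tpair c w).
Proof. by apply: linear_bigsum => k s c c'; apply: pair_linear. Qed.

Lemma tpair_din W (c : Cochains M) k (w : chain_space (hmod W) k) : tpair c (din w) = pair (c k) w.
Proof.
Transparent din.
by apply: dliftE => j; apply: pair_linear_r.
Opaque din.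
Qed.

Section NMap.
Variables (W W' : lmodType F) (f : W -> W').
Hypothesis lf : linear f.

(** The second component, invisible to the pairing, is erased. Thus [nmap] of the identity is not
    the identity in general, and [nmap] need not commute with [hmul]. *)
Definition nmap (x : hmod W) : hmod W' := (mklin (linear_comp lf (linmap_linear x.1)), 0 : W').

Lemma nmap_dhom : dhom nmap.
Proof.
split=> [s x y|x].
  by apply: nmodP => [v|] /=; [exact: lf|rewrite scaler0 addr0].
by apply: nmodP => [v|] //=; rewrite /nhomD /= !sub0r (linear_funN lf).
Qed.

Lemma nmap_evhom : evhom (@hev W) (@hev W') nmap.
Proof.
split=> [|b g]; first exact: nmap_dhom.
apply: nmodP => // v; rewrite [LHS]/= /nev_fun (lext_comp _ _ lf) nevE; apply: eq_lext => n u.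
by rewrite (linear_fun_muln lf).
Qed.

Lemma pbar_nmap k (xi : expo k -> hmod W) p : pbar (nmap \o xi) p = f (pbar xi p).
Proof. by rewrite /pbar (lext_comp _ _ lf); apply: eq_lext => m v; rewrite (linear_fun_muln lf). Qed.

Lemma pair_nmap k (c : cochain M k) w : pair c (cmap nmap w) = f (pair c w).
Proof.
have hn := nmap_dhom; move: w; apply: chain_ext => [||a xi].
- exact: linear_comp (@pair_linear_r _ _ _) (cmap_linear hn).
- exact: linear_comp lf (@pair_linear_r _ _ _).
rewrite cmapE // /tch !pairE; elim/coef_ind: (c a) => p; rewrite !sbarE.
by rewrite (serE (dhom_series hn (xseries_valP xi))) pbar_nmap.
Qed.

Lemma tpair_nmap (c : Cochains M) w : tpair c (tmap nmap w) = f (tpair c w).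
Proof.
have hn := nmap_dhom; move: w; apply: total_ext => [||k w].
- exact: linear_comp (@tpair_linear_r _ _) (tmap_linear hn).
- exact: linear_comp lf (@tpair_linear_r _ _).
by rewrite tmap_din // !tpair_din pair_nmap.
Qed.

End NMap.

End Pairing.

(** * The universal series and the cochains represented by it *)

Section Universal.
Variables (F : fieldType) (charF : [pchar F]%R =i pred0).
Variables (R : lieConformalAlgebra F) (M : lcaModuleAlgebra R).
Implicit Type W : lmodType F.

Lemma coef_pi_linear k : linear (@coef_pi F R M k).
Proof. by move=> s p q; rewrite /coef_pi linearP. Qed.

Lemma mfact_neq0 k (m : expo k) : (mfact m)%:R != 0 :> F.
Proof.
rewrite ((pcharf0P _).1 charF) -lt0n; apply: prodn_gt0 => i; exact: fact_gt0.
Qed.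

Lemma mfact_inj W k (m : expo k) (x y : W) : x *+ mfact m = y *+ mfact m -> x = y.
Proof. by rewrite -!scaler_nat => /(scalerI (mfact_neq0 m)). Qed.

Lemma xiu_linear k (m : expo k) :
  linear (fun v : M => (mfact m)%:R^-1 *: @coef_pi F R M k (mono m v)).
Proof. apply: linear_scale; exact: linear_comp (@coef_pi_linear k) (@mono_linear _ _ _ _). Qed.

(* the generating series of the divided monomials lambda^m v / m! *)
Definition xiu_fun k (m : expo k) : hmod M (coef_space M k) := (mklin (xiu_linear m), 0).

Lemma xiu_mfact k (m : expo k) v : (xiu_fun m).1 v *+ mfact m = coef_pi (mono m v).
Proof. by rewrite -scaler_nat /= scalerA mulfV ?mfact_neq0 // scale1r. Qed.

Lemma xiu_series k : @xiu_fun k \in @is_series F R (hmod M (coef_space M k)) k.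
Proof.
apply/asboolP => m; apply: nmodP => [v|]; last first.
  rewrite (linear_fun_sum (@snd_linear _ _ _ _ _ _)) big1 // => i _.
  by rewrite /derX (linear_fun_muln (@snd_linear _ _ _ _ _ _)) mul0rn.
have -> : (lcm_D (xiu_fun m)).1 v = - (xiu_fun m).1 (lcm_D v) by rewrite -[RHS]add0r.
apply: (mfact_inj (m := m)); rewrite mulNrn xiu_mfact (linear_fun_sum (fst_eval v)) -sumrMnl.
have -> : \sum_(i < k) (derX i (@xiu_fun k) m).1 v *+ mfact m = \sum_(i < k) coef_pi (mulX i (mono m v)).
  apply: eq_bigr => i _; rewrite mulX_mono -xiu_mfact mfact_upd mulrnA.
  by rewrite /derX (linear_fun_muln (fst_eval v)).
apply/eqP; rewrite -addr_eq0 -(linear_fun_sum (@coef_pi_linear k)) -(linear_funD (@coef_pi_linear k)).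
apply/eqP; rewrite -[RHS](linear_fun0 (@coef_pi_linear k)); apply/lpi_eqP; rewrite subr0.
apply: lspan_gen; exists (mono m v); rewrite fmap_mono //; exact: lcm_D_linear.
Qed.

Definition xiu k : xseries (hmod M (coef_space M k)) k := XSeries (@xiu_series k).

Lemma pbar_xiu k p : pbar (xiu k) p = coef_pi p.
Proof.
move: p; apply: mono_ext => [||m v]; [exact: pbar_linear|exact: coef_pi_linear|].
by rewrite pbar_mono xiu_mfact.
Qed.

Lemma sbar_xiu k q : sbar (xiu k) q = q.
Proof. by elim/coef_ind: q => p; rewrite sbarE pbar_xiu. Qed.

Lemma pair_xiu k (c : cochain M k) a : pair c (chain a (xiu k)) = c a.
Proof. by rewrite pairE sbar_xiu. Qed.

Definition natural k (T : forall W, chain_space (hmod M W) k -> W) : Prop :=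
  (forall W, linear (T W)) /\
  forall W W' (f : W -> W') (lf : linear f) w, T W' (cmap (nmap lf) w) = f (T W w).

(** The derivatives and permutations of the universal series are its images under [coef_mulX] and
    [coef_permX], so naturality in W for these maps gives the cochain conditions. *)
Lemma cochain_of_proof k (T : forall W, chain_space (hmod M W) k -> W) : natural T ->
  (fun a => T _ (chain a (xiu k))) \in @is_cochain F R M k.
Proof.
case=> lT nT; apply/asboolP; split=> [a i s u v|a i|s a].
- exact: linear_comp (lT _) (@chain_tensor_linear _ _ _ _ _ _ _) s u v.
- rewrite chain_D (linear_funN (lT _)) -(nT _ _ _ (@coef_mulX_linear F R M k i)); congr (- T _ _).
  rewrite cmapE; last exact: nmap_dhom.
  rewrite -tch_chain; apply: tch_ext => m; apply: nmodP => [v|]; last first.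
    by rewrite /= /derX (linear_fun_muln (@snd_linear _ _ _ _ _ _)) mul0rn.
  apply: (mfact_inj (m := m)).
  have -> : ((nmap (@coef_mulX_linear F R M k i) \o xiu k) m).1 v *+ mfact m =
      coef_mulX i ((xiu k m).1 v *+ mfact m).
    by rewrite (linear_fun_muln (@coef_mulX_linear F R M k i)).
  rewrite xiu_mfact coef_mulX_pi mulX_mono -xiu_mfact mfact_upd mulrnA.
  by rewrite /= /derX (linear_fun_muln (fst_eval v)).
rewrite -(nT _ _ _ (@coef_permX_linear F R M k s)) cmapE; last exact: nmap_dhom.
have e := chain_perm a (s^-1)%g (xiu k); rewrite odd_permV invgK in e.
rewrite -(linear_funZ (lT _)) -e; congr T; rewrite -tch_chain; apply: tch_ext => m.
apply: nmodP => // v; apply: (mfact_inj (m := m)).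
have -> : ((nmap (@coef_permX_linear F R M k s) \o xiu k) m).1 v *+ mfact m =
    coef_permX s ((xiu k m).1 v *+ mfact m).
  by rewrite (linear_fun_muln (@coef_permX_linear F R M k s)).
by rewrite xiu_mfact coef_permX_pi permX_mono -xiu_mfact mfact_comp.
Qed.

(* A natural functional on chains is the pairing with the cochain obtained by
   evaluating it at the universal series *)
Definition cochain_of k (T : forall W, chain_space (hmod M W) k -> W) : cochain M k :=
  insubd (0 : cochain M k) (fun a => T _ (chain a (xiu k))).

Lemma cochain_ofE k (T : forall W, chain_space (hmod M W) k -> W) a : natural T ->
  cochain_of T a = T _ (chain a (xiu k)).
Proof. by move=> nT; rewrite /cochain_of /insubd insubT //; apply: cochain_of_proof. Qed.

(** A Yoneda argument: up to the second component, xi is the image of the universal series under its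
    own functional [sbar xi]. *)
Lemma pair_cochain_of k (T : forall W, chain_space (hmod M W) k -> W) W w : natural T ->
  pair (cochain_of T) w = T W w.
Proof.
move=> hT; have [lT nT] := hT; move: w; apply: chain_ext => [||a xi]; [exact: pair_linear_r|exact: lT|].
(* [nmap] of the identity erases the second component of xi, as the image of the universal series
   has none; by naturality this does not change the value of T. *)
have li : linear (fun x : W => x) by exact: linear_id.
rewrite pairE cochain_ofE // -(nT _ _ _ (sbar_linear xi)) -[RHS](nT _ _ _ li); congr T.
have hd := nmap_dhom M li; have hs := nmap_dhom M (sbar_linear xi).
rewrite !cmapE //; apply: tch_ext => m; apply: nmodP => // v; apply: (mfact_inj (m := m)).
have -> : ((nmap (sbar_linear xi) \o xiu k) m).1 v *+ mfact m = sbar xi ((xiu k m).1 v *+ mfact m).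
  by rewrite (linear_fun_muln (sbar_linear xi)).
by rewrite xiu_mfact sbarE pbar_mono.
Qed.

Lemma cochainP k (c c' : cochain M k) :
  (forall W (w : chain_space (hmod M W) k), pair c w = pair c' w) -> c = c'.
Proof. by move=> e; apply: val_inj; apply: funext => a; rewrite /= -!pair_xiu e. Qed.

Lemma tpairP (c c' : Cochains M) :
  (forall W (w : Chains (hmod M W)), tpair c w = tpair c' w) -> c = c'.
Proof.
by move=> e; apply: dsumP => k; apply: cochainP => W w; rewrite -!tpair_din e.
Qed.

Definition tnatural (T : forall W, Chains (hmod M W) -> W) : Prop :=
  (forall W, linear (T W)) /\
  forall W W' (f : W -> W') (lf : linear f) w, T W' (tmap (nmap lf) w) = f (T W w).

Lemma tnatural_din T k : tnatural T -> natural (fun W (w : chain_space (hmod M W) k) => T W (din w)).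
Proof.
case=> lT nT; split=> [W|W W' f lf w]; first exact: linear_comp (lT W) (@din_linear _ _ _ _).
by rewrite -nT tmap_din //; apply: nmap_dhom.
Qed.

(** Cochains form a direct sum, so a functional T is represented only if it vanishes from some
    degree n on. *)
Definition tcoch (T : forall W, Chains (hmod M W) -> W) n : Cochains M :=
  \sum_(k < n) dinj (fun k => cochain M k : lmodType F) k (cochain_of (fun W w => T W (din w))).

Lemma tpair_tcoch T n W w : tnatural T ->
  (forall W k (w : chain_space (hmod M W) k), (n <= k)%N -> T W (din w) = 0) ->
  tpair (tcoch T n) w = T W w.
Proof.
move=> hT hn; have [lT _] := hT; move: w; apply: total_ext => [||k w]; [exact: tpair_linear_r|exact: lT|].
rewrite /tcoch (linear_fun_sum (tpair_linear (din w))).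
pose S j := tpair (dinj (fun k => cochain M k : lmodType F) j (cochain_of (fun W w => T W (din w)))) (din w).
have Sk : S k = T W (din w).
  by rewrite /S tpair_din dinj_id (pair_cochain_of w (tnatural_din k hT)).
have Sj j : j != k -> S j = 0.
  by move=> njk; rewrite /S tpair_din dinj_neq // (linear_fun0 (pair_linear w)).
have [kn|nk] := ltnP k n; last first.
  rewrite (hn _ _ _ nk) big1 // => j _; apply: Sj; rewrite neq_ltn.
  by rewrite (leq_trans (ltn_ord j) nk).
rewrite (bigD1 (Ordinal kn)) //= -/(S k) Sk big1 ?addr0 // => j njk; exact: Sj.
Qed.

Definition cbound (c : Cochains M) : nat := (\max_(i <- supp c) i).+1.

Lemma cboundP (c : Cochains M) k : (cbound c <= k)%N -> c k = 0.
Proof.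
move=> h; apply/eqP; apply: contraTT h; rewrite -mem_supp -ltnNge => h.
by rewrite /cbound ltnS; apply: (leq_bigmax_seq (F := id)).
Qed.

End Universal.

(** * The calculus structure *)

(** C(h, 2) counts the inversions of the reversal of h letters. *)
Lemma bin2D h k : 'C(h + k, 2) = ('C(h, 2) + 'C(k, 2) + h * k)%N.
Proof.
elim: h => [|h ih]; first by rewrite add0n mul0n addn0 bin0n.
by rewrite addSn !binS !bin1 ih; lia.
Qed.

Section Calculus.
Variables (F : fieldType) (charF : [pchar F]%R =i pred0).
Variables (R : lieConformalAlgebra F) (M : lcaModuleAlgebra R).
Implicit Type W : lmodType F.

Let ld A n : linear (@din F R A n). Proof. exact: din_linear. Qed.
Let hA W := @hmul_mact F R M W.
Let hmu W := mact_pairing (hA W).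
Let hE W := mact_ev (hA W).
Let lb W := tbv_linear (hE W).
Let lP W := tw_linear (hmu W).
Let lPr W := tw_linear_r (hmu W).

(* d and iota_X are the transposes of the boundary operator and of X wedge - *)
Definition cd (c : Cochains M) : Cochains M :=
  tcoch charF (fun W w => tpair c (tbv (@hev F R M W) w)) (cbound c).+1.

Lemma cd_pair c W w : tpair (cd c) w = tpair c (tbv (@hev F R M W) w).
Proof.
have h W' : linear (fun w => tpair c (tbv (@hev F R M W') w)).
  exact: linear_comp (tpair_linear_r c) (@lb W').
apply: (tpair_tcoch charF) => [|W' [|k] w' hk] //.
- split=> [W'|W' W'' f lf w']; first exact: h.
  by rewrite -(tmap_tbv (hE W') w' (hE W'') (nmap_evhom M lf)) tpair_nmap.
by rewrite (tbv_dinS (hE W')) tpair_din cboundP // (linear_fun0 (pair_linear _)).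
Qed.

(* the sign of the order-reversing permutation, in each degree *)
Definition sgm (x : Chains M) : Chains M := dlift (fun h X => (-1) ^+ 'C(h, 2) *: @din F R M h X) x.

Lemma sgm_linear : linear sgm.
Proof. by apply: dlift_linear => h; apply: linear_scale; apply: ld. Qed.

Lemma sgm_din h (X : chain_space M h) : sgm (din X) = (-1) ^+ 'C(h, 2) *: din X.
Proof.
Transparent din.
by apply: dliftE => j; apply: linear_scale; apply: ld.
Opaque din.
Qed.

Lemma tpair_tw0 (c : Cochains M) W (x : Chains M) k (w : chain_space (hmod M W) k) :
  (forall h, c (h + k)%N = 0) -> tpair c (tw (@hmul F R M W) x (din w)) = 0.
Proof.
move=> hc; move: x; apply: total_ext => [||h X]; last first.
- by rewrite tw_degree // tpair_din hc (linear_fun0 (pair_linear _)).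
- exact: linear_zero.
exact: linear_comp (tpair_linear_r c) (lP _).
Qed.

(** Since [nmap] and [hmul] may disagree in the second component, both sides are compared after
    erasing it, through the pairing [nu]. *)
Lemma tw_nmap (c : Cochains M) W W' (f : W -> W') (lf : linear f) x w :
  tpair c (tw (@hmul F R M W') x (tmap (nmap lf) w)) = f (tpair c (tw (@hmul F R M W) x w)).
Proof.
have li := @linear_id F W'; have hn := nmap_dhom M li; have hf := nmap_dhom M lf.
pose nu m y := nmap li (@hmul F R M W' m y).
have hnu : pairing nu.
  have [[ml mr] mD] := hmu W'; have [ln Dn] := hn; split.
    by split=> [y|m]; [exact: linear_comp ln (ml y)|exact: linear_comp ln (mr m)].
  by move=> m y; rewrite /nu -Dn mD (linear_funD ln).
rewrite -(tpair_nmap lf) -(tpair_nmap li); congr tpair.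
have h1 := tmap_tw (hmu W') x (tmap (nmap lf) w) hnu (@dhom_id _ _ _) (@dhom_id _ _ _) hn (fun _ _ => erefl).
have e m y : nmap lf (@hmul F R M W m y) = nu m (nmap lf y).
  by apply: nmodP.
have h2 := tmap_tw (hmu W) x w hnu (@dhom_id _ _ _) hf hf e.
by rewrite h1 h2 [tmap _ (tmap _ w)]tmap_id.
Qed.

Definition ci (x : Chains M) (c : Cochains M) : Cochains M :=
  tcoch charF (fun W w => tpair c (tw (@hmul F R M W) (sgm x) w)) (cbound c).

Lemma ci_pair x c W w : tpair (ci x c) w = tpair c (tw (@hmul F R M W) (sgm x) w).
Proof.
apply: (tpair_tcoch charF) => [|W' k w' hk] //.
- split=> [W'|W' W'' f lf w']; first exact: linear_comp (tpair_linear_r c) (lPr _).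
  exact: tw_nmap.
by apply: tpair_tw0 => h; apply: cboundP; apply: leq_trans hk (leq_addl _ _).
Qed.

Opaque cd ci sgm tpair tw.

Lemma cd_linear : linear cd.
Proof.
move=> s c c'; apply: (tpairP charF) => W w.
by rewrite cd_pair !tpair_linear !cd_pair.
Qed.

Lemma cd_cd c : cd (cd c) = 0.
Proof.
apply: (tpairP charF) => W w.
by rewrite !cd_pair (tbv_tbv (hE W)) (linear_fun0 (tpair_linear_r _)) (linear_fun0 (tpair_linear _)).
Qed.

Lemma ci_bilinear : bilinear_op ci.
Proof.
split=> [c|x] s u v; apply: (tpairP charF) => W w.
  apply: etrans (ci_pair (s *: u + v) c w) (esym (etrans (tpair_linear w s (ci u c) (ci v c)) _)).
  apply: etrans (congr2 (fun y z => s *: y + z) (ci_pair u c w) (ci_pair v c w)) _.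
  have l := linear_comp (tpair_linear_r c) (linear_comp (@lP W w) sgm_linear).
  exact/esym/l.
apply: etrans (ci_pair x (s *: u + v) w) (esym (etrans (tpair_linear w s (ci x u) (ci x v)) _)).
apply: etrans (congr2 (fun y z => s *: y + z) (ci_pair x u w) (ci_pair x v w)) _.
exact/esym/(tpair_linear (tw (@hmul F R M W) (sgm x) w)).
Qed.

Lemma sgm_parity p x : dsum_parity p x -> dsum_parity p (sgm x).
Proof.
move: x; apply: dsum_parity_ind => [|u v hu hv|h X ph].
- by rewrite (linear_fun0 sgm_linear).
- by rewrite (linear_funD sgm_linear) -[X in X + _]scale1r; apply: dsum_parity_linear.
have -> : dinj (fun k => chain_space M k) h X = din X by [].
rewrite sgm_din -[_ *: _]addr0; apply: dsum_parity_linear => //.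
rewrite -ph; exact: dsum_parity_dinj.
Qed.

(** The binomial sign fails to be multiplicative by (-1)^(hk), the sign of graded commutativity,
    hence the reversed order; it offsets the reversal caused by transposition. *)
Lemma sgm_cwd x y : sgm (cwd x y) = cwd (sgm y) (sgm x).
Proof.
have [cl cr] := proj1 (@cwd_is_wedge F R M); have ls := sgm_linear.
move: x; apply: total_ext => [||h X].
- exact: linear_comp ls (cl y).
- exact: linear_comp (cr _) ls.
move: y; apply: total_ext => [||k Y].
- exact: linear_comp ls (cr _).
- exact: linear_comp (cl _) ls.
have [_ _ comm _] := @cwd_comm_assoc F R M.
rewrite !sgm_din (linear_funZ (cr _)) (linear_funZ (cl _)) scalerA.
have -> : cwd (din X) (din Y) = din (cwd (din X) (din Y) (h + k)%N) by apply: tw_degree; apply: mul_pairing.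
rewrite sgm_din; have <- : cwd (din X) (din Y) = din (cwd (din X) (din Y) (h + k)%N).
  by apply: tw_degree; apply: mul_pairing.
rewrite (comm _ _ _ _ (dsum_parity_dinj X) (dsum_parity_dinj Y)) scalerA; congr (_ *: _).
rewrite -!exprD -[LHS]signr_odd -[RHS]signr_odd; congr (_ ^+ nat_of_bool _).
by rewrite bin2D !oddD oddM; case: (odd 'C(h, 2)); case: (odd 'C(k, 2)); case: (odd h && odd k).
Qed.

End Calculus.

Global Opaque cd ci sgm tpair tw tcoch.

Section CalculusLaws.
Variables (F : fieldType) (charF : [pchar F]%R =i pred0).
Variables (R : lieConformalAlgebra F) (M : lcaModuleAlgebra R).
Implicit Type W : lmodType F.

Local Notation cd := (@cd F charF R M).
Local Notation ci := (@ci F charF R M).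
Local Notation sgm := (@sgm F R M).
Local Notation cbr := (@cbr F R M).
Local Notation chains := (Chains M).

Let ld A n : linear (@din F R A n). Proof. exact: din_linear. Qed.
Let hA W := @hmul_mact F R M W.
Let hmu W := mact_pairing (hA W).
Let hE W := mact_ev (hA W).
Let lb W := tbv_linear (hE W).
Let lP W := tw_linear (hmu W).
Let lPr W := tw_linear_r (hmu W).

(** The bracket has degree n = h + k - 1, and C(n, 2) = C(h, 2) + C(k, 2) + hk - (h + k - 1); modulo
    2 the last part is 1 + h + (h + 1)k, the exponents on the right. *)
Lemma sgm_cbr p q x y : dsum_parity p x -> dsum_parity q y ->
  sgm (cbr x y) = - ((-1) ^+ p *: ((-1) ^+ (~~ p && q) *: cbr (sgm x) (sgm y))).
Proof.
move=> px qy; have [cl cr] := @cbr_bilinear F R M; have ls := @sgm_linear F R M.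
move: x px; apply: dsum_parity_ext => [||h X ph].
- exact: linear_comp ls (cl _).
- apply: linear_opp; do 2!apply: linear_scale; exact: linear_comp (cl _) ls.
move: y qy; apply: dsum_parity_ext => [||k Y qk].
- exact: linear_comp ls (cr _).
- apply: linear_opp; do 2!apply: linear_scale; exact: linear_comp (cr _) ls.
(* For h = k = 0 the bracket has no degree n with n + 1 = h + k; both sides vanish then. *)
have [n hn] : exists n, n.+1 = (h + k)%N \/ (h = 0%N /\ k = 0%N).
  by case: h {X ph} => [|h]; [case: k {Y qk} => [|k]; [exists 0%N; right|exists k; left]|exists (h + k)%N; left].
case: hn => [hn|[h0 k0]]; last first.
  subst h k; have z (X' Y' : chain_space M 0) : cbr (din X') (din Y') = 0 by apply: cbr_degree0.
  rewrite [cbr _ _]z (linear_fun0 ls).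
  have e := etrans (congr1 (cbr^~ _) (sgm_din X)) (congr1 (cbr _) (sgm_din Y)).
  rewrite [cbr _ _]e (linear_funZ (cl _)) (linear_funZ (cr _)) [cbr _ _]z.
  by rewrite !scaler0 oppr0.
change (sgm (cbr (din X) (din Y)) = - ((-1) ^+ p *: ((-1) ^+ (~~ p && q) *: cbr (sgm (din X)) (sgm (din Y))))).
have e : sgm (cbr (din X) (din Y)) = (-1) ^+ 'C(n, 2) *: cbr (din X) (din Y).
  have := cbr_degree X Y; rewrite -hn /=; move: (dcoef _ n) => Z ->; exact: sgm_din.
have e2 := etrans (congr1 (cbr^~ _) (sgm_din X)) (congr1 (cbr _) (sgm_din Y)).
rewrite e [in RHS]e2 (linear_funZ (cl _)) (linear_funZ (cr _)) !scalerA -scaleNr; congr (_ *: _).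
have b : odd 'C(n, 2) = ~~ (odd h (+) (~~ odd h && odd k) (+) odd 'C(h, 2) (+) odd 'C(k, 2)).
  have := congr1 odd (bin2D h k); rewrite -hn binS bin1 !oddD oddM.
  have -> : odd n = ~~ (odd h (+) odd k) by rewrite -oddD -hn /= negbK.
  by case: (odd 'C(n, 2)); case: (odd 'C(h, 2)); case: (odd 'C(k, 2)); case: (odd h); case: (odd k).
rewrite -signr_odd b -[(-1) ^+ 'C(h, 2)]signr_odd -[(-1) ^+ 'C(k, 2)]signr_odd -ph -qk.
by case: (odd 'C(h, 2)); case: (odd 'C(k, 2)); case: (odd h); case: (odd k);
  rewrite /= ?expr0 ?expr1 ?mulr1 ?mul1r ?mulrN1 ?mulN1r ?opprK.
Qed.

(** The sign of [iota_X, d] depends on the parity of X; spreading it over the degrees makes L_X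
    linear in an inhomogeneous X. *)
Definition tau (x : chains) : chains := dlift (fun h X => (-1) ^+ h *: @din F R M h X) x.

Lemma tau_linear : linear tau.
Proof. by apply: dlift_linear => h; apply: linear_scale; apply: ld. Qed.

Lemma tauE p x : dsum_parity p x -> tau x = (-1) ^+ p *: x.
Proof.
move: x; apply: dsum_parity_ext => [||h X <-]; [exact: tau_linear|exact: linear_scale (@linear_id _ _)|].
rewrite signr_odd.
Transparent din.
by rewrite /tau dliftE // => j; apply: linear_scale; apply: ld.
Opaque din.
Qed.

Definition cL (x : chains) (c : Cochains M) : Cochains M := ci x (cd c) - cd (ci (tau x) c).

Lemma cL_scomm p x : dsum_parity p x -> cL x =1 scomm p true (ci x) cd.
Proof.
move=> px c; have [il ir] := @ci_bilinear F charF R M; have lD := @cd_linear F charF R M.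
rewrite /cL /scomm andbT (tauE px); congr (_ - _).
apply: etrans (congr1 cd (linear_funZ (il c) _ _)) _; exact: (linear_funZ lD).
Qed.

Lemma cL_bilinear : bilinear_op cL.
Proof.
have [il ir] := @ci_bilinear F charF R M; have lD := @cd_linear F charF R M; split=> [c|x].
  by apply: linear_sub; [exact: il|exact: linear_comp lD (linear_comp (il c) tau_linear)].
by apply: linear_sub; [exact: linear_comp (ir x) lD|exact: linear_comp lD (ir _)].
Qed.

(** Up to sign the Lie derivative is the transpose of the supercommutator of X wedge - with delta,
    so its relations follow from those of [Kop]. *)
Lemma cL_pair p x c W w : dsum_parity p x ->
  tpair (cL x c) w = (-1) ^+ p *: tpair c (Kop (tbv (@hev F R M W)) p (tw (@hmul F R M W) (sgm x)) w).
Proof.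
move=> px; rewrite (cL_scomm px) /scomm andbT /Kop.
have lr := tpair_linear_r c (W := W); have ll := tpair_linear w.
apply: etrans (linear_funB ll _ _) _.
apply: etrans (congr2 (fun u v => u - v) (ci_pair charF x _ w) (linear_funZ ll _ _)) _.
apply: etrans (congr2 (fun u v => u - _ *: v) (cd_pair charF _ _) (cd_pair charF _ _)) _.
apply: etrans (congr1 (fun v => _ - _ *: v) (ci_pair charF x _ _)) _.
apply: esym; apply: etrans (congr1 (fun v => _ *: v) (linear_funB lr _ _)) _.
apply: etrans (congr1 (fun v => _ *: (v - _)) (linear_funZ lr _ _)) _.
by rewrite scalerBr scalerA -signr_addb addbb scale1r.
Qed.

Lemma cochain0P k (c : Cochains M) :
  (forall W (w : chain_space (hmod M W) k), tpair c (din w) = 0) -> c k = 0.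
Proof.
move=> h; apply: (cochainP charF) => W w.
by rewrite -tpair_din h (linear_fun0 (pair_linear w)).
Qed.

Lemma cd_degree (c : Cochains M) k : cd c k.+1 != 0 -> c k != 0.
Proof.
apply: contraNneq => h; apply/eqP; apply: cochain0P => W w; apply: etrans (cd_pair charF c (din w)) _.
by rewrite (tbv_dinS (hE W)) tpair_din h (linear_fun0 (pair_linear _)).
Qed.

Lemma cd_degree0 (c : Cochains M) : cd c 0%N = 0.
Proof.
apply: cochain0P => W w; apply: etrans (cd_pair charF c (din w)) _.
by rewrite (tbv_din0 (hE W)) (linear_fun0 (tpair_linear_r _)).
Qed.

Lemma ci_degree (x : chains) (c : Cochains M) k : ci x c k != 0 ->
  exists h, x h != 0 /\ c (h + k)%N != 0.
Proof.
move=> nz; apply: contrapT => h; move/eqP: nz; apply; apply: cochain0P => W w.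
apply: etrans (ci_pair charF x c (din w)) _.
rewrite (dsum_sum x) (linear_fun_sum (@sgm_linear F R M)) (linear_fun_sum (@lP W _)).
rewrite (linear_fun_sum (tpair_linear_r c)) big1_seq // => i /andP[_]; rewrite mem_supp => xi.
have ci0 : c (i + k)%N = 0.
  by apply/eqP/negPn/negP => nc; apply: h; exists i.
have e : sgm (dinj (fun k => chain_space M k) i (x i)) = (-1) ^+ 'C(i, 2) *: din (x i) by apply: sgm_din.
rewrite e (linear_funZ (@lP W _)) (linear_funZ (tpair_linear_r c)) tw_degree; last exact: hmu.
by rewrite tpair_din ci0 (linear_fun0 (pair_linear _)) scaler0.
Qed.

Lemma cd_parity p c : dsum_parity p c -> dsum_parity (~~ p) (cd c).
Proof.
move=> pc [|k] hk; first exact: cd_degree0.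
apply/eqP; apply: contraTT hk => /cd_degree nz; rewrite negbK /=.
by rewrite (inj_eq negb_inj); apply: contraNT nz => /pc ->.
Qed.

Lemma ci_parity p q x c : dsum_parity p x -> dsum_parity q c -> dsum_parity (p (+) q) (ci x c).
Proof.
move=> px qc k hk; apply/eqP; apply: contraTT hk => /ci_degree [h [xh ch]]; rewrite negbK.
have <- : odd h = p by apply/eqP; apply: contraNT xh => /px ->.
have <- : odd (h + k) = q by apply/eqP; apply: contraNT ch => /qc ->.
by rewrite oddD addKb.
Qed.

Lemma cL_parity p q x c : dsum_parity (~~ p) x -> dsum_parity q c -> dsum_parity (p (+) q) (cL x c).
Proof.
move=> px qc; rewrite /cL (tauE px) addrC -scaleN1r; apply: dsum_parity_linear.
  rewrite -[p (+) q]negbK; apply: cd_parity; rewrite -addNb; apply: ci_parity => //.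
  by rewrite -[_ *: x]addr0; apply: dsum_parity_linear.
have -> : p (+) q = ~~ p (+) ~~ q by case: p q {px qc} => -[].
by apply: ci_parity => //; apply: cd_parity.
Qed.

Lemma cochains_super_complex : super_complex (@dsum_parity F _) cd.
Proof.
split; [exact: dsum_superspace|exact: cd_linear| |exact: cd_cd].
by move=> p c; apply: cd_parity.
Qed.

Lemma ci_module : superalgebra_module (@dsum_parity F _) (@cwd F R M) (@dsum_parity F _) ci.
Proof.
split; first by split=> [|p q x c px qc]; [exact: ci_bilinear|exact: ci_parity].
move=> x y c; apply: (tpairP charF) => W w; apply: etrans (ci_pair charF _ _ _) _.
apply: etrans _ (esym (ci_pair charF x (ci y c) w)).
apply: etrans _ (esym (ci_pair charF y c _)); apply: (congr1 (tpair c)).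
rewrite sgm_cwd; apply: tw_assoc => //; try exact: hmu; first exact: mul_pairing.
by move=> u v z; rewrite (mact_assoc (hA W)).
Qed.

Lemma tw_sgm_cbr W p q x y : dsum_parity p x -> dsum_parity q y ->
  tw (@hmul F R M W) (sgm (cbr x y)) = fun w => - ((-1) ^+ p * (-1) ^+ (~~ p && q)) *:
    Bop (tbv (@hev F R M W)) p q (tw (@hmul F R M W) (sgm x)) (tw (@hmul F R M W) (sgm y)) w.
Proof.
move=> px qy; apply: funext => w.
rewrite -(tw_cbr (hA W) w (sgm_parity px) (sgm_parity qy)) (sgm_cbr px qy) scaleNr.
by rewrite (linear_funN (@lP W w)) !(linear_funZ (@lP W w)) scalerA.
Qed.

Lemma cL_module : lie_superalgebra_module (rev_parity (@dsum_parity F _)) cbr (@dsum_parity F _) cL.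
Proof.
split; first by split=> [|p q x c px qc]; [exact: cL_bilinear|exact: cL_parity].
move=> p q x y px qy c; apply: (tpairP charF) => W w.
have lT := tpair_linear_r c (W := W); have ll := tpair_linear w.
have lx := @lPr W (sgm x); have ly := @lPr W (sgm y).
apply: etrans (cL_pair c w (cbr_parity px qy)) _; rewrite (tw_sgm_cbr W px qy).
rewrite (Kop_scale (@lb W)).
rewrite (Kop_Bop (@lb W) (tbv_tbv (hE W)) _ _ lx ly) (linear_funZ lT) (linear_funB lT) (linear_funZ lT).
rewrite !negbK; apply: esym; apply: etrans (linear_funB ll _ _) _.
apply: etrans (congr2 (fun u v => u - v) (cL_pair _ _ px) (linear_funZ ll _ _)) _.
apply: etrans (congr2 (fun u v => _ *: u - _ *: v) (cL_pair _ _ qy) (cL_pair _ _ qy)) _.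
apply: etrans (congr1 (fun v => _ - _ *: (_ *: v)) (cL_pair _ _ px)) _.
(* Transposition has reversed the order of the two factors; the signs are compared parity by
   parity. *)
by case: (p); case: (q); rewrite /= ?(expr0, expr1, mulr1, mul1r, mulrN1, opprK, scale1r, scaleN1r); zmod.
Qed.

Lemma cL_ci p q x y : dsum_parity p x -> dsum_parity q y ->
  scomm (~~ p) q (cL x) (ci y) =1 ci (cbr x y).
Proof.
move=> px qy c; apply: (tpairP charF) => W w.
have lT := tpair_linear_r c (W := W); have ll := tpair_linear w.
apply: esym; apply: etrans (ci_pair charF _ c w) _; rewrite (tw_sgm_cbr W px qy) (linear_funZ lT).
rewrite /Bop (linear_funB lT) (linear_funZ lT).
apply: esym; apply: etrans (linear_funB ll _ _) _.
apply: etrans (congr2 (fun u v => u - v) (cL_pair _ _ px) (linear_funZ ll _ _)) _.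
apply: etrans (congr2 (fun u v => _ *: u - _ *: v) (ci_pair charF y c _) (ci_pair charF y _ w)) _.
apply: etrans (congr1 (fun v => _ - _ *: v) (cL_pair _ _ px)) _.
by case: (p); case: (q); rewrite /= ?(expr0, expr1, mulr1, mul1r, mulrN1, opprK, scale1r, scaleN1r); zmod.
Qed.

Lemma chains_calculus : calculus_structure (@dsum_parity F _) (@cwd F R M) cbr
  (@dsum_parity F _) cd ci cL.
Proof.
split; [by split; [exact: chains_gerstenhaber|exact: cochains_super_complex]|exact: ci_module| | |].
- exact: cL_module.
- by move=> p q x y px qy; apply: cL_ci.
- by move=> p x px; apply: cL_scomm.
Qed.

End CalculusLaws.

(** * Agreement with the formulas for the differential and the contraction *)

Section Formulas.
Variables (F : fieldType) (charF : [pchar F]%R =i pred0).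
Variables (R : lieConformalAlgebra F) (M : lcaModuleAlgebra R).
Implicit Type W : lmodType F.

Local Notation xiu := (@xiu F charF R M).
Local Notation cd := (@cd F charF R M).
Local Notation ci := (@ci F charF R M).

(** As in [nphi_sum], powers of lambda_i + lambda_j see theta only on x_i = x_j; the induction rests
    on [diag_sum]. *)
Lemma pbar_merge_mono W k (i j : 'I_k) n (theta : expo k -> hmod M W) (u : expo k) v :
  i != j -> u i = 0%N -> u j = 0%N ->
  pbar theta (iter n (fun q => mulX i q + mulX j q) (mono u v)) =
    (\sum_(s < n.+1) theta (upd (upd u j s) i (n - s)%N)).1 v *+ (n`! * mfact u).
Proof.
move=> nij ui uj; elim: n theta => [|n ih] theta.
  rewrite big_ord1 mul1n [LHS]pbar_mono; congr ((theta _).1 v *+ _); apply: funext => l.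
  rewrite /upd; case: eqP => [->|_]; first by rewrite ui.
  by case: eqP => [->|].
rewrite iterS (linear_funD (pbar_linear theta)) !pbar_mulX !ih -mulrnDl.
rewrite -(linear_funD (fst_eval v)) -big_split /=.
have e : \sum_(s < n.+1) (derX i theta (upd (upd u j s) i (n - s)%N) +
      derX j theta (upd (upd u j s) i (n - s)%N)) =
    (\sum_(s < n.+2) theta (upd (upd u j s) i (n.+1 - s)%N)) *+ n.+1.
  rewrite (diag_sum (fun p q => theta (upd (upd u j q) i p))); apply: eq_bigr => s _.
  rewrite /derX upd_id updK upd_neq 1?eq_sym // upd_id; congr (_ + theta _ *+ _).
  by rewrite (updC _ _ _ nij) updK.
by rewrite e (linear_fun_muln (fst_eval v)) -mulrnA factS mulnA.
Qed.

Lemma mfact_upd0 k (m : expo k) i : mfact m = ((m i)`! * mfact (upd m i 0%N))%N.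
Proof.
rewrite /mfact (bigD1 i) //= [in RHS](bigD1 i) //= upd_id mul1n; congr (_ * _)%N.
by apply: eq_bigr => j nj; rewrite upd_neq.
Qed.

(** Substituting lambda_i + lambda_j in a polynomial is dual to setting x_j = x_i in a series. *)
Lemma pbar_merge W k (i j : 'I_k.+1) (theta : expo k.+1 -> hmod M W) p : i != j ->
  pbar theta (mergeX i j p) = pbar (diagS i j theta) p.
Proof.
move=> nij; rewrite /mergeX (lext_comp _ _ (pbar_linear theta)); apply: eq_lext => m v /=.
rewrite pbar_merge_mono ?upd_id // ?upd_neq 1?eq_sym ?ins_id // -mfact_upd0 mfact_ins mul1n.
apply: (congr1 (fun x : hmod M W => x.1 v *+ _)); apply: eq_bigr => s _; congr theta.
have e x : ins j x m i = ins j 0 m i by rewrite -(upd_ins_id j 0) upd_neq.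
by rewrite e (updC _ _ _ nij) updK upd_ins_id.
Qed.

Lemma pbar_iter_mulX W k l i (theta : expo k -> hmod M W) p :
  pbar theta (iter l (mulX i) p) = pbar (iter l (derX i) theta) p.
Proof. by elim: l theta => [|l ih] theta //; rewrite iterS pbar_mulX ih iterSr. Qed.

Lemma pbar_actX k (i : 'I_k.+1) b (p : vpoly k M) :
  pbar (@hev F R M _ b \o curi i (xiu k.+1)) p = coef_pi (actX i b p).
Proof.
have lc := @coef_pi_linear F R M k.+1.
rewrite /actX (lext_comp _ _ lc); apply: eq_lext => m v.
rewrite (lext_comp _ _ lc) /= /nev_fun /lext -sumrMnl; apply: eq_bigr => n _.
by rewrite -(xiu_mfact charF) mfact_ins mulrnA.
Qed.

Lemma pair_tch W k (c : cochain M k) a (xi : expo k -> hmod M W) (p : vpoly k M) :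
  xi \in @is_series F R (hmod M W) k -> coef_pi p = c a -> pair c (tch a xi) = pbar xi p.
Proof. by move=> h e; rewrite /tch pairE -e sbarE (serE h). Qed.

(** Pairing with the universal series returns the value of a cochain; the summands of the boundary
    then transpose one by one to those of the formula. A lift enters only through its class. *)
Lemma cd_is_differential : is_differential cd.
Proof.
split; [exact: cd_linear|exact: cd_degree0|move=> c k c' hc a].
have hA := hmul_mact M (coef_space M k.+1); have hE := mact_ev hA.
have hx := xseries_valP (xiu k.+1).
have lc := @coef_pi_linear F R M k.+1.
have lT := tpair_linear_r c (W := coef_space M k.+1).
rewrite -(pair_xiu charF) -tpair_din; apply: etrans (cd_pair charF c _) _.
rewrite (tbv_chain _ _ hE) (linear_funD lT) !(linear_fun_sum lT).
rewrite /differential_formula (linear_funD lc) !(linear_fun_sum lc); congr (_ + _).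
  apply: eq_bigr => i _; rewrite (linear_funZ lc) tpair_din.
  rewrite (linear_funZ (@pair_linear_r _ _ _ _ _ _)) -pbar_actX; congr (_ *: _).
  by apply: pair_tch; [exact: dhom_series (ev_dhom hE _) (curi_series i hx)|exact: hc].
apply: eq_bigr => i _; rewrite (linear_fun_sum lT) (linear_fun_sum lc); apply: eq_bigr => j ij.
have nij : i != j by apply: contraTneq ij => ->; rewrite ltnn.
rewrite (linear_funZ lc) tpair_din (linear_funZ (@pair_linear_r _ _ _ _ _ _)); congr (_ *: _).
rewrite (lext_comp _ _ lc) (lext_comp _ _ (@pair_linear_r _ _ _ _ _ _)); apply: eq_lext => l e.
rewrite -(pbar_xiu charF) pbar_iter_mulX pbar_merge //.
by apply: pair_tch; [exact: diag_series|exact: hc].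
Qed.

(** In the product of X with the universal series the factorials split: those of the first h
    variables are the ones in [contract], the others turn the universal coefficients back into
    monomials. *)
Lemma ci_is_contraction : is_contraction ci.
Proof.
split=> [|h a phi c k b p hp]; first exact: ci_bilinear.
have hA := hmul_mact M (coef_space M k); have hm := mact_pairing hA.
have lc := @coef_pi_linear F R M k; have hx := xseries_valP (xiu k).
rewrite -(pair_xiu charF) -tpair_din; apply: etrans (ci_pair charF _ c _) _.
have e : sgm (dinj (fun k => chain_space M k) h (chain a phi)) = (-1) ^+ 'C(h, 2) *: din (chain a phi).
  exact: sgm_din.
rewrite e (linear_funZ (tw_linear hm _)) (linear_funZ (tpair_linear_r c)) bin2 subn1 divn2.
congr (_ *: _); rewrite tw_chain // tpair_din.
rewrite (pair_tch (prodP_series hm (xseries_valP phi) hx) hp).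
rewrite /contract (lext_comp _ _ lc); apply: eq_lext => m v.
rewrite mfact_split mulnC mulrnA.
have -> : (prodP (@hmul F R M _) phi (xiu k) m).1 v =
    (xiu_fun M (m \o @rshift h k)).1 (lcma_mul (phi (m \o lshift k)) v) by [].
rewrite (xiu_mfact charF); apply: esym.
exact: (linear_fun_muln (linear_comp lc (@mono_linear F (expo k) M (m \o @rshift h k)))).
Qed.

Lemma ci_cL_graded : graded_calculus (@dsum_degree F _) (@dsum_degree F _) ci (cL charF (M := M)).
Proof.
have ciD m n x c : dsum_degree m x -> dsum_degree n c -> degree_sub (@dsum_degree F _) n m (ci x c).
  move=> xm cn; have nz k : ci x c k != 0 -> n = (m + k)%N.
    move=> /ci_degree [h [xh ch]].
    have <- : h = m by apply/eqP; apply: contraNT xh => /xm ->.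
    by apply/esym/eqP; apply: contraNT ch => /cn ->.
  rewrite /degree_sub; case: leqP => mn.
    by move=> k; apply: contraNeq => /nz; lia.
  by apply: dsumP => k; apply/eqP; apply: contraTT mn => /nz; lia.
have cdD n c : dsum_degree n c -> dsum_degree n.+1 (cd c).
  move=> cn [|k] nk; first exact: cd_degree0.
  by apply/eqP; apply: contraTT nk => /cd_degree ck; rewrite negbK eqSS; apply: contraNT ck => /cn ->.
move=> m n x c xm cn; split; first exact: ciD.
have tm : dsum_degree m (tau x).
  move=> k km; rewrite (dsum_sum x) (linear_fun_sum (@tau_linear F R M)).
  have l : linear (fun y : Chains M => y k) by [].
  rewrite (linear_fun_sum l) big1_seq // => i /andP[_]; rewrite mem_supp => xi.
  have im : i = m by apply/eqP; apply: contraNT xi => /xm ->.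
  rewrite (tauE (dsum_parity_dinj (x i))) (linear_funZ l) dinj_neq ?scaler0 //.
  by rewrite im eq_sym.
have h1 := ciD _ _ _ _ xm (cdD _ _ cn); have h2 := ciD _ _ _ _ tm cn.
have -> : cL charF x c = ci x (cd c) - cd (ci (tau x) c) by [].
have ll k : linear (fun y : Cochains M => y k) by [].
move: h1 h2; rewrite /degree_sub; case: (leqP m n) => mn.
  rewrite leqW // subSn // => h1 h2 k nk.
  by rewrite (linear_funB (ll k)) h1 // (cdD _ _ h2) // subrr.
(* For m > n the contraction of c vanishes, so that L_X c is the contraction of d c alone. *)
move=> h1 ->; rewrite (linear_fun0 (@cd_linear F charF R M)) subr0.
exact: h1.
Qed.

End Formulas.

Theorem theorem4p11 (F : fieldType) (charF : [pchar F]%R =i pred0)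
    (R : lieConformalAlgebra F) (M : lcaModuleAlgebra R) :
  exists (w br : Chains M -> Chains M -> Chains M) (d : Cochains M -> Cochains M)
      (iota L : Chains M -> Cochains M -> Cochains M),
    [/\ is_wedge w /\ is_bracket br,
        is_differential d,
        is_contraction iota,
        calculus_structure (@dsum_parity F _) w br (@dsum_parity F _) d iota L &
        graded_calculus (@dsum_degree F _) (@dsum_degree F _) iota L].
Proof.
exists (@cwd F R M), (@cbr F R M), (@cd F charF R M), (@ci F charF R M), (@cL F charF R M).
split.
- by split; [exact: cwd_is_wedge|exact: cbr_is_bracket].
- exact: cd_is_differential.
- exact: ci_is_contraction.
- exact: chains_calculus.
- exact: ci_cL_graded.
Qed.
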